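(* For every $N\in L^2(\mathcal G_T;\mathbb R^k)$ there exist a unique random variable $N_0\in L^2(\mathcal F^\alpha_T;\mathbb R^k)$ and a unique stochastic process $Z=\{Z_t;0\le t\le T\}\in M^2_{\mathcal G_t}(0,T;\mathbb R^{k\times d})$ such that $$N=N_0+\int_0^TZ_t\,dB_t.$$ Moreover, $N_0=E(N\mid\mathcal F^\alpha_T)$.
   Context: $(\Omega,\mathcal F,P)$ is a probability space, $T>0$ is fixed, $B=\{B_t;0\le t\le T\}$, $B_0=0$, is a $d$-dimensional Brownian motion, and $\alpha=\{\alpha_t;0\le t\le T\}$ is a continuous-time Markov chain with finite state space $\mathcal M=\{1,\dots,m\}$, independent of $B$. $\mathcal N$ is the class of $P$-null sets of $\mathcal F$, $\mathcal F^\eta_t=\sigma\{\eta_r;0\le r\le t\}$ for a process $\eta$, and $\mathcal G_t=\mathcal F^B_t\vee\mathcal F^\alpha_T\vee\mathcal N$, $0\le t\le T$, which is a filtration. $L^2(\mathcal A;\mathbb R^k)$ is the space of square-integrable $\mathcal A$-measurable $\mathbb R^k$-valued random variables; $M^2_{\mathcal G_t}(0,T;\mathbb R^{k\times d})$ is the space of $\mathcal G_t$-adapted $\mathbb R^{k\times d}$-valued processes $\varphi$ with $E\int_0^T|\varphi_t|^2dt<\infty$. Uniqueness is up to a.s. equality of random variables, respectively $dP\otimes dt$-a.e. equality of processes. *)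

(* Defs.v *)
From HB Require Import structures.
From mathcomp Require Import all_boot all_order all_algebra.
From mathcomp Require Import all_classical all_reals all_analysis.

Set Implicit Arguments.
Unset Strict Implicit.
Unset Printing Implicit Defensive.

Import Order.TTheory GRing.Theory Num.Theory.
Import numFieldNormedType.Exports.

Local Open Scope classical_set_scope.
Local Open Scope ring_scope.

(* Processes are functions R -> Omega -> S of which only the values at times
   in [0, T] matter. Vectors of R^k are column vectors 'cV_k, and matrices
   carry the Borel sigma-algebra of R^(p * q), i.e. the one generated by the
   entries. *)

(* |A|^2 for the Euclidean (Frobenius) norm; the library's `|A| is the sup
   norm. *)
Definition sqnorm (R : realType) (p q : nat) (A : 'M[R]_(p, q)) : R :=
  \sum_(i < p) \sum_(j < q) A i j ^+ 2.

Section sigma_algebras.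
Context {disp : measure_display} {Omega : measurableType disp} {R : realType}.

Definition mx_sigma (p q : nat) (X : Omega -> 'M[R]_(p, q)) :
    set (set Omega) :=
  <<s \bigcup_(ij in [set: 'I_p * 'I_q])
        preimage_set_system setT (fun w => X w ij.1 ij.2) measurable >>.

Definition discrete_sigma (S : Type) (X : Omega -> S) : set (set Omega) :=
  preimage_set_system setT X [set: set S].

Definition mx_measurable (A : set (set Omega)) (p q : nat)
    (X : Omega -> 'M[R]_(p, q)) : Prop :=
  mx_sigma X `<=` A.

(* F^eta_t, where sig X is the sigma-algebra generated by one variable X *)
Definition nat_filtration (S : Type) (sig : (Omega -> S) -> set (set Omega))
    (eta : R -> Omega -> S) (t : R) : set (set Omega) :=
  <<s \bigcup_(r in `[0, t]) sig (eta r) >>.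

Definition mx_filtration (p q : nat) (eta : R -> Omega -> 'M[R]_(p, q)) :
    R -> set (set Omega) :=
  nat_filtration (@mx_sigma p q) eta.

Definition chain_filtration (S : Type) (eta : R -> Omega -> S) :
    R -> set (set Omega) :=
  nat_filtration (@discrete_sigma S) eta.

End sigma_algebras.

Section probability_notions.
Context {disp : measure_display} {Omega : measurableType disp} {R : realType}.
Variable P : probability Omega R.

Definition null_sets : set (set Omega) :=
  [set A | measurable A /\ P A = 0%E].

Definition indep_sigma (F G : set (set Omega)) : Prop :=
  forall A C, F A -> G C -> P (A `&` C) = (P A * P C)%E.

Definition cond_prob (A C : set Omega) : R := fine (P (A `&` C)) / fine (P C).

Definition in_L2 (A : set (set Omega)) (p q : nat)
    (X : Omega -> 'M[R]_(p, q)) : Prop :=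
  mx_measurable A X /\ (\int[P]_w (sqnorm (X w))%:E < +oo)%E.

(* Y is a version of E(X | A) *)
Definition is_cond_exp (A : set (set Omega)) (p q : nat)
    (X Y : Omega -> 'M[R]_(p, q)) : Prop :=
  [/\ mx_measurable A Y,
      forall i j, P.-integrable setT (fun w => (Y w i j)%:E) &
      forall D, A D -> forall i j,
        (\int[P]_(w in D) (Y w i j)%:E = \int[P]_(w in D) (X w i j)%:E)%E].

(* d-dimensional standard Brownian motion on [0, T] *)
Record brownian_motion (T : R) (d : nat) (B : R -> Omega -> 'cV[R]_d) : Prop :=
  BrownianMotion {
    bm_measurable : forall t : R, 0 <= t <= T -> mx_measurable measurable (B t);
    bm_start : {ae P, forall w, B 0 w = 0};
    bm_continuous :
      {ae P, forall w, {within `[0, T], continuous (fun t => B t w)}};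
    bm_incr_indep : forall s t : R, 0 <= s -> s < t -> t <= T ->
      indep_sigma (mx_filtration B s) (mx_sigma (fun w => B t w - B s w));
    (* the increment has law N(0, (t - s) I_d), given on Borel boxes; the
       second parameter of normal_prob is the standard deviation *)
    bm_incr_law : forall s t : R, 0 <= s -> s < t -> t <= T ->
      forall U : 'I_d -> set R, (forall i, measurable (U i)) ->
      (P [set w | forall i, U i ((B t w - B s w)%R i ord0)] =
       \prod_(i < d) normal_prob 0%R (Num.sqrt (t - s)%R) (U i))%E }.

(* Markov chain on [0, T] with m states; neither time-homogeneity nor
   regularity of the paths is required *)
Record markov_chain (T : R) (m : nat) (alpha : R -> Omega -> 'I_m) : Prop :=
  MarkovChain {
    mc_measurable : forall t : R, 0 <= t <= T ->
      discrete_sigma (alpha t) `<=` measurable;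
    mc_markov : forall s t : R, 0 <= s -> s <= t -> t <= T ->
      forall (i j : 'I_m) (A : set Omega), chain_filtration alpha s A ->
      (0 < P (A `&` [set w | alpha s w = i]))%E ->
      cond_prob [set w | alpha t w = j] (A `&` [set w | alpha s w = i]) =
      cond_prob [set w | alpha t w = j] [set w | alpha s w = i] }.

(* G_t = F^B_t \/ F^alpha_T \/ N *)
Definition enlarged_filtration (T : R) (d m : nat) (B : R -> Omega -> 'cV[R]_d)
    (alpha : R -> Omega -> 'I_m) (t : R) : set (set Omega) :=
  <<s mx_filtration B t `|` chain_filtration alpha T `|` null_sets >>.

Section integrands.
Variables (T : R) (G : R -> set (set Omega)).

(* E \int_0^T |Z_t|^2 dt *)
Definition M2_sqnorm (p q : nat) (Z : R -> Omega -> 'M[R]_(p, q)) : \bar R :=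
  (\int[P]_w \int[lebesgue_measure]_(t in `[0%R, T]) (sqnorm (Z t w))%:E)%E.

(* The space M^2_G(0, T); joint measurability is what gives a meaning to
   M2_sqnorm. *)
Definition in_M2 (p q : nat) (Z : R -> Omega -> 'M[R]_(p, q)) : Prop :=
  [/\ forall i j, measurable_fun ([set: Omega] `*` `[0, T])
        (fun x : Omega * measurableTypeR R => Z x.2 x.1 i j),
      forall t : R, 0 <= t <= T -> mx_measurable (G t) (Z t) &
      (M2_sqnorm Z < +oo)%E].

(* \sum_(l < n) xi_l 1_]t_l, t_(l+1)] *)
Record simple_process (p q : nat) := SimpleProcess {
  sp_size : nat;
  sp_time : nat -> R;
  sp_coef : nat -> Omega -> 'M[R]_(p, q) }.

Definition sp_adapted (p q : nat) (S : simple_process p q) : Prop :=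
  [/\ sp_time S 0%N = 0 /\ sp_time S (sp_size S) = T,
      forall l, (l < sp_size S)%N -> sp_time S l < sp_time S l.+1,
      forall l, (l < sp_size S)%N ->
        mx_measurable (G (sp_time S l)) (sp_coef S l) &
      exists M : R, forall l w i j, (l < sp_size S)%N ->
        `|sp_coef S l w i j| <= M].

Definition sp_val (p q : nat) (S : simple_process p q) (t : R) (w : Omega) :
    'M[R]_(p, q) :=
  \sum_(l < sp_size S)
    \1_(`]sp_time S l, sp_time S l.+1]) t *: sp_coef S l w.

Definition sp_integral (p q : nat) (B : R -> Omega -> 'cV[R]_q)
    (S : simple_process p q) (w : Omega) : 'cV[R]_p :=
  \sum_(l < sp_size S)
    sp_coef S l w *m (B (sp_time S l.+1) w - B (sp_time S l) w).

(* I = \int_0^T Z_t dB_t: the Ito integral is the L^2 limit of the integrals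
   of bounded adapted simple processes converging to Z in M^2. It is a
   relation because the limit is only determined almost surely. *)
Definition is_ito_integral (p q : nat) (B : R -> Omega -> 'cV[R]_q)
    (Z : R -> Omega -> 'M[R]_(p, q)) (I : Omega -> 'cV[R]_p) : Prop :=
  in_L2 measurable I /\
  exists S : nat -> simple_process p q,
    [/\ forall n, sp_adapted (S n),
        (fun n => M2_sqnorm (fun t w => sp_val (S n) t w - Z t w))
          @ \oo --> (0 : \bar R)%E &
        (fun n => (\int[P]_w (sqnorm (sp_integral B (S n) w - I w)%R)%:E)%E)
          @ \oo --> (0 : \bar R)%E].

(* N = N0 + \int_0^T Z_t dB_t almost surely *)
Definition ito_representation (p q : nat) (B : R -> Omega -> 'cV[R]_q)
    (N N0 : Omega -> 'cV[R]_p) (Z : R -> Omega -> 'M[R]_(p, q)) : Prop :=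
  exists2 I, is_ito_integral B Z I & {ae P, forall w, N w = N0 w + I w}.

End integrands.
End probability_notions.

(* Main.v *)
(* Only two features of the Markov chain matter: F^alpha_T is a sigma-algebra
   of events, and it is independent of B.  Let Y = 1_A cos (theta + sum_j
   lambda_j . B_(r_j)) with A in F^alpha_T.  On a uniform grid of mesh T / n the
   times r_j may be replaced by grid points, so that Y = 1_A cos (x_n) with x_i
   = x_(i-1) + s_i and s_i a linear form of the i-th Brownian increment.  Writing
   cos (x + s) = cos x cos s - sin x sin s and a_i = E cos s_i, a telescoping
   sum expresses Y as an F^alpha_T-measurable variable, minus a sum of 1_A
   (prod_(k > i) a_k) sin (x_(i-1)) s_i, which is a stochastic integral of a
   simple process, plus martingale differences of the form cos (x_(i-1))
   (cos s_i - a_i) and errors sin (x_(i-1)) (s_i - sin s_i), whose total L^2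
   norm squared is O(1/n).  The bounded variables generated by such Y through
   linear combinations and bounded limits form an algebra containing the
   indicators of all events of G_T, so every N in L^2(G_T) is an L^2 limit of
   N0_q + int S_q dB with N0_q measurable for F^alpha_T and S_q simple.  Bounded
   F^alpha_T-measurable variables are orthogonal to stochastic integrals, so by
   the isometry N0_q and S_q converge separately, to N0 and Z.  The same
   orthogonality gives N0 = E(N | F^alpha_T), whence uniqueness of N0, and the
   isometry gives uniqueness of Z. *)

Require Import Defs.
From HB Require Import structures.
From mathcomp Require Import all_boot all_order all_algebra.
From mathcomp Require Import all_classical all_reals all_analysis.
From mathcomp Require Import measurable_realfun ring lra.

Set Implicit Arguments.
Unset Strict Implicit.
Unset Printing Implicit Defensive.

Import Order.TTheory GRing.Theory Num.Theory.
Import numFieldNormedType.Exports.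

Local Open Scope classical_set_scope.
Local Open Scope ring_scope.

(** * Square-integrable functions *)

(** Cosines keep everything bounded: coefficients of simple processes must be bounded, and bounded
    limits need a uniform bound. The free phase theta makes sines available as shifted cosines. The
    weights prod a_k absorb the second-order term of cos (x + s), so only a term linear in the
    increments has to be represented, and no Ito formula enters. The rate 1/n has two origins. The n
    martingale differences have squared norm O(n^-2) each and are orthogonal, so they add up to
    O(1/n). The n errors are not orthogonal, and summing them costs a further factor n; this is
    affordable because each is cubic in the increment, with squared norm O(n^-3). Hence the Gaussian
    moments of order 4 and 6, for which crude bounds suffice, whereas the second moment must be
    exact for the isometry. B_0 = 0 holds only almost surely, so phases use increments from time 0,
    and null functions are put into the approximable class to return to B itself. All estimates
    concern squared norms, with |f + g|^2 <= 2 |f|^2 + 2 |g|^2 as triangle inequality. *)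

Section square_integrable.
Context d (T : measurableType d) (R : realType).
Variable mu : {measure set T -> \bar R}.
Implicit Types f g : T -> R.

Definition intg f := mu.-integrable setT (EFin \o f).

Definition sqint f := measurable_fun setT f /\ intg (fun x => f x ^+ 2).

Lemma intg_meas f : intg f -> measurable_fun setT f.
Proof. by case/integrableP => /measurable_EFinP. Qed.

Lemma intg_le f g : measurable_fun setT f -> (forall x, `|f x| <= g x) ->
  intg g -> intg f.
Proof.
move=> mf fg ig; apply: le_integrable ig => //; first exact/measurable_EFinP.
by move=> x _ /=; rewrite lee_fin (le_trans (fg x))// ler_norm.
Qed.

Lemma intgD f g : intg f -> intg g -> intg (fun x => f x + g x).
Proof. exact: integrableD. Qed.

Lemma intgB f g : intg f -> intg g -> intg (fun x => f x - g x).
Proof. by move=> i_f i_g; exact: (integrableB measurableT i_f i_g). Qed.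

Lemma intgZ c f : intg f -> intg (fun x => c * f x).
Proof. exact: integrableZl. Qed.

Lemma intg_norm f : intg f -> intg (fun x => `|f x|).
Proof. exact: integrable_abse. Qed.

Lemma intg_sum (I : Type) (r : seq I) (F : I -> T -> R) :
  (forall i, intg (F i)) -> intg (fun x => \sum_(i <- r) F i x).
Proof.
move=> iF; elim: r => [|i r IH].
  rewrite (_ : (fun _ => _) = cst 0); first exact: integrable0.
  by apply/funext => x; rewrite big_nil.
rewrite (_ : (fun _ => _) = fun x => F i x + \sum_(j <- r) F j x).
  exact: intgD.
by apply/funext => x; rewrite big_cons.
Qed.

Lemma Rintegral_bigsum (I : Type) (r : seq I) (F : I -> T -> R) :
  (forall i, intg (F i)) ->
  \int[mu]_x (\sum_(i <- r) F i x) = \sum_(i <- r) \int[mu]_x F i x.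
Proof.
move=> iF; elim: r => [|i r IH].
  rewrite big_nil (@eq_Rintegral _ _ _ _ _ (cst 0)).
    by rewrite Rintegral_cst ?mul0r.
  by move=> x _; rewrite big_nil.
rewrite big_cons -IH -RintegralD//; [|exact: iF|exact: intg_sum].
by apply: eq_Rintegral => x _; rewrite big_cons.
Qed.

Lemma EFin_Rintegral f : intg f ->
  (\int[mu]_x (f x)%:E)%E = (\int[mu]_x f x)%:E.
Proof. by move=> i_f; rewrite fineK//; exact: integrable_fin_num. Qed.

(** Follows from the domination |f g| <= f^2 + g^2. *)
Lemma sqint_mul f g : sqint f -> sqint g -> intg (fun x => f x * g x).
Proof.
move=> [mf if2] [mg ig2].
apply: (@intg_le _ (fun x => f x ^+ 2 + g x ^+ 2)); last exact: intgD.
  exact: measurable_funM.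
by move=> x; rewrite normrM; have := sqr_ge0 (`|f x| - `|g x|);
  rewrite -(real_normK (num_real (f x))) -(real_normK (num_real (g x)));
  have := normr_ge0 (f x); have := normr_ge0 (g x); nra.
Qed.

Lemma sqintZ c f : sqint f -> sqint (fun x => c * f x).
Proof.
move=> [mf if2]; split; first exact: measurable_funM.
rewrite (_ : (fun _ => _) = fun x => c ^+ 2 * f x ^+ 2); first exact: intgZ.
by apply/funext => x; rewrite exprMn.
Qed.

Lemma sqintN f : sqint f -> sqint (fun x => - f x).
Proof.
move=> /(sqintZ (-1)); rewrite (_ : (fun _ => _) = fun x => - f x)//.
by apply/funext => x; rewrite mulN1r.
Qed.

Lemma sqintD f g : sqint f -> sqint g -> sqint (fun x => f x + g x).
Proof.
move=> sf sg; have [mf if2] := sf; have [mg ig2] := sg.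
split; first exact: measurable_funD.
rewrite (_ : (fun _ => _) = fun x => (f x ^+ 2 + g x ^+ 2) + 2 * (f x * g x)).
  by apply: intgD; [exact: intgD|apply: intgZ; exact: sqint_mul].
by apply/funext => x; ring.
Qed.

Lemma sqintB f g : sqint f -> sqint g -> sqint (fun x => f x - g x).
Proof. by move=> sf sg; apply: sqintD => //; exact: sqintN. Qed.

Lemma sqint0 : sqint (fun=> 0).
Proof.
split => //; rewrite /intg (_ : _ \o _ = cst 0); first exact: integrable0.
by apply/funext => x /=; rewrite expr0n.
Qed.

Lemma sqint_sum (I : Type) (r : seq I) (F : I -> T -> R) :
  (forall i, sqint (F i)) -> sqint (fun x => \sum_(i <- r) F i x).
Proof.
move=> iF; elim: r => [|i r IH].
  rewrite (_ : (fun _ => _) = fun=> 0); first exact: sqint0.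
  by apply/funext => x; rewrite big_nil.
rewrite (_ : (fun _ => _) = fun x => F i x + \sum_(j <- r) F j x).
  exact: sqintD.
by apply/funext => x; rewrite big_cons.
Qed.

Lemma sqint_le f g : measurable_fun setT f -> (forall x, `|f x| <= `|g x|) ->
  sqint g -> sqint f.
Proof.
move=> mf fg [mg ig]; split => //.
apply: (intg_le _ _ ig); first exact: measurable_funX.
move=> x; rewrite normrX -(real_normK (num_real (g x))).
by apply: lerXn2r (fg x); rewrite nnegrE.
Qed.

Lemma sqint_bndM f g M : measurable_fun setT f -> (forall x, `|f x| <= M) ->
  sqint g -> sqint (fun x => f x * g x).
Proof.
move=> mf fM sg; apply: (@sqint_le _ (fun x => M * g x)); last exact: sqintZ.
  by apply: measurable_funM => //; case: sg.
move=> x; rewrite !normrM ler_wpM2r// (le_trans (fM x))//.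
exact: ler_norm.
Qed.

Lemma sqint_ereal f : measurable_fun setT f ->
  (\int[mu]_x (f x ^+ 2)%:E < +oo)%E -> sqint f.
Proof.
move=> mf foo; split => //; apply/integrableP; split.
  exact/measurable_EFinP/measurable_funX.
rewrite (eq_integral (fun x => (f x ^+ 2)%:E))// => x _ /=.
by rewrite ger0_norm// sqr_ge0.
Qed.

(** The squared L^2 norm as a real number. It is 0 by default when the integral is infinite, so it
    is meaningful only together with [sqint]. *)
Definition sqnm f : R := \int[mu]_x (f x ^+ 2).

Lemma sqnm_ge0 f : 0 <= sqnm f.
Proof. by apply: Rintegral_ge0 => x _; exact: sqr_ge0. Qed.

Lemma eq_sqnm f g : f =1 g -> sqnm f = sqnm g.
Proof. by move=> fg; apply: eq_Rintegral => x _; rewrite fg. Qed.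

Lemma sqint_sqnmE f : sqint f -> (\int[mu]_x (f x ^+ 2)%:E)%E = (sqnm f)%:E.
Proof. by case=> _ /EFin_Rintegral. Qed.

Lemma sqnm_le f g : sqint f -> sqint g -> (forall x, `|f x| <= `|g x|) ->
  sqnm f <= sqnm g.
Proof.
move=> [mf if2] [mg ig2] fg; apply: le_Rintegral => // x _.
rewrite -(real_normK (num_real (f x))) -(real_normK (num_real (g x))).
by apply: lerXn2r (fg x); rewrite nnegrE.
Qed.

Lemma sqnmZ c f : sqint f -> sqnm (fun x => c * f x) = c ^+ 2 * sqnm f.
Proof.
move=> [_ if2]; rewrite -RintegralZl//; apply: eq_Rintegral => x _.
by rewrite exprMn.
Qed.

Lemma sqnmN f : sqnm (fun x => - f x) = sqnm f.
Proof. by apply: eq_Rintegral => x _; rewrite sqrrN. Qed.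

Lemma sqnmBC f g : sqnm (fun x => f x - g x) = sqnm (fun x => g x - f x).
Proof. by rewrite -sqnmN; apply: eq_sqnm => x; rewrite opprB. Qed.

(** From 2 f g <= f^2 + g^2. It replaces the triangle inequality and spares square roots; its
    factors 2 determine by how much later epsilons are divided. *)
Lemma sqnmD_le f g : sqint f -> sqint g ->
  sqnm (fun x => f x + g x) <= 2 * sqnm f + 2 * sqnm g.
Proof.
move=> sf sg; have [mf if2] := sf; have [mg ig2] := sg.
rewrite -!RintegralZl// -RintegralD//; [|exact: intgZ|exact: intgZ].
apply: le_Rintegral => //; first by case: (sqintD sf sg).
  by apply: intgD; exact: intgZ.
by move=> x _; have := sqr_ge0 (f x - g x); nra.
Qed.

Lemma sqnmD f g : sqint f -> sqint g ->
  sqnm (fun x => f x + g x) =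
  sqnm f + 2 * \int[mu]_x (f x * g x) + sqnm g.
Proof.
move=> sf sg; have [mf if2] := sf; have [mg ig2] := sg.
have ifg := sqint_mul sf sg.
rewrite -RintegralZl// -!RintegralD//; [|exact: intgD (intgZ _ _)|exact: intgZ].
by apply: eq_Rintegral => x _; ring.
Qed.

Lemma sqnm_triangle3 f g h : sqint f -> sqint g -> sqint h ->
  sqnm (fun x => f x - h x) <=
  2 * sqnm (fun x => f x - g x) + 2 * sqnm (fun x => g x - h x).
Proof.
move=> sf sg sh; rewrite (@eq_sqnm _ (fun x => (f x - g x) + (g x - h x))).
  by apply: sqnmD_le; exact: sqintB.
by move=> x; ring.
Qed.

(** The factor n is the price of having no orthogonality; [sqnm_orth_sum] saves it for orthogonal
    terms. *)
Lemma sqnm_sum_le (n : nat) (F : 'I_n -> T -> R) : (forall i, sqint (F i)) ->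
  sqnm (fun x => \sum_(i < n) F i x) <= n%:R * \sum_(i < n) sqnm (F i).
Proof.
move=> sF.
rewrite -Rintegral_bigsum; last by move=> i; case: (sF i).
have isq : intg (fun x => \sum_(i < n) F i x ^+ 2).
  by apply: intg_sum => i; case: (sF i).
rewrite -RintegralZl//; apply: le_Rintegral => //.
- by case: (sqint_sum (index_enum 'I_n) sF).
- exact: intgZ.
move=> x _; rewrite expr2 mulr_suml.
(* AM-GM on each of the n^2 products *)
have -> : n%:R * (\sum_(i < n) F i x ^+ 2) =
    \sum_(i < n) \sum_(j < n) 2^-1 * (F i x ^+ 2 + F j x ^+ 2).
  under [RHS]eq_bigr do rewrite -mulr_sumr big_split/= sumr_const card_ord.
  rewrite -mulr_sumr big_split/= sumr_const card_ord sumrMnl -mulr_natl.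
  by field.
apply: ler_sum => i _; rewrite mulr_sumr; apply: ler_sum => j _.
by have := sqr_ge0 (F i x - F j x); lra.
Qed.

Lemma sqnm_orth_sum (n : nat) (F : 'I_n -> T -> R) : (forall i, sqint (F i)) ->
  (forall i j : 'I_n, (i < j)%N -> \int[mu]_x (F i x * F j x) = 0) ->
  sqnm (fun x => \sum_(i < n) F i x) = \sum_(i < n) sqnm (F i).
Proof.
move=> sF orth.
have iFF i j : intg (fun x => F i x * F j x) by exact: sqint_mul.
transitivity (\int[mu]_x (\sum_(i < n) \sum_(j < n) F i x * F j x)).
  apply: eq_Rintegral => x _; rewrite expr2 mulr_suml.
  by apply: eq_bigr => i _; rewrite mulr_sumr.
rewrite Rintegral_bigsum; last by move=> i; exact: intg_sum.
apply: eq_bigr => i _; rewrite Rintegral_bigsum// (bigD1 i)//= big1.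
  by rewrite addr0; apply: eq_Rintegral => x _; rewrite expr2.
move=> j; rewrite -(inj_eq val_inj) neq_ltn => /orP[ji|ij]; last exact: orth.
by rewrite -(orth _ _ ji); apply: eq_Rintegral => x _; rewrite mulrC.
Qed.

Lemma sqnm0_ae f : sqint f -> sqnm f = 0 -> {ae mu, forall x, f x = 0}.
Proof.
move=> [mf if2] f0.
have /ae_eq_integral_abs : (\int[mu]_(x in setT) `|(f x ^+ 2)%:E| = 0)%E.
  rewrite (eq_integral (fun x => (f x ^+ 2)%:E)).
    by rewrite EFin_Rintegral// -/(sqnm f) f0.
  by move=> x _ /=; rewrite ger0_norm// sqr_ge0.
move=> /(_ measurableT) H.
have /H : measurable_fun setT (fun x => (f x ^+ 2)%:E).
  exact/measurable_EFinP/measurable_funX.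
apply: filterS => x /= /(_ I) [] /eqP; rewrite sqrf_eq0 => /eqP; exact.
Qed.

Lemma ae_sqnm0 f : {ae mu, forall x, f x = 0} -> measurable_fun setT f ->
  sqint f /\ sqnm f = 0.
Proof.
move=> f0 mf.
have e : (\int[mu]_x (f x ^+ 2)%:E = 0)%E.
  rewrite (ae_eq_integral (cst 0%E)) ?integral0//.
    exact/measurable_EFinP/measurable_funX.
  by apply: filterS f0 => x /= -> _; rewrite expr0n.
by split; [apply: sqint_ereal; rewrite ?e|rewrite /sqnm /Rintegral e].
Qed.

(** Dominated convergence for (f - f_n)^2, which is at most 4 g^2. One good index is enough for the
    approximation arguments. *)
Lemma sqint_dominated (f_ : nat -> T -> R) f g :
  (forall n, measurable_fun setT (f_ n)) -> sqint g ->
  (forall n x, `|f_ n x| <= g x) -> (forall x, f_ n x @[n --> \oo] --> f x) ->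
  sqint f /\ forall e, 0 < e -> exists n, sqnm (fun x => f x - f_ n x) <= e.
Proof.
move=> mf_ sg f_g f_f; have [mg ig] := sg.
have mf : measurable_fun setT f.
  by apply: (measurable_fun_cvg mf_) => x _; exact: f_f.
have fg x : `|f x| <= g x.
  have -> : `|f x| = limn (fun n => `|f_ n x|).
    by apply/esym/cvg_lim => //; exact: cvg_norm (f_f x).
  apply: limr_le; first by apply/cvg_ex; exists `|f x|; exact: cvg_norm (f_f x).
  exact: nearW.
have gg x : g x <= `|g x| by exact: ler_norm.
have sf : sqint f.
  by apply: sqint_le mf _ sg => x; exact: le_trans (gg x).
have sf_ n : sqint (f_ n).
  by apply: sqint_le (mf_ n) _ sg => x; exact: le_trans (gg x).
split => // e e0.
pose D n x := ((f x - f_ n x) ^+ 2)%:E.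
have mD n : measurable_fun setT (D n).
  by apply/measurable_EFinP/measurable_funX/measurable_funB.
have cD : {ae mu, forall x, setT x -> D ^~ x @ \oo --> cst 0%E x}.
  apply: aeW => x _; apply/cvg_EFin; first exact: nearW.
  rewrite (_ : 0 = (f x - f x) ^+ 2); last by rewrite subrr expr0n.
  have h : f x - f_ n x @[n --> \oo] --> f x - f x.
    by apply: cvgB; [exact: cvg_cst|exact: f_f].
  exact: (cvgM h h).
have iD : mu.-integrable setT (EFin \o (fun x => 4 * g x ^+ 2)).
  exact: intgZ.
have bD : {ae mu, forall x n, setT x -> (`|D n x| <= (4 * g x ^+ 2)%:E)%E}.
  apply: aeW => x n _; rewrite lee_fin ger0_norm ?sqr_ge0//.
  have -> : 4 * g x ^+ 2 = (2 * g x) ^+ 2 by ring.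
  rewrite -(real_normK (num_real (f x - _))) lerXn2r ?nnegrE//.
    by rewrite mulr_ge0// (le_trans _ (fg x)).
  by rewrite (le_trans (ler_normB _ _))// mulr2n mulrDl mul1r lerD.
have [_ _] := dominated_convergence measurableT mD (measurable_cst 0%E) cD iD bD.
rewrite integral0 => /fine_cvgP[_ /cvgrPdist_le /(_ e e0) [n _ /(_ n (leqnn n))]].
rewrite /= sub0r normrN => h; exists n; apply: le_trans h.
exact: ler_norm.
Qed.

End square_integrable.

(** * Square-integrable random variables under a probability *)

Section finite_measure.
Context d (T : measurableType d) (R : realType).
Variable P : probability T R.
Implicit Types f g : T -> R.

Lemma bnd_intg f M : measurable_fun setT f -> (forall x, `|f x| <= M) ->
  intg P f.
Proof.
move=> mf fM; apply: (intg_le (g := cst M)) => //.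
exact: finite_measure_integrable_cst.
Qed.

Lemma bnd_sqint f M : measurable_fun setT f -> (forall x, `|f x| <= M) ->
  sqint P f.
Proof.
move=> mf fM; split => //; apply: (@bnd_intg _ (M ^+ 2)).
  exact: measurable_funX.
move=> x; rewrite normrX; apply: lerXn2r (fM x); rewrite nnegrE//.
exact: le_trans (fM x).
Qed.

Lemma sqint_intg f : sqint P f -> intg P f.
Proof.
move=> sf; rewrite (_ : f = fun x => f x * 1).
  apply: sqint_mul => //; apply: (@bnd_sqint _ 1) => // x.
  by rewrite normr1.
by apply/funext => x; rewrite mulr1.
Qed.

Lemma Rintegral_prob_cst c : \int[P]_x c = c.
Proof.
rewrite Rintegral_cst//; transitivity (c * fine 1%E); last by rewrite mulr1.
by congr (_ * fine _); exact: probability_setT.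
Qed.

Lemma sqnm_cst c : sqnm P (fun=> c) = c ^+ 2.
Proof. exact: Rintegral_prob_cst. Qed.

Lemma sqnm_bnd f M : measurable_fun setT f -> (forall x, `|f x| <= M) ->
  sqnm P f <= M ^+ 2.
Proof.
move=> mf fM; rewrite -[leRHS](Rintegral_prob_cst (M ^+ 2)).
apply: le_Rintegral => //; first by case: (bnd_sqint mf fM).
  exact: finite_measure_integrable_cst.
move=> x _; rewrite -(real_normK (num_real (f x))).
by apply: lerXn2r (fM x); rewrite nnegrE//; exact: le_trans (fM x).
Qed.

(** Jensen's inequality, by expanding 0 <= |f - m|^2 with [m] the mean of [f]. *)
Lemma sqr_Rintegral_le f : sqint P f -> (\int[P]_x f x) ^+ 2 <= sqnm P f.
Proof.
move=> sf; set m := \int[P]_x f x.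
have sm : sqint P (fun=> - m) by apply: (@bnd_sqint _ `|m|) => // x; rewrite normrN.
have := sqnm_ge0 P (fun x => f x + - m).
rewrite sqnmD// RintegralZr//; last exact: sqint_intg.
rewrite sqnm_cst -/m; lra.
Qed.

Lemma sqnm_center_le f : sqint P f ->
  sqnm P (fun x => f x - \int[P]_x f x) <= sqnm P f.
Proof.
move=> sf; set m := \int[P]_x f x.
have sm : sqint P (fun=> - m) by apply: (@bnd_sqint _ `|m|) => // x; rewrite normrN.
rewrite sqnmD// RintegralZr//; last exact: sqint_intg.
rewrite sqnm_cst -/m.
by have := sqr_ge0 m; lra.
Qed.

End finite_measure.

(** * Independence *)

(** [g_sigma_algebraType X] is the same carrier equipped with the sigma-algebra generated by [X], so
    measurability for a sub-sigma-algebra becomes ordinary measurability and inherits its closure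
    properties. *)
Notation gmeas X f :=
  (@measurable_fun _ _ (g_sigma_algebraType X) _ setT f).

Section sub_sigma_algebras.
Context d (T : measurableType d) (R : realType).
Implicit Types (X Y : set (set T)) (f g : T -> R).

Lemma measurable_id_gsa X : <<s X >> `<=` measurable ->
  @measurable_fun _ _ T (g_sigma_algebraType X) setT id.
Proof. by move=> Xm _ A mA; rewrite setTI; exact: Xm. Qed.

Lemma gmeas_measurable X f : <<s X >> `<=` measurable -> gmeas X f ->
  measurable_fun setT f.
Proof. by move=> Xm mf _ U mU; exact: Xm (mf measurableT U mU). Qed.

Lemma gmeas_sub X Y f : <<s X >> `<=` <<s Y >> -> gmeas X f -> gmeas Y f.
Proof. by move=> XY mf _ U mU; exact: XY (mf measurableT U mU). Qed.

Lemma gmeas_preimage X f (U : set R) : gmeas X f -> measurable U ->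
  <<s X >> (f @^-1` U).
Proof. by move=> mf mU; rewrite -[X in <<s _ >> X]setTI; exact: mf. Qed.

Lemma gmeasP X f :
  (forall U : set R, measurable U -> <<s X >> (f @^-1` U)) -> gmeas X f.
Proof. by move=> fX _ U mU; rewrite setTI; exact: fX. Qed.

Lemma gmeas_indic X A : <<s X >> A -> gmeas X (\1_A : T -> R).
Proof. by move=> XA; exact: measurable_indic. Qed.

End sub_sigma_algebras.

Section independence.
Context d (T : measurableType d) (R : realType) (P : probability T R).
Variables X Y : set (set T).
Hypotheses (Xm : <<s X >> `<=` measurable) (Ym : <<s Y >> `<=` measurable).
Hypothesis XY : indep_sigma P <<s X >> <<s Y >>.

Let TX : measurableType _ := g_sigma_algebraType X.
Let TY : measurableType _ := g_sigma_algebraType Y.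
Let iX : {mfun T >-> TX} :=
  HB.pack (id : T -> TX) (isMeasurableFun.Build _ _ _ _ _ (measurable_id_gsa Xm)).
Let iY : {mfun T >-> TY} :=
  HB.pack (id : T -> TY) (isMeasurableFun.Build _ _ _ _ _ (measurable_id_gsa Ym)).
(** The diagonal map into the square of the space, each factor carrying one of the two
    sigma-algebras. Independence means that its law is the product of the laws of [iX] and [iY]. *)
Let diag_fun (w : T) : (TX * TY)%type := (iX w, iY w).
Let mdiag : measurable_fun setT diag_fun.
Proof. exact: measurable_fun_pair. Qed.
Let diag : {mfun T >-> (TX * TY)%type} :=
  HB.pack diag_fun (isMeasurableFun.Build _ _ _ _ _ mdiag).

(** The integral of f g is that of a tensor product against the law of [diag]. This law agrees with
    the product measure on rectangles, hence everywhere, and Tonelli's theorem separates the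
    factors. *)
Let integral_indep_ge0 (f g : T -> \bar R) :
  measurable_fun setT (f : TX -> \bar R) ->
  measurable_fun setT (g : TY -> \bar R) ->
  (forall x, 0 <= f x)%E -> (forall x, 0 <= g x)%E ->
  (\int[P]_x (f x * g x) = \int[P]_x f x * \int[P]_x g x)%E.
Proof.
move=> mf mg f0 g0.
pose h (z : TX * TY) := (f z.1 * g z.2)%E.
have mh : measurable_fun setT h.
  by apply: emeasurable_funM; exact: measurableT_comp.
have h0 z : (0 <= h z)%E by rewrite mule_ge0.
transitivity (\int[distribution P diag]_z h z)%E.
  by rewrite ge0_integral_distribution.
transitivity (\int[distribution P iX \x distribution P iY]_z h z)%E.
  apply: eq_measure_integral => A mA _.
  apply/esym/product_measure_unique => // B C mB mC; exact: XY.
rewrite fubini_tonelli1// /fubini_F /h/=.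
under eq_integral do rewrite ge0_integralZl//.
rewrite ge0_integralZr//; last exact: integral_ge0.
by rewrite ge0_integral_distribution// ge0_integral_distribution.
Qed.

(** Integrability is bundled in because it is needed when positive and negative parts are recombined
    by additivity. *)
Let indep2 (f g : T -> R) :=
  intg P (fun x => f x * g x) /\
  \int[P]_x (f x * g x) = \int[P]_x f x * \int[P]_x g x.

Let indep2_ge0 (f g : T -> R) : gmeas X f -> gmeas Y g ->
  (forall x, 0 <= f x) -> (forall x, 0 <= g x) -> intg P f -> intg P g ->
  indep2 f g.
Proof.
move=> mf mg f0 g0 i_f i_g.
have E : (\int[P]_x (f x * g x)%:E = (\int[P]_x f x * \int[P]_x g x)%:E)%E.
  rewrite EFinM -!EFin_Rintegral//.
  by rewrite -integral_indep_ge0//; exact/measurable_EFinP.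
split; last by rewrite /Rintegral E.
apply/integrableP; split.
  by apply/measurable_EFinP/measurable_funM; [exact: intg_meas i_f|
    exact: intg_meas i_g].
rewrite (eq_integral (fun x => (f x * g x)%:E)) ?E ?ltry// => x _ /=.
by rewrite ger0_norm// mulr_ge0.
Qed.

Let indep2B (f1 f2 g : T -> R) : intg P f1 -> intg P f2 ->
  indep2 f1 g -> indep2 f2 g -> indep2 (fun x => f1 x - f2 x) g.
Proof.
move=> if1 if2 [i1 e1] [i2 e2]; rewrite /indep2.
have -> : (fun x => (f1 x - f2 x) * g x) = (fun x => f1 x * g x - f2 x * g x).
  by apply/funext => x; rewrite mulrBl.
by split; [exact: intgB|rewrite !RintegralB// e1 e2 mulrBl].
Qed.

Let indep2C (f g : T -> R) : indep2 f g -> indep2 g f.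
Proof.
rewrite /indep2 => -[i e].
have -> : (fun x => g x * f x) = (fun x => f x * g x).
  by apply/funext => x; rewrite mulrC.
by split; rewrite // e mulrC.
Qed.

Lemma indep_Rintegral (f g : T -> R) : gmeas X f -> gmeas Y g ->
  intg P f -> intg P g ->
  intg P (fun x => f x * g x) /\
  \int[P]_x (f x * g x) = \int[P]_x f x * \int[P]_x g x.
Proof.
move=> mf mg i_f i_g; rewrite -/(indep2 f g).
have ifp : intg P f^\+ by exact: integrable_funrpos.
have ifn : intg P f^\- by exact: integrable_funrneg.
have igp : intg P g^\+ by exact: integrable_funrpos.
have ign : intg P g^\- by exact: integrable_funrneg.
have split_pn (h : T -> R) : h = fun x => h^\+ x - h^\- x.
  exact/esym/funrposBneg.
rewrite (split_pn f) (split_pn g).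
(* Bilinearity leaves the four products of positive and negative parts; [indep2C] exchanges the
   roles so that the second factor can be split too. *)
apply: indep2B => //; apply: indep2C; apply: indep2B => //; apply: indep2C;
  apply: indep2_ge0 => //; by [exact: measurable_funrpos|
    exact: measurable_funrneg].
Qed.

End independence.

(** * Gaussian moments *)

Section gaussian_moments.
Context {R : realType}.
Local Notation leb := (@lebesgue_measure R).
Import HBNNSimple.

(** [normal_prob] is given on sets, as an integral of the density. The formula extends to simple
    functions by linearity, and to [f] by monotone convergence on both sides. *)
Lemma ge0_integral_normal_prob (m s : R) (f : measurableTypeR R -> \bar R) :
  measurable_fun setT f -> (forall x, 0 <= f x)%E ->
  (\int[normal_prob m s]_x f x = \int[leb]_x (f x * (normal_pdf m s x)%:E))%E.
Proof.
move=> mf f0; pose g := nnsfun_approx measurableT mf.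
have mp := measurable_normal_pdf m s.
have gcvg x : (g n x)%:E @[n --> \oo] --> f x.
  by apply: cvg_nnsfun_approx => // *; exact: f0.
have gpcvg x : ((g n x)%:E * (normal_pdf m s x)%:E)%E @[n --> \oo] -->
    (f x * (normal_pdf m s x)%:E)%E.
  by apply: cvgeZr => //; exact: gcvg.
transitivity (limn (fun n => \int[normal_prob m s]_x (g n x)%:E)%E).
  rewrite -monotone_convergence//.
  - by apply: eq_integral => y _; apply/esym/cvg_lim => //; exact: gcvg.
  - by move=> n; exact/measurable_EFinP/measurable_funP.
  - by move=> n y _; rewrite lee_fin.
  - by move=> y _ a b ab; rewrite lee_fin; exact/lefP/nd_nnsfun_approx.
transitivity (limn (fun n => \int[leb]_x ((g n x)%:E * (normal_pdf m s x)%:E))%E);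
    last first.
  rewrite -monotone_convergence//.
  - by apply: eq_integral => y _; apply/cvg_lim => //; exact: gpcvg.
  - by move=> n; apply/measurable_EFinP/measurable_funM.
  - by move=> n y _; rewrite -EFinM lee_fin mulr_ge0// normal_pdf_ge0.
  - move=> y _ a b ab; rewrite -!EFinM lee_fin ler_wpM2r ?normal_pdf_ge0//.
    exact/lefP/nd_nnsfun_approx.
congr (limn _); apply/funext => n.
rewrite integralT_nnsfun sintegralE.
transitivity (\int[leb]_x (\sum_(r \in range (g n))
    (r%:E * ((\1_(g n @^-1` [set r]) x)%:E * (normal_pdf m s x)%:E))))%E; last first.
  apply: eq_integral => x _; rewrite [in RHS]fimfunE -fsumEFin//.
  rewrite ge0_mule_fsuml; last by move=> r; exact: nnfun_muleindic_ge0.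
  by apply: eq_fsbigr => r _; rewrite EFinM muleA.
rewrite ge0_integral_fsum//; last 2 first.
- by move=> r; apply/measurable_EFinP; do 2 apply: measurable_funM => //.
- move=> r x _; rewrite muleA mule_ge0 ?lee_fin ?normal_pdf_ge0//.
  exact: nnfun_muleindic_ge0.
apply: eq_fsbigr => r /set_mem [x _ <-].
rewrite ge0_integralZl//.
- congr (_ * _)%E; rewrite /normal_prob [LHS]integral_mkcond.
  by apply: eq_integral => y _; rewrite patchE indicE; case: ifP => _;
    rewrite ?mul1e ?mul0e.
- by apply/measurable_EFinP; apply: measurable_funM.
- by move=> y _; rewrite mule_ge0 ?lee_fin ?normal_pdf_ge0.
- by rewrite lee_fin.
Qed.

Lemma normal_pdf0E (s : R) : s != 0 -> forall x,
  normal_pdf 0 s x = normal_peak s * expR (- (s ^+ 2 *+ 2)^-1 * x ^+ 2).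
Proof.
move=> s0 x; rewrite normal_pdfE// /normal_fun subr0; congr (_ * expR _).
by rewrite mulrC mulrN mulNr mulrC.
Qed.

(** Comparison with the normal density of standard deviation q = sqrt 2 * s. With y = x^2 / (4 s^2)
    the two exponentials are exp (- 2 y) and exp (- y), the power is y^n (4 s^2)^n, and y^n <= n!
    exp y by the exponential series. The ratio sqrt 2 of the normalising constants is rounded up to
    2. *)
Lemma integral_even_moment_le (s : R) n : 0 < s ->
  (\int[leb]_x (x ^+ n.*2 * normal_pdf 0 s x)%:E <=
   (n`!%:R * 2 * 4 ^+ n * s ^+ n.*2)%:E)%E.
Proof.
move=> s0; have s0' : s != 0 by rewrite gt_eqF.
pose q := Num.sqrt 2 * s.
have q0 : 0 < q by rewrite mulr_gt0// sqrtr_gt0.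
have q2 : q ^+ 2 = 2 * s ^+ 2 by rewrite exprMn sqr_sqrtr.
set K := n`!%:R * 2 * 4 ^+ n * s ^+ n.*2.
have K0 : 0 <= K by rewrite !mulr_ge0// ?exprn_ge0// ltW.
have -> : K%:E = (\int[leb]_x (K * normal_pdf 0 q x)%:E)%E.
  under eq_integral do rewrite EFinM.
  rewrite ge0_integralZl_EFin ?integral_normal_pdf ?mule1//.
    by move=> x _; rewrite lee_fin normal_pdf_ge0.
  by apply/measurable_EFinP; exact: measurable_normal_pdf.
apply: ge0_le_integral => //.
- move=> x _; rewrite lee_fin mulr_ge0 ?normal_pdf_ge0// -mul2n exprM.
  by rewrite exprn_ge0// sqr_ge0.
- by apply/measurable_EFinP/measurable_funM => //; exact: measurable_normal_pdf.
- by apply/measurable_EFinP/measurable_funM => //; exact: measurable_normal_pdf.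
move=> x _; rewrite lee_fin !normal_pdf0E// ?gt_eqF//.
have -> : normal_peak s = Num.sqrt 2 * normal_peak q.
  rewrite /normal_peak q2.
  have -> : 2 * s ^+ 2 * pi *+ 2 = 2 * (s ^+ 2 * pi *+ 2) :> R by ring.
  by rewrite sqrtrM// invfM mulrA divff ?mul1r//.
pose y := x ^+ 2 / (4 * s ^+ 2).
have s20 : 0 < s ^+ 2 by rewrite exprn_gt0.
have y0 : 0 <= y by rewrite divr_ge0 ?sqr_ge0// mulr_ge0// ltW.
have -> : - (s ^+ 2 *+ 2)^-1 * x ^+ 2 = - y - y.
  by rewrite /y; field; lra.
have -> : - (q ^+ 2 *+ 2)^-1 * x ^+ 2 = - y.
  by rewrite /y q2; field; lra.
have -> : x ^+ n.*2 = y ^+ n * (4 ^+ n * s ^+ n.*2).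
  rewrite -mul2n !exprM -!exprMn; congr (_ ^+ _).
  by rewrite /y; field; lra.
have yn : y ^+ n <= n`!%:R * expR y.
  case: n {K K0} => [|n].
    by rewrite expr0 fact0 mul1r -expR0 ler_expR.
  have := expR_ge1Dxn n y0; rewrite -ler_pdivrMl ?ltr0n ?fact_gt0// mulrC.
  by apply: le_trans; rewrite lerDr.
have s2 : Num.sqrt 2 <= 2 :> R.
  by rewrite -[leRHS]ger0_norm// -sqrtr_sqr ler_wsqrtr// expr2; lra.
rewrite expRD.
have ey : expR y * expR (- y) = 1 by rewrite -expRD subrr expR0.
have := expR_gt0 (- y).
set e := expR (- y) in ey *; set c := 4 ^+ n * s ^+ n.*2 => e0.
have c0 : 0 <= c by rewrite mulr_ge0// ?exprn_ge0// ltW.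
set p := normal_peak q; have p0 : 0 <= p by exact: normal_peak_ge0.
rewrite /K -/c.
have -> : y ^+ n * c * (Num.sqrt 2 * p * (e * e)) =
  Num.sqrt 2 * (y ^+ n * e) * (c * p * e) by ring.
have -> : n`!%:R * 2 * 4 ^+ n * s ^+ n.*2 * (p * e) =
  2 * n`!%:R * (c * p * e) by rewrite /c; ring.
apply: ler_wpM2r; first exact: mulr_ge0 (mulr_ge0 c0 p0) (ltW e0).
apply: ler_pM => //; first by rewrite mulr_ge0 ?exprn_ge0// ltW.
apply: le_trans (_ : n`!%:R * expR y * e <= _).
  by rewrite ler_wpM2r// ltW.
by rewrite -mulrA ey mulr1.
Qed.

(** Symmetry of the density under x -> - x. The positive and negative parts are treated separately
    so that only integrals of nonnegative functions occur; their equality makes the mean vanish. *)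
Lemma integral_odd_normal (s : R) : s != 0 ->
  (\int[leb]_x ((Num.max x 0) * normal_pdf 0 s x)%:E =
   \int[leb]_x ((Num.max (- x) 0) * normal_pdf 0 s x)%:E)%E.
Proof.
move=> s0; have mm : measurable_fun setT (fun x : R =>
  ((Num.max x 0) * normal_pdf 0 s x)%:E).
  apply/measurable_EFinP/measurable_funM; last exact: measurable_normal_pdf.
  exact: measurable_maxr.
have m0 (x : R) : 0 <= Num.max x 0 by rewrite le_max lexx orbT.
transitivity (\int[leb]_x ((Num.max (- x) 0) * normal_pdf 0 s (- x))%:E)%E; last first.
  apply: eq_integral => x _; rewrite !normal_pdf0E//.
  by rewrite sqrrN.
pose opp : measurableTypeR R -> measurableTypeR R := -%R.
have mopp : measurable_fun setT opp by exact: oppr_measurable.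
rewrite -(@ge0_integral_pushforward _ _ _ _ _ opp mopp leb setT
  (fun x => ((Num.max x 0) * normal_pdf 0 s x)%:E))//.
- by apply: eq_measure_integral => A mA _; exact/esym/lebesgue_measureN.
- by move=> x _; rewrite lee_fin mulr_ge0// normal_pdf_ge0.
Qed.

Lemma derive_mulx_gauss (s : R) : s != 0 ->
  let E x := expR (- (s ^+ 2 *+ 2)^-1 * x ^+ 2) in
  forall x : R, is_derive x 1 (fun x => - s ^+ 2 * (x * E x))
    ((x ^+ 2 - s ^+ 2) * E x).
Proof.
move=> s0 E x; set c := - (s ^+ 2 *+ 2)^-1.
have dc : is_derive x 1 (fun x => c * x ^+ 2) (c * (2 * x)).
  by apply: is_derive_eq; rewrite /GRing.scale/=; ring.
have dE : is_derive x 1 E (E x * (c * (2 * x))).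
  exact: (@is_derive1_comp _ expR (fun x => c * x ^+ 2)).
apply: is_derive_eq.
rewrite /GRing.scale/= /c; field.
by rewrite s0.
Qed.

(** The fundamental theorem of calculus for [F]; the last term is the boundary contribution F (- a)
    - F a. *)
Lemma integral_sqr_normal_itv (s a : R) : s != 0 -> 0 < a ->
  (\int[leb]_(x in `[(- a)%R, a]) (x ^+ 2 * normal_pdf 0 s x)%:E =
   (s ^+ 2)%:E * \int[leb]_(x in `[(- a)%R, a]) (normal_pdf 0 s x)%:E -
   (s ^+ 2 * 2 * (a * normal_pdf 0 s a))%:E)%E.
Proof.
move=> s0 a0.
have ci (f : R -> R) : continuous f ->
    leb.-integrable `[- a, a] (EFin \o f).
  move=> cf; apply: continuous_compact_integrable; first exact: segment_compact.
  exact: continuous_subspaceT.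
have cp := @continuous_normal_pdf R 0 s s0.
have cX : continuous (fun x : R => x ^+ 2) by exact: exprn_continuous.
have aa : - a < a by rewrite gtrN.
pose F (x : R) : R := - s ^+ 2 * (x * normal_pdf 0 s x).
pose f (x : R) : R := (x ^+ 2 - s ^+ 2) * normal_pdf 0 s x.
have dF (x : R) : is_derive x (1 : R) F (f x).
  rewrite (_ : F = fun x : R =>
    normal_peak s * (- s ^+ 2 * (x * expR (- (s ^+ 2 *+ 2)^-1 * x ^+ 2)))).
    have d := derive_mulx_gauss s0 x.
    apply: is_derive_eq; rewrite /GRing.scale/= /f normal_pdf0E//; ring.
  by apply/funext => y; rewrite /F normal_pdf0E//; ring.
have cf : continuous f.
  move=> x; apply: cvgM; last exact: cp.
  by apply: cvgB; [exact: cX|exact: cvg_cst].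
have cF : continuous F.
  move=> x; apply: differentiable_continuous; apply/derivable1_diffP.
  by have [] := dF x.
have := @continuous_FTC2 R f F (- a) a aa.
have -> : (\int[leb]_(x in `[(- a)%R, a]) (f x)%:E =
   \int[leb]_(x in `[(- a)%R, a]) (x ^+ 2 * normal_pdf 0 s x)%:E -
   (s ^+ 2)%:E * \int[leb]_(x in `[(- a)%R, a]) (normal_pdf 0 s x)%:E)%E.
  have i1 : leb.-integrable `[- a, a] (EFin \o (fun x => x ^+ 2 * normal_pdf 0 s x)).
    by apply: ci => x; apply: cvgM; [exact: cX|exact: cp].
  have i2 := ci _ cp.
  rewrite -integralZl//=.
  rewrite -integralB//=; last exact: integrableZl.
  by apply: eq_integral => x _; rewrite /f mulrBl EFinB.
move=> H.
have {H} := H (continuous_subspaceT cf).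
have -> : (F a)%:E = (- (s ^+ 2 * (a * normal_pdf 0 s a)))%:E by rewrite /F mulNr.
have -> : (F (- a))%:E = (s ^+ 2 * (a * normal_pdf 0 s a))%:E.
  by rewrite /F !normal_pdf0E// sqrrN; congr (_%:E); ring.
move=> H.
have dl : derivable_oo_LRcontinuous F (- a) a.
  split.
  - by move=> x _; have [] := dF x.
  - exact: cvg_at_right_filter (cF _).
  - exact: cvg_at_left_filter (cF _).
have {H} := H dl.
have F' : {in `]- a, a[, derive1 F =1 f}.
  by move=> x _; rewrite derive1E; have [] := dF x.
move/(_ F').
have := integrable_fin_num _ (ci _ cp).
move=> /(_ ltac:(exact: measurable_itv)).
case: (\int[leb]_(x in _) (EFin \o _) x)%E => [r| |]//= _.
case: (\int[leb]_(x in _) _)%E => [q| |]//=.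
rewrite -EFinM -!EFinB => -[] H; congr EFin.
lra.
Qed.

(** From exp (- y) <= 1 / y with y = a^2 / (2 s^2), the boundary term is at most K / a. *)
Lemma cvg_mulx_normal (s : R) : s != 0 ->
  n.+1%:R * normal_pdf 0 s n.+1%:R @[n --> \oo] --> (0 : R).
Proof.
move=> s0; have s20 : 0 < s ^+ 2 by rewrite exprn_even_gt0.
pose K := normal_peak s * (2 * s ^+ 2).
apply: (@squeeze_cvgr _ _ _ _ (fun=> 0) (fun n => K * n.+1%:R^-1)).
- near=> n; rewrite mulr_ge0 ?normal_pdf_ge0//= normal_pdf0E//.
  set a : R := n.+1%:R; have a0 : 0 < a by rewrite ltr0n.
  pose y := (s ^+ 2 *+ 2)^-1 * a ^+ 2.
  have y0 : 0 < y by rewrite mulr_gt0 ?invr_gt0 ?exprn_gt0// pmulrn_lgt0.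
  have ey : expR (- y) <= y^-1.
    rewrite expRN lef_pV2 ?posrE ?expR_gt0//.
    by apply: le_trans (expR_ge1Dx y); rewrite lerDr.
  have -> : K * a^-1 = a * (normal_peak s * y^-1).
    by rewrite /K /y; field; rewrite s0 gt_eqF.
  rewrite mulNr -/y; apply: ler_wpM2l; first exact: ltW.
  by apply: ler_wpM2l => //; exact: normal_peak_ge0.
- exact: cvg_cst.
- rewrite -[X in _ --> X](mulr0 K); apply: cvgM; first exact: cvg_cst.
  exact: cvg_harmonic.
Unshelve. all: by end_near. Qed.

(** The limit of the previous computation over the intervals [-(n + 1), n + 1]. An exact value is
    required here, as it becomes the length t - s in the isometry. *)
Lemma integral_sqr_normal (s : R) : s != 0 ->
  (\int[leb]_x (x ^+ 2 * normal_pdf 0 s x)%:E = (s ^+ 2)%:E)%E.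
Proof.
move=> s0.
pose F (n : nat) : set (measurableTypeR R) := [set` `[(- n.+1%:R)%R, n.+1%:R]].
have ndF : nondecreasing_seq F.
  apply/nondecreasing_seqP => n; rewrite subsetEset => x.
  rewrite /F/= !in_itv/= => /andP[h1 h2].
  have : n.+1%:R <= n.+2%:R :> R by rewrite ler_nat.
  by move=> h; apply/andP; split; lra.
have mF n : measurable (F n) by exact: measurable_itv.
have UF : \bigcup_n F n = setT.
  apply/seteqP; split => // x _.
  exists (Num.trunc `|x|) => //=; rewrite /F/= in_itv/= -ler_norml.
  by rewrite ltW// truncnS_gt.
have cvgF (g : measurableTypeR R -> R) : measurable_fun setT g ->
  (forall x, 0 <= g x) ->
    (\int[leb]_(x in F n) (g x)%:E)%E @[n --> \oo] --> (\int[leb]_x (g x)%:E)%E.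
  move=> mg g0; rewrite -UF; apply: ge0_nondecreasing_set_cvg_integral => //.
  - by move=> n; apply/measurable_EFinP; exact: measurable_funTS.
  - by move=> n x _; rewrite lee_fin.
have mp := measurable_normal_pdf (0 : R) s.
have h1 := cvgF _ mp (normal_pdf_ge0 0 s).
have h2 : (\int[leb]_(x in F n) (x ^+ 2 * normal_pdf 0 s x)%:E)%E @[n --> \oo] -->
  (\int[leb]_x (x ^+ 2 * normal_pdf 0 s x)%:E)%E.
  apply: cvgF; first exact: measurable_funM.
  by move=> x; rewrite mulr_ge0 ?sqr_ge0 ?normal_pdf_ge0.
apply: (cvg_unique _ h2) => //=.
rewrite integral_normal_pdf in h1.
rewrite (_ : (fun n => _) = (fun n => (s ^+ 2)%:E *
    \int[leb]_(x in F n) (normal_pdf 0 s x)%:E -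
    (s ^+ 2 * 2 * (n.+1%:R * normal_pdf 0 s n.+1%:R))%:E)%E); last first.
  by apply/funext => n; rewrite integral_sqr_normal_itv.
set l := (s ^+ 2)%:E; rewrite [X in _ `=>` nbhs X](_ : l =
  ((s ^+ 2)%:E * 1%E - (s ^+ 2 * 2 * 0)%:E)%E); last first.
  by rewrite mule1 mulr0 sube0.
apply: cvgeB => //.
- exact: cvgeZl.
- apply/cvg_EFin; first by near=> n.
  apply: cvgM; [exact: cvg_cst|exact: cvg_mulx_normal].
Unshelve. all: by end_near. Qed.

End gaussian_moments.

Section normal_random_variable.
Context d (T : measurableType d) (R : realType) (P : probability T R).
Variables (W : T -> R) (s : R).
Hypotheses (mW : measurable_fun setT W) (s0 : 0 < s).
Hypothesis lawW : forall U : set R, measurable U ->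
  P (W @^-1` U) = normal_prob 0 s U.
Local Notation leb := (@lebesgue_measure R).

Let s0' : s != 0. Proof. by rewrite gt_eqF. Qed.

Lemma ge0_integral_normal_rv (g : R -> R) : measurable_fun setT g ->
  (forall x, 0 <= g x) ->
  (\int[P]_w (g (W w))%:E = \int[leb]_x (g x * normal_pdf 0 s x)%:E)%E.
Proof.
move=> mg g0.
pose W' : T -> measurableTypeR R := W.
have mW' : measurable_fun setT W' by [].
have mg' : measurable_fun (setT : set (measurableTypeR R)) (fun x => (g x)%:E).
  by apply/measurable_EFinP; exact: mg.
transitivity (\int[pushforward P W']_x (g x)%:E)%E.
  by rewrite ge0_integral_pushforward// => x _; rewrite lee_fin.
transitivity (\int[normal_prob 0 s]_x (g x)%:E)%E.
  by apply: eq_measure_integral => A mA _; exact: lawW.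
by rewrite ge0_integral_normal_prob.
Qed.

Lemma normal_rv_even_moment_le n : intg P (fun w => W w ^+ n.*2) /\
  \int[P]_w (W w ^+ n.*2) <= n`!%:R * 2 * 4 ^+ n * s ^+ n.*2.
Proof.
have e0 (x : R) : 0 <= x ^+ n.*2 by rewrite exprn_even_ge0// odd_double.
have := integral_even_moment_le n s0.
rewrite -(ge0_integral_normal_rv (g := fun x => x ^+ n.*2))//.
move=> h; have i : intg P (fun w => W w ^+ n.*2).
  apply/integrableP; split; first exact/measurable_EFinP/measurable_funX.
  rewrite (eq_integral (fun w => (W w ^+ n.*2)%:E)).
    exact: le_lt_trans h (ltry _).
  by move=> w _ /=; rewrite ger0_norm.
by split => //; rewrite -lee_fin -EFin_Rintegral.
Qed.

Lemma normal_rv_sqint : sqint P W.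
Proof. by split => //; have [] := normal_rv_even_moment_le 1. Qed.

Lemma normal_rv_variance : sqnm P W = s ^+ 2.
Proof.
apply: EFin_inj; rewrite -sqint_sqnmE; last exact: normal_rv_sqint.
rewrite (ge0_integral_normal_rv (g := fun x => x ^+ 2)) ?integral_sqr_normal//.
by move=> x; exact: sqr_ge0.
Qed.

Lemma normal_rv_mean : \int[P]_w W w = 0.
Proof.
have iW : intg P W := sqint_intg normal_rv_sqint.
have m1 : measurable_fun setT (fun x : R => Num.max x 0).
  exact: measurable_maxr.
have m2 : measurable_fun setT (fun x : R => Num.max (- x) 0).
  by apply: measurable_maxr => //; exact: oppr_measurable.
rewrite (_ : W = fun w => W^\+ w - W^\- w); last exact/esym/funrposBneg.
rewrite RintegralB//; [|exact: integrable_funrpos|exact: integrable_funrneg].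
apply/eqP; rewrite subr_eq0; apply/eqP; congr fine.
rewrite (ge0_integral_normal_rv (g := fun x => Num.max x 0))//.
  rewrite integral_odd_normal// (ge0_integral_normal_rv (g := fun x =>
    Num.max (- x) 0))//.
  by move=> x; rewrite le_max lexx orbT.
by move=> x; rewrite le_max lexx orbT.
Qed.

End normal_random_variable.

(** * Generated sigma-algebras and independence of a join *)

Section generated_sigma_algebras.
Context d (T : measurableType d) (R : realType).
Implicit Types X Y : set (set T).

Lemma gsaI X (A C : set T) : <<s X >> A -> <<s X >> C -> <<s X >> (A `&` C).
Proof. by move=> XA XC; exact: (@measurableI _ (g_sigma_algebraType X)). Qed.

Lemma gsaT X : <<s X >> setT.
Proof. exact: (@measurableT _ (g_sigma_algebraType X)). Qed.

Lemma gsa_sub X Y : X `<=` <<s Y >> -> <<s X >> `<=` <<s Y >>.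
Proof. by move=> XY; apply: smallest_sub => //; exact: smallest_sigma_algebra. Qed.

Lemma gsa_sub_measurable X : X `<=` measurable -> <<s X >> `<=` measurable.
Proof. by move=> Xm; apply: smallest_sub => //; exact: sigma_algebra_measurable. Qed.

(** The generating family of [mx_sigma X]: [gmeas] takes a generator as argument, and
    [<<s mxgen X >>] is convertible to [mx_sigma X]. *)
Definition mxgen (p q : nat) (X : T -> 'M[R]_(p, q)) : set (set T) :=
  \bigcup_(ij in [set: 'I_p * 'I_q])
    preimage_set_system setT (fun w => X w ij.1 ij.2) measurable.

Lemma mx_measurableP Y (p q : nat) (X : T -> 'M[R]_(p, q)) :
  mx_measurable <<s Y >> X <-> forall i j, gmeas Y (fun w => X w i j).
Proof.
split=> [XY i j|XY].
  apply: gmeasP => U mU; apply: XY; apply: sub_sigma_algebra.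
  by exists (i, j) => //; exists U => //; rewrite setTI.
apply: gsa_sub => _ [[i j] _ [U mU <-]].
exact: XY.
Qed.

Lemma mx_measurable_measurableP (p q : nat) (X : T -> 'M[R]_(p, q)) :
  mx_measurable measurable X <-> forall i j, measurable_fun setT (fun w => X w i j).
Proof.
split=> [Xm i j _ U mU|Xm].
  apply: Xm; apply: sub_sigma_algebra.
  by exists (i, j) => //; exists U.
apply: gsa_sub_measurable => _ [[i j] _ [U mU <-]].
exact: Xm.
Qed.

End generated_sigma_algebras.

Section independence_join.
Context d (T : measurableType d) (R : realType) (P : probability T R).

(** A pi-lambda argument. The intersections of a set of <<s F>> with a set of <<s A>>, together with
    the null sets, form a pi-system generating the join. On intersections the product formula is the
    hypothesis; on null sets both sides vanish. *)
Lemma indep_sigma_join (F A H : set (set T)) :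
  <<s F >> `<=` measurable -> <<s A >> `<=` measurable -> H `<=` measurable ->
  (forall C E D, <<s F >> C -> <<s A >> E -> H D ->
    P (C `&` E `&` D) = (P (C `&` E) * P D)%E) ->
  indep_sigma P <<s <<s F >> `|` <<s A >> `|` null_sets P >> H.
Proof.
move=> Fm Am Hm FAH S D GS HD.
have mD := Hm _ HD.
pose Q : set (set T) := [set X | exists C E, [/\ <<s F >> C, <<s A >> E & X = C `&` E]]
  `|` null_sets P.
have Qm : Q `<=` measurable.
  move=> X [[C [E [FC AE ->]]]|[]//].
  by apply: measurableI; [exact: Fm|exact: Am].
have QI : setI_closed Q.
  move=> X Y QX QY.
  have [mX mY] := (Qm _ QX, Qm _ QY).
  case: (QX) => [[C [E [FC AE XE]]]|[_ X0]]; last first.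
    right; split; first exact: measurableI.
    by apply: subset_measure0 X0 => //; exact: measurableI.
  case: (QY) => [[C' [E' [FC' AE' YE]]]|[_ Y0]]; last first.
    right; split; first exact: measurableI.
    by apply: subset_measure0 Y0 => //; exact: measurableI.
  left; exists (C `&` C'), (E `&` E'); split; [exact: gsaI|exact: gsaI|].
  by rewrite XE YE setIACA.
have sQ : <<s Q >> S.
  apply: gsa_sub GS => X [[FX|AX]|NX]; apply: sub_sigma_algebra.
  - by left; exists X, setT; split => //; [exact: gsaT|rewrite setIT].
  - by left; exists setT, X; split => //; [exact: gsaT|rewrite setTI].
  - by right.
have sQm : <<s Q >> `<=` measurable by exact: gsa_sub_measurable.
apply: (@dynkin_induction _ (g_sigma_algebraType Q) Q
  (fun E => P (E `&` D) = (P E * P D)%E)) sQ => //.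
- by rewrite setTI probability_setT mul1e.
- move=> X [[C [E [FC AE ->]]]|[mX X0]]; first exact: FAH.
  rewrite X0 mul0e; apply: subset_measure0 X0 => //.
  exact: measurableI.
(* The induction runs on the type carrying <<s Q>>; renaming the set at type [set T] makes the
   measure lemmas for [P] applicable. *)
- move=> Y /sQm; pose X : set T := Y; rewrite -/X => mX.
  move=> XD'; have {XD'}XD : P (X `&` D) = (P X * P D)%E by exact: XD'.
  have -> : P (~` X `&` D) = (P D - P (X `&` D))%E.
    rewrite setIC -setDE measureD//; last by rewrite -ge0_fin_numE// fin_num_measure.
    by rewrite (setIC D).
  rewrite XD probability_setC// muleBl ?mul1e//; first by rewrite fin_num_measure.
- move=> E' mE tE; pose E n : set T := E' n.
  move=> ED'; have {ED'}ED n : P (E n `&` D) = (P (E n) * P D)%E by exact: ED'.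
  rewrite -[\bigcup_k E' k]/(\bigcup_k E k) setI_bigcupl !measure_bigcup//.
  + rewrite -[in RHS](fineK (fin_num_measure P D mD)) muleC -nneseriesZl//.
    by apply: eq_eseriesr => n _; apply: etrans (ED n) _;
      rewrite muleC fineK// fin_num_measure.
  + by move=> n _; apply: sQm; exact: mE.
  + by move=> n _; apply: measurableI => //; apply: sQm; exact: mE.
  + move=> i j _ _ [w [[Eiw _] [Ejw _]]]; apply: tE => //; by exists w.
Qed.

End independence_join.

(** * Brownian increments and an independent sigma-algebra *)

(* A0 stands for a generator of F^alpha_T, and <<s GX t >> below is G_t. *)
Record noise (d0 : measure_display) (Omega : measurableType d0) (R : realType)
    (P : probability Omega R) (T : R) (d : nat) (B : R -> Omega -> 'cV[R]_d)
    (A0 : set (set Omega)) : Prop := Noise {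
  noise_gt0 : 0 < T;
  noise_bm : brownian_motion P T B;
  noise_meas : <<s A0 >> `<=` measurable;
  noise_indep : indep_sigma P (mx_filtration B T) <<s A0 >> }.

Section brownian_increments.
Context (d0 : measure_display) (Omega : measurableType d0) (R : realType)
  (P : probability Omega R) (T : R) (d : nat) (B : R -> Omega -> 'cV[R]_d)
  (A0 : set (set Omega)).
Hypothesis H : noise P T B A0.

Definition GX (t : R) := mx_filtration B t `|` <<s A0 >> `|` null_sets P.

Definition dB (s t : R) (j : 'I_d) (w : Omega) : R :=
  B t w j ord0 - B s w j ord0.

Let bgen t := \bigcup_(r in `[0, t]) mx_sigma (B r).

Lemma mx_filtration_measurable t : t <= T -> mx_filtration B t `<=` measurable.
Proof.
move=> tT; apply: gsa_sub_measurable => A [r /=].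
rewrite in_itv/= => /andP[r0 rt]; apply: (bm_measurable (noise_bm H)).
by rewrite r0 (le_trans rt).
Qed.

Lemma mx_filtration_sub s t : s <= t -> mx_filtration B s `<=` mx_filtration B t.
Proof.
move=> st; apply: gsa_sub => A [r /=]; rewrite in_itv/= => /andP[r0 rs] Ar.
apply: sub_sigma_algebra; exists r => //=.
by rewrite in_itv/= r0 (le_trans rs).
Qed.

Lemma GX_measurable t : t <= T -> <<s GX t >> `<=` measurable.
Proof.
move=> tT; apply: gsa_sub_measurable => A [[|]|[]//].
- exact: mx_filtration_measurable.
- exact: (noise_meas H).
Qed.

Lemma GX_sub s t : s <= t -> <<s GX s >> `<=` <<s GX t >>.
Proof.
move=> st; apply: sub_sigma_algebra2 => A [[FA|]|]; [|by left; right|by right].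
by left; left; exact: mx_filtration_sub FA.
Qed.

Lemma A0_sub_GX t : <<s A0 >> `<=` <<s GX t >>.
Proof. by move=> A AA; apply: sub_sigma_algebra; left; right. Qed.

Lemma filtration_B r t j : 0 <= r <= t ->
  @measurable_fun _ _ (g_sigma_algebraType (bgen t)) _ setT (fun w => B r w j ord0).
Proof.
move=> rt; apply: gmeasP => U mU; apply: sub_sigma_algebra.
exists r => //; apply: sub_sigma_algebra; exists (j, ord0) => //.
by exists U => //; rewrite setTI.
Qed.

Lemma filtration_sub_GX t : mx_filtration B t `<=` <<s GX t >>.
Proof. by move=> A AA; apply: sub_sigma_algebra; left; left. Qed.

Lemma GX_B r t j : 0 <= r <= t -> gmeas (GX t) (fun w => B r w j ord0).
Proof.
by move=> rt; apply: gmeas_sub (filtration_B j rt); exact: filtration_sub_GX.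
Qed.

Lemma GX_dB r s t j : 0 <= r -> r <= s -> s <= t -> gmeas (GX t) (dB r s j).
Proof.
move=> r0 rs st; apply: measurable_funB; apply: GX_B.
  by rewrite (le_trans r0).
by rewrite r0 (le_trans rs).
Qed.

Section one_increment.
Variables s t : R.
Hypotheses (s0 : 0 <= s) (st : s < t) (tT : t <= T).

Let incgen := mxgen (fun w => B t w - B s w).

Lemma incgen_filtration : <<s incgen >> `<=` mx_filtration B t.
Proof.
apply/mx_measurableP => i j; rewrite ord1.
rewrite (_ : (fun _ => _) = dB s t i); last by apply/funext => w; rewrite !mxE.
by apply: measurable_funB; apply: filtration_B;
  rewrite ?s0 ?lexx ?(ltW st) ?(le_trans s0 (ltW st)).
Qed.

Lemma incgen_measurable : <<s incgen >> `<=` measurable.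
Proof.
by apply: subset_trans incgen_filtration _; exact: mx_filtration_measurable.
Qed.

Lemma incgen_dB j : gmeas incgen (dB s t j).
Proof.
rewrite (_ : dB s t j = fun w => (B t w - B s w) j ord0); last first.
  by apply/funext => w; rewrite !mxE.
have : mx_measurable <<s incgen >> (fun w => B t w - B s w) by [].
by move/mx_measurableP => /(_ j ord0).
Qed.

(** Take [C] in the Brownian past, [E] in <<s A0>> and [D] an event of the increment. [C] and [D]
    both belong to the Brownian sigma-algebra at [T], so [E] splits off first; [C] and [D] are then
    separated by independence of increments, and [C] and [E] are joined again. *)
Lemma GX_indep_increment : indep_sigma P <<s GX s >> <<s incgen >>.
Proof.
have sT : s <= T := le_trans (ltW st) tT.
apply: indep_sigma_join.
- exact: mx_filtration_measurable.
- exact: (noise_meas H).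
- exact: incgen_measurable.
move=> C E D FC AE ID.
have FCT : mx_filtration B T C by exact: mx_filtration_sub FC.
have FDT : mx_filtration B T D.
  by apply: (mx_filtration_sub tT); exact: incgen_filtration.
rewrite setIAC (noise_indep H)//; last exact: gsaI.
rewrite (bm_incr_indep (noise_bm H) s0 st tT)// (noise_indep H)//.
by rewrite muleAC.
Qed.

Lemma GX_indep_Rintegral (xi phi : Omega -> R) :
  gmeas (GX s) xi -> gmeas incgen phi -> intg P xi -> intg P phi ->
  intg P (fun w => xi w * phi w) /\
  \int[P]_w (xi w * phi w) = \int[P]_w xi w * \int[P]_w phi w.
Proof.
have sT : s <= T := le_trans (ltW st) tT.
move=> mxi mphi ixi iphi.
exact: (indep_Rintegral (GX_measurable sT) incgen_measurable
  GX_indep_increment mxi mphi ixi iphi).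
Qed.

Let sg := Num.sqrt (t - s).
Let sg0 : 0 < sg. Proof. by rewrite sqrtr_gt0 subr_gt0. Qed.
Let sg2 : sg ^+ 2 = t - s.
Proof. by rewrite sqr_sqrtr// subr_ge0 ltW. Qed.

Lemma measurable_dB j : measurable_fun setT (dB s t j).
Proof. exact: gmeas_measurable incgen_measurable (incgen_dB j). Qed.

Lemma dB_law j (U : set R) : measurable U ->
  P (dB s t j @^-1` U) = normal_prob 0 sg U.
Proof.
(* The law is given on boxes; all sides but the j-th are the whole line. *)
move=> mU; pose V i : set R := if i == j then U else setT.
have mV i : measurable (V i) by rewrite /V; case: ifP.
have := bm_incr_law (noise_bm H) s0 st tT mV.
rewrite (bigD1 j)//= big1 ?mule1; last first.
  by move=> i ij; rewrite /V (negbTE ij); exact: probability_setT.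
rewrite /V eqxx => <-; congr (P _); apply/seteqP; split => w /=.
  by move=> Uw i; case: eqP => // ->; rewrite !mxE.
by move=> /(_ j); rewrite eqxx !mxE.
Qed.

Lemma dB_sqint j : sqint P (dB s t j).
Proof. by apply: (normal_rv_sqint _ sg0); [exact: measurable_dB|exact: dB_law]. Qed.

Lemma dB_mean j : \int[P]_w dB s t j w = 0.
Proof. by apply: (normal_rv_mean _ sg0); [exact: measurable_dB|exact: dB_law]. Qed.

Lemma dB_variance j : \int[P]_w (dB s t j w * dB s t j w) = t - s.
Proof.
rewrite -sg2 -(normal_rv_variance (measurable_dB j) sg0 (dB_law j)).
by apply: eq_Rintegral => w _; rewrite expr2.
Qed.

(** 64 = 2! * 2 * 4^2 in the even-moment bound. *)
Lemma dB_moment4 j : intg P (fun w => dB s t j w ^+ 4) /\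
  \int[P]_w (dB s t j w ^+ 4) <= 64 * (t - s) ^+ 2.
Proof.
have [i le] := normal_rv_even_moment_le (measurable_dB j) sg0 (dB_law j) 2.
split => //; apply: le_trans le _.
rewrite -sg2 -exprM.
by rewrite (_ : 2.*2 = 4)%N// (_ : 2 * 2 = 4)%N// (_ : 2`! = 2)%N//; lra.
Qed.

(** 768 = 3! * 2 * 4^3 in the even-moment bound. *)
Lemma dB_moment6 j : intg P (fun w => dB s t j w ^+ 6) /\
  \int[P]_w (dB s t j w ^+ 6) <= 768 * (t - s) ^+ 3.
Proof.
have [i le] := normal_rv_even_moment_le (measurable_dB j) sg0 (dB_law j) 3.
split => //; apply: le_trans le _; rewrite -sg2 -exprM.
by rewrite (_ : 3.*2 = 6)%N// (_ : 2 * 3 = 6)%N// (_ : 3`! = 6)%N//; lra.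
Qed.

(** Boxes with two nontrivial sides show that distinct components are independent, and both have
    mean zero. *)
Lemma dB_covariance i j : i != j ->
  \int[P]_w (dB s t i w * dB s t j w) = 0.
Proof.
move=> ij.
pose X k := preimage_set_system setT (dB s t k) measurable.
have Xk k : <<s X k >> = X k.
  by apply: sigma_algebra_id; apply: sigma_algebra_preimage;
    exact: sigma_algebra_measurable.
have Xm k : X k `<=` measurable.
  by move=> _ [U mU <-]; exact: measurable_dB.
have gX k : gmeas (X k) (dB s t k).
  by apply: gmeasP => U mU; apply: sub_sigma_algebra; exists U => //; rewrite setTI.
have ind : indep_sigma P <<s X i >> <<s X j >>.
  rewrite !Xk => _ _ [U mU <-] [V mV <-]; rewrite !setTI !dB_law//.
  pose W l : set R := if l == i then U else if l == j then V else setT.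
  have mW l : measurable (W l) by rewrite /W; case: ifP => // _; case: ifP.
  have := bm_incr_law (noise_bm H) s0 st tT mW.
  rewrite (bigD1 i)//= (bigD1 j)/=; last by rewrite eq_sym.
  rewrite big1 ?mule1; last first.
    move=> l /andP[li lj]; rewrite /W (negbTE li) (negbTE lj).
    exact: probability_setT.
  rewrite /W !eqxx [in j == i]eq_sym (negbTE ij) => <-.
  congr (P _); apply/seteqP; split => w /=.
    move=> [Uw Vw] l; case: eqP => [->|_]; first by rewrite !mxE.
    by case: eqP => // ->; rewrite !mxE.
  move=> h; have := h i; have := h j.
  by rewrite !eqxx [in j == i]eq_sym (negbTE ij) !mxE.
have [_ ->] := indep_Rintegral (eq_ind_r (fun Y => Y `<=` _) (Xm i) (Xk i))
  (eq_ind_r (fun Y => Y `<=` _) (Xm j) (Xk j)) ind (gX i) (gX j)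
  (sqint_intg (dB_sqint i)) (sqint_intg (dB_sqint j)).
by rewrite dB_mean mul0r.
Qed.

End one_increment.
End brownian_increments.

(** * The isometry for simple processes *)

Section tensor.
Context d1 d2 (T1 : measurableType d1) (T2 : measurableType d2) (R : realType).
Variables (m1 : {sigma_finite_measure set T1 -> \bar R})
  (m2 : {sigma_finite_measure set T2 -> \bar R}).
Variables (f : T1 -> R) (g : T2 -> R).
Hypotheses (i_f : intg m1 f) (i_g : intg m2 g).

Let h (x : T1 * T2) := f x.1 * g x.2.

Lemma measurable_tensor : measurable_fun setT h.
Proof.
apply: measurable_funM.
  by apply: measurableT_comp => //; exact: intg_meas i_f.
by apply: measurableT_comp => //; exact: intg_meas i_g.
Qed.

Lemma intg_tensor : intg (m1 \x m2)%E h.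
Proof.
apply/integrable12ltyP.
  by apply/measurable_EFinP; exact: measurable_tensor.
have e x : (\int[m2]_y `|(EFin \o h) (x, y)| =
    (`|f x| * \int[m2]_y `|g y|)%:E)%E.
  rewrite EFinM -EFin_Rintegral; last exact: intg_norm.
  rewrite -ge0_integralZl_EFin//; last first.
    by apply/measurable_EFinP/measurableT_comp => //; exact: intg_meas i_g.
  by apply: eq_integral => y _; rewrite /h /= normrM.
under eq_integral do rewrite e.
rewrite (EFin_Rintegral (f := fun x => `|f x| * \int[m2]_y `|g y|)) ?ltry//.
rewrite (_ : (fun _ => _) = fun x => (\int[m2]_y `|g y|) * `|f x|).
  by apply: intgZ; exact: intg_norm.
by apply/funext => x; rewrite mulrC.
Qed.

Lemma Rintegral_tensor :
  \int[(m1 \x m2)%E]_x h x = (\int[m1]_x f x) * (\int[m2]_y g y).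
Proof.
rewrite /Rintegral -integral12_prod_meas1; last exact: intg_tensor.
rewrite /fubini_F; transitivity (fine (\int[m1]_x ((\int[m2]_y g y) * f x)%:E)%E).
  congr fine; apply: eq_integral => x _; rewrite mulrC EFinM -EFin_Rintegral//.
  by rewrite -integralZl.
by rewrite mulrC; exact: (RintegralZl _ measurableT i_f).
Qed.

End tensor.

Section overlap.
Context {R : realType}.
Local Notation leb := (@lebesgue_measure R).

Definition itvind (s t : R) (x : measurableTypeR R) : R :=
  \1_(`]s, t]%classic) x.

Definition overlap (s t u v : R) : R :=
  \int[leb]_x (itvind s t x * itvind u v x).

Lemma intg_itvindM s t u v : intg leb (fun x => itvind s t x * itvind u v x).
Proof.
apply: (@intg_le _ _ _ _ _ (itvind s t : measurableTypeR R -> R)).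
- by apply: measurable_funM; exact: measurable_indic.
- move=> x; rewrite /itvind normrM !indicE.
  by do 2 case: (_ \in _); rewrite /= ?normr0 ?normr1 ?mulr0 ?mulr1.
- exact: integrable_indic_itv.
Qed.

Lemma overlapE s t u v : overlap s t u v =
  Num.max 0 (Num.min t v - Num.max s u).
Proof.
have -> : overlap s t u v = fine (leb `]Num.max s u, Num.min t v]%classic).
  rewrite /overlap /Rintegral.
  rewrite (eq_integral (fun x =>
    (\1_(`]Num.max s u, Num.min t v]%classic : set (measurableTypeR R)) x)%:E)).
    by rewrite integral_indic// setIT.
  move=> x _; congr EFin; rewrite /itvind !indicE -natrM mulnb; congr (_%:R).
  congr nat_of_bool; rewrite !mem_setE/= !in_itv/= gt_max le_min.
  by case: (s < x) (u < x) (x <= t) (x <= v) => [] [] [] [].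
rewrite lebesgue_measure_itv/= lte_fin; case: ltP => h.
  by rewrite -EFinB/= [RHS]max_r// subr_ge0 ltW.
by rewrite [RHS]max_l// subr_le0.
Qed.

End overlap.

(** * Covariances of weighted Brownian increments *)

Section ito_isometry.
Context (d0 : measure_display) (Omega : measurableType d0) (R : realType)
  (P : probability Omega R) (T : R) (d : nat) (B : R -> Omega -> 'cV[R]_d)
  (A0 : set (set Omega)).
Hypothesis H : noise P T B A0.
Local Notation GX := (GX P B A0).
Local Notation dB := (dB B).

Definition bnd (f : Omega -> R) := exists M, forall w, `|f w| <= M.

(** Boundedness is what [sp_adapted] demands of coefficients. It also makes the class stable under
    products and lets it act on square-integrable variables. *)
Definition adm (t : R) (xi : Omega -> R) := gmeas (GX t) xi /\ bnd xi.

Lemma bndM f g : bnd f -> bnd g -> bnd (fun w => f w * g w).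
Proof.
move=> [M fM] [K gK]; exists (M * K) => w; rewrite normrM.
by apply: ler_pM.
Qed.

Lemma bndD f g : bnd f -> bnd g -> bnd (fun w => f w + g w).
Proof.
move=> [M fM] [K gK]; exists (M + K) => w.
by rewrite (le_trans (ler_normD _ _))// lerD.
Qed.

Lemma bnd_cst c : bnd (fun=> c).
Proof. by exists `|c|. Qed.

Lemma admM t f g : adm t f -> adm t g -> adm t (fun w => f w * g w).
Proof.
by move=> [mf bf] [mg bg]; split; [exact: measurable_funM|exact: bndM].
Qed.

Lemma admD t f g : adm t f -> adm t g -> adm t (fun w => f w + g w).
Proof.
by move=> [mf bf] [mg bg]; split; [exact: measurable_funD|exact: bndD].
Qed.

Lemma adm_cst t c : adm t (fun=> c).
Proof. by split; [exact: measurable_cst|exact: bnd_cst]. Qed.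

Lemma adm_sub s t f : s <= t -> adm s f -> adm t f.
Proof. by move=> st [mf bf]; split => //; apply: gmeas_sub mf; exact: GX_sub. Qed.

Lemma adm_measurable t f : t <= T -> adm t f -> measurable_fun setT f.
Proof. by move=> tT [mf _]; apply: gmeas_measurable mf; exact: (GX_measurable H). Qed.

Lemma adm_sqint t f : t <= T -> adm t f -> sqint P f.
Proof.
move=> tT af; have [_ [M fM]] := af; apply: bnd_sqint fM.
exact: adm_measurable af.
Qed.

Lemma dBxx s j : dB s s j = fun=> 0.
Proof. by apply/funext => w; rewrite /dB subrr. Qed.

Lemma sqint_dB s t j : 0 <= s -> s <= t -> t <= T -> sqint P (dB s t j).
Proof.
move=> s0; rewrite le_eqVlt => /orP[/eqP<- _|st tT]; last exact: (dB_sqint H).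
by rewrite dBxx; exact: sqint0.
Qed.

Lemma sqint_admM s f X : s <= T -> adm s f -> sqint P X -> sqint P (fun w => f w * X w).
Proof.
move=> sT af; have [_ [M fM]] := af; apply: sqint_bndM fM.
exact: adm_measurable af.
Qed.

(** Independence of the increment, whose mean is zero. The case u = v is included because cutting
    intervals at a minimum of two endpoints produces empty ones. *)
Lemma adapted_increment_mean u v j (X : Omega -> R) : 0 <= u -> u <= v -> v <= T ->
  gmeas (GX u) X -> intg P X -> \int[P]_w (X w * dB u v j w) = 0.
Proof.
move=> u0; rewrite le_eqVlt => /orP[/eqP<- vT|uv vT] mX iX.
  rewrite dBxx -[RHS](Rintegral_prob_cst P 0); apply: eq_Rintegral => w _.
  by rewrite mulr0.
have [_ ->] := GX_indep_Rintegral H u0 uv vT mX (@incgen_dB _ _ _ _ B u v j) iX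
  (sqint_intg (dB_sqint H u0 uv vT j)).
by rewrite (dB_mean H)// mulr0.
Qed.

Lemma adapted_increment_covariance u v i j (a : Omega -> R) :
  0 <= u -> u <= v -> v <= T -> adm u a ->
  \int[P]_w (a w * (dB u v i w * dB u v j w)) =
  (i == j)%:R * (v - u) * \int[P]_w a w.
Proof.
move=> u0; rewrite le_eqVlt => /orP[/eqP<- vT|uv vT] adm_a.
  rewrite subrr mulr0 mul0r -[RHS](Rintegral_prob_cst P 0).
  by apply: eq_Rintegral => w _; rewrite !dBxx !mulr0.
have uT : u <= T by exact: le_trans (ltW uv) vT.
have mm : gmeas (mxgen (fun w => B v w - B u w)) (fun w => dB u v i w * dB u v j w).
  by apply: measurable_funM; exact: incgen_dB.
have [_ ->] := GX_indep_Rintegral H u0 uv vT adm_a.1 mm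
  (sqint_intg (adm_sqint uT adm_a))
  (sqint_mul (dB_sqint H u0 uv vT i) (dB_sqint H u0 uv vT j)).
rewrite mulrC; congr (_ * _); case: eqVneq => [->|ij].
  by rewrite (dB_variance H)// mul1r.
by rewrite (dB_covariance H)// mul0r.
Qed.

(** If t <= u, the later increment is independent of all the rest. Otherwise the increments are cut
    at [u] and at m = min (t, v), and only the product of the two increments over ]u, m]
    contributes. Every other product vanishes, either in mean, because its last increment starts
    once the other factors are known, or identically. *)
Let pair_le s t u v i j xi eta : 0 <= s -> s <= u -> s < t -> u < v ->
  t <= T -> v <= T -> adm s xi -> adm u eta ->
  \int[P]_w ((xi w * dB s t i w) * (eta w * dB u v j w)) =
  (i == j)%:R * overlap s t u v * \int[P]_w (xi w * eta w).
Proof.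
move=> s0 su st uv tT vT axi aeta.
have u0 : 0 <= u by exact: le_trans su.
have uT : u <= T by exact: le_trans (ltW uv) vT.
have sT : s <= T by exact: le_trans su uT.
have aa : adm u (fun w => xi w * eta w).
  by apply: admM => //; exact: adm_sub axi.
have [mxi _] := axi; have [meta _] := aeta.
have sdst := sqint_dB i s0 (ltW st) tT.
have sduv := sqint_dB j u0 (ltW uv) vT.
rewrite overlapE (max_r su).
have [tu|ut] := leP t u.
  rewrite max_l; last by rewrite subr_le0 ge_min tu.
  rewrite mulr0 mul0r.
  rewrite -[RHS](@adapted_increment_mean u v j (fun w =>
    (xi w * dB s t i w) * eta w))//.
  - by apply: eq_Rintegral => w _; rewrite mulrA.
  - exact: ltW.
  - apply: measurable_funM => //; apply: measurable_funM.
      by apply: gmeas_sub mxi; exact: GX_sub.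
    by apply: GX_dB => //; exact: ltW.
  - apply: sqint_mul; last exact: adm_sqint aeta.
    exact: sqint_admM axi sdst.
rewrite max_r; last by rewrite subr_ge0 le_min !ltW.
set m := Num.min t v.
have um : u < m by rewrite lt_min ut.
have mT : m <= T by rewrite ge_min tT.
have m0 : 0 <= m by rewrite (le_trans u0)// ltW.
have mt : m <= t by rewrite ge_min lexx.
have mv : m <= v by rewrite ge_min lexx orbT.
pose a w := xi w * eta w.
have sd1 := sqint_dB i s0 su uT.
have sd2 k := sqint_dB k u0 (ltW um) mT.
have sd3 := sqint_dB i m0 mt tT.
have sd4 := sqint_dB j m0 mv vT.
have aM X : sqint P X -> sqint P (fun w => a w * X w) by exact: sqint_admM aa.
have md1 : gmeas (GX u) (dB s u i) by apply: GX_dB.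
have md2 k : gmeas (GX m) (dB u m k) by apply: GX_dB => //; exact: ltW.
have ma : gmeas (GX u) a by case: aa.
have mam : gmeas (GX m) a by apply: gmeas_sub ma; exact: GX_sub (ltW um).
have e1 : \int[P]_w (a w * dB s u i w * dB u v j w) = 0.
  apply: adapted_increment_mean => //; first exact: ltW.
    exact: measurable_funM.
  exact: sqint_intg (aM _ sd1).
have e2 : \int[P]_w (a w * (dB u m i w * dB u m j w)) =
    (i == j)%:R * (m - u) * \int[P]_w a w.
  by apply: adapted_increment_covariance => //; exact: ltW.
have e3 : \int[P]_w (a w * dB u m i w * dB m v j w) = 0.
  apply: adapted_increment_mean => //; first exact: measurable_funM.
  exact: sqint_intg (aM _ (sd2 i)).
have e4 : \int[P]_w (a w * dB u m j w * dB m t i w) = 0.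
  apply: adapted_increment_mean => //; first exact: measurable_funM.
  exact: sqint_intg (aM _ (sd2 j)).
(* [m] is [t] or [v], so one of the two leftover increments is over an empty interval. *)
have e5 w : dB m t i w * dB m v j w = 0.
  rewrite /m; have [tv|vt] := leP t v; first by rewrite dBxx mul0r.
  by rewrite dBxx mulr0.
have dBD x y z k w : dB x z k w = dB x y k w + dB y z k w.
  by rewrite /dB; ring.
rewrite -e2.
transitivity (\int[P]_w (a w * dB s u i w * dB u v j w +
  (a w * (dB u m i w * dB u m j w) + (a w * dB u m i w * dB m v j w +
   a w * dB u m j w * dB m t i w)))).
  apply: eq_Rintegral => w _; rewrite (dBD s u t i) (dBD u m t i).
  rewrite (dBD u m v j).
  transitivity (a w * dB s u i w * (dB u m j w + dB m v j w) +
    (a w * (dB u m i w * dB u m j w) + (a w * dB u m i w * dB m v j w +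
    a w * dB u m j w * dB m t i w)) + a w * (dB m t i w * dB m v j w)).
    by rewrite /a; ring.
  by rewrite e5 mulr0 addr0.
have i1 : intg P (fun w => a w * dB s u i w * dB u v j w).
  exact: sqint_mul (aM _ sd1) sduv.
have i2 : intg P (fun w => a w * (dB u m i w * dB u m j w)).
  rewrite (_ : (fun _ => _) = fun w => (a w * dB u m i w) * dB u m j w).
    exact: sqint_mul (aM _ (sd2 i)) (sd2 j).
  by apply/funext => w; rewrite mulrA.
have i3 : intg P (fun w => a w * dB u m i w * dB m v j w).
  exact: sqint_mul (aM _ (sd2 i)) sd4.
have i4 : intg P (fun w => a w * dB u m j w * dB m t i w).
  exact: sqint_mul (aM _ (sd2 j)) sd3.
rewrite RintegralD//; last by apply: intgD => //; exact: intgD.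
rewrite RintegralD//; last exact: intgD.
by rewrite RintegralD// e1 e3 e4 add0r !addr0.
Qed.

Lemma increment_pair s t u v i j xi eta : 0 <= s -> 0 <= u -> s < t -> u < v ->
  t <= T -> v <= T -> adm s xi -> adm u eta ->
  \int[P]_w ((xi w * dB s t i w) * (eta w * dB u v j w)) =
  (i == j)%:R * overlap s t u v * \int[P]_w (xi w * eta w).
Proof.
move=> s0 u0 st uv tT vT axi aeta; have [su|us] := leP s u; first exact: pair_le.
rewrite (@eq_Rintegral _ _ _ _ _ (fun w => (eta w * dB u v j w) * (xi w * dB s t i w))).
  rewrite pair_le// ?(ltW us)//; congr (_ * _ * _); first by rewrite eq_sym.
    by rewrite !overlapE [Num.min v t]minC [Num.max u s]maxC.
  by apply: eq_Rintegral => w _; rewrite mulrC.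
by move=> w _; rewrite mulrC.
Qed.

End ito_isometry.

(** * The isometry for finite families of weighted increments *)

Section elementary_isometry.
Context (d0 : measure_display) (Omega : measurableType d0) (R : realType)
  (P : probability Omega R) (T : R) (d : nat) (B : R -> Omega -> 'cV[R]_d)
  (A0 : set (set Omega)).
Hypothesis H : noise P T B A0.
Local Notation GX := (GX P B A0).
Local Notation dB := (dB B).
Local Notation leb := (@lebesgue_measure R).
Local Notation nu := (P \x leb)%E.

Variables (I : finType) (s t : I -> R) (j : I -> 'I_d) (xi : I -> Omega -> R).
Hypothesis adm_xi : forall e,
  [/\ 0 <= s e, s e < t e, t e <= T & adm P B A0 (s e) (xi e)].

(** The intervals of the family may overlap arbitrarily. This allows the difference of two simple
    processes to be treated without a common refinement of their partitions. *)
Definition elem_integral (w : Omega) : R :=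
  \sum_(e : I) xi e w * dB (s e) (t e) (j e) w.

Definition elem_val (l : 'I_d) (x : Omega * measurableTypeR R) : R :=
  \sum_(e : I) (j e == l)%:R * (xi e x.1 * itvind (s e) (t e) x.2).

Let sT e : s e <= T.
Proof. by have [_ st tT _] := adm_xi e; rewrite (le_trans (ltW st)). Qed.

Lemma elem_term_sqint e : sqint P (fun w => xi e w * dB (s e) (t e) (j e) w).
Proof.
have [s0 st tT ax] := adm_xi e.
by apply: (sqint_admM H (sT e) ax); apply: (sqint_dB H) => //; exact: ltW.
Qed.

Lemma elem_integral_sqint : sqint P elem_integral.
Proof. by apply: sqint_sum => e; exact: elem_term_sqint. Qed.

Let term (e : I) (x : Omega * measurableTypeR R) :=
  xi e x.1 * itvind (s e) (t e) x.2.

Let termM e e' : (fun x => term e x * term e' x) =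
  (fun x => (fun w => xi e w * xi e' w) x.1 *
     (fun y => itvind (s e) (t e) y * itvind (s e') (t e') y) x.2).
Proof. by apply/funext => x; rewrite /term; ring. Qed.

Let intg_xi e e' : intg P (fun w => xi e w * xi e' w).
Proof.
have [_ _ _ ax] := adm_xi e; have [_ _ _ ax'] := adm_xi e'.
by apply: sqint_mul; [exact: (adm_sqint H (sT e) ax)|exact: (adm_sqint H (sT e') ax')].
Qed.

Let intg_term e e' : intg nu (fun x => term e x * term e' x).
Proof. by rewrite termM; exact: (intg_tensor (intg_xi e e') (intg_itvindM _ _ _
  _)). Qed.

Let term_sqint e : sqint nu (term e).
Proof.
split.
  have [_ _ _ ax] := adm_xi e; have mx := adm_measurable H (sT e) ax.
  apply: measurable_funM; first exact: measurableT_comp.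
  apply: measurableT_comp => //; exact: measurable_indic.
rewrite (_ : (fun _ => _) = (fun x => term e x * term e x)).
  exact: intg_term.
by apply/funext => x; rewrite expr2.
Qed.

Lemma elem_val_sqint l : sqint nu (elem_val l).
Proof. by apply: sqint_sum => e; exact: sqintZ (term_sqint e). Qed.

(** Both sides expand into one double sum over pairs of terms: on the left by the covariance of
    weighted increments, on the right by Fubini, where the time integral is the overlap of the
    intervals. Summation over [l] leaves the pairs with equal components. *)
Lemma elem_isometry : sqnm P elem_integral = \sum_(l < d) sqnm nu (elem_val l).
Proof.
pose c e e' := overlap (s e) (t e) (s e') (t e') * \int[P]_w (xi e w * xi e' w).
have it e e' : intg P (fun w => (xi e w * dB (s e) (t e) (j e) w) *
    (xi e' w * dB (s e') (t e') (j e') w)).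
  by apply: sqint_mul; exact: elem_term_sqint.
transitivity (\sum_e \sum_e' (j e == j e')%:R * c e e').
  transitivity (\int[P]_w (\sum_e \sum_e' (xi e w * dB (s e) (t e) (j e) w) *
    (xi e' w * dB (s e') (t e') (j e') w))).
    apply: eq_Rintegral => w _; rewrite expr2 mulr_suml.
    by apply: eq_bigr => e _; rewrite mulr_sumr.
  rewrite Rintegral_bigsum; last by move=> e; exact: intg_sum.
  apply: eq_bigr => e _; rewrite Rintegral_bigsum//; apply: eq_bigr => e' _.
  have [s0 st tT ax] := adm_xi e; have [s0' st' tT' ax'] := adm_xi e'.
  by rewrite (increment_pair H)// mulrA.
have -> : \sum_(l < d) sqnm nu (elem_val l) =
    \sum_(l < d) \sum_e \sum_e' (j e == l)%:R * (j e' == l)%:R * c e e'.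
  apply: eq_bigr => l _.
  transitivity (\int[nu]_x (\sum_e \sum_e' (j e == l)%:R * (j e' == l)%:R *
      (term e x * term e' x))).
    apply: eq_Rintegral => x _; rewrite expr2 mulr_suml.
    apply: eq_bigr => e _; rewrite mulr_sumr; apply: eq_bigr => e' _.
    by rewrite /term; ring.
  rewrite Rintegral_bigsum; last first.
    by move=> e; apply: intg_sum => e'; exact: intgZ.
  apply: eq_bigr => e _; rewrite Rintegral_bigsum//; last first.
    by move=> e'; exact: intgZ.
  apply: eq_bigr => e' _; rewrite RintegralZl//; last exact: intg_term.
  congr (_ * _); rewrite termM /c mulrC.
  exact: (Rintegral_tensor (intg_xi e e') (intg_itvindM _ _ _ _)).
rewrite [RHS]exchange_big/=; apply: eq_bigr => e _.
rewrite [RHS]exchange_big/=; apply: eq_bigr => e' _.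
rewrite -mulr_suml; congr (_ * _).
rewrite (bigD1 (j e))//= big1 ?addr0; last first.
  by move=> l le; rewrite eq_sym (negbTE le) mul0r.
by rewrite eqxx mul1r eq_sym.
Qed.

(** [X] is known at time 0, so it can be absorbed into each coefficient, after which every term has
    mean zero. *)
Lemma elem_integral_orth (X : Omega -> R) : adm P B A0 0 X ->
  \int[P]_w (X w * elem_integral w) = 0.
Proof.
move=> aX; have T0 : 0 <= T by exact: ltW (noise_gt0 H).
transitivity (\int[P]_w (\sum_e X w * (xi e w * dB (s e) (t e) (j e) w))).
  by apply: eq_Rintegral => w _; rewrite mulr_sumr.
rewrite Rintegral_bigsum; last first.
  move=> e; apply: sqint_mul; last exact: elem_term_sqint.
  exact: (adm_sqint H T0 aX).
rewrite big1// => e _; have [s0 st tT ax] := adm_xi e.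
have aXx : adm P B A0 (s e) (fun w => X w * xi e w).
  by apply: admM => //; exact: adm_sub aX.
rewrite -[RHS](@adapted_increment_mean _ _ _ _ _ _ _ _ H (s e) (t e) (j e) (fun
  w => X w * xi e w))//.
- by apply: eq_Rintegral => w _; rewrite mulrA.
- exact: ltW.
- by case: aXx.
- exact: sqint_intg (adm_sqint H (sT e) aXx).
Qed.

End elementary_isometry.

(** * Simple processes as finite families of increments *)

Section simple_processes.
Context (d0 : measure_display) (Omega : measurableType d0) (R : realType)
  (P : probability Omega R) (T : R) (d : nat) (B : R -> Omega -> 'cV[R]_d)
  (A0 : set (set Omega)).
Hypothesis H : noise P T B A0.
Local Notation G := (fun t => <<s GX P B A0 t >>).
Local Notation dB := (dB B).
Local Notation leb := (@lebesgue_measure R).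
Local Notation nu := (P \x leb)%E.

Section one_process.
Variables (p : nat) (S : @simple_process d0 Omega R p d).
Hypothesis adS : sp_adapted T G S.

Lemma sp_time_ge0 l : (l <= sp_size S)%N -> 0 <= sp_time S l.
Proof.
have [[t0 _] lt_t _ _] := adS.
elim: l => [|l IH ln]; first by rewrite t0.
by apply: le_trans (IH (ltnW ln)) _; apply: ltW; exact: lt_t.
Qed.

Lemma sp_time_leT l : (l <= sp_size S)%N -> sp_time S l <= T.
Proof.
have [[_ tn] lt_t _ _] := adS => ln; rewrite -(subKn ln).
have := leq_subr l (sp_size S).
elim: (sp_size S - l)%N => [|k IH kn]; first by rewrite subn0 tn.
apply: le_trans (IH (ltnW kn)).
have kk : (sp_size S - k.+1 < sp_size S)%N by rewrite ltn_subrL (leq_trans _ kn).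
by have := lt_t _ kk; rewrite -subSn// subSS => /ltW.
Qed.

Lemma sp_term_adm (r : 'I_p) (e : 'I_(sp_size S) * 'I_d) :
  [/\ 0 <= sp_time S e.1, sp_time S e.1 < sp_time S e.1.+1,
      sp_time S e.1.+1 <= T &
      adm P B A0 (sp_time S e.1) (fun w => sp_coef S e.1 w r e.2)].
Proof.
have [_ lt_t mc [M cM]] := adS; have ln := ltn_ord e.1.
split; [exact: sp_time_ge0 (ltnW ln)|exact: lt_t|exact: sp_time_leT|split].
  by have /mx_measurableP := mc _ ln; exact.
by exists M => w; exact: cM.
Qed.

End one_process.

Lemma sp_integralE p (S : @simple_process d0 Omega R p d) w (r : 'I_p) (z : 'I_1) :
  sp_integral B S w r z =
  \sum_(e : 'I_(sp_size S) * 'I_d)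
    sp_coef S e.1 w r e.2 * dB (sp_time S e.1) (sp_time S e.1.+1) e.2 w.
Proof.
rewrite /sp_integral summxE -(pair_bigA _ (fun (l : 'I_(sp_size S)) (j : 'I_d)
  => sp_coef S l w r j *
  dB (sp_time S l) (sp_time S l.+1) j w))/=.
apply: eq_bigr => l _; rewrite mxE; apply: eq_bigr => j _.
by rewrite ord1 !mxE.
Qed.

Lemma sp_valE p (S : @simple_process d0 Omega R p d) t w (r : 'I_p) (l : 'I_d) :
  sp_val S t w r l =
  \sum_(e : 'I_(sp_size S) * 'I_d) (e.2 == l)%:R *
    (sp_coef S e.1 w r e.2 * itvind (sp_time S e.1) (sp_time S e.1.+1) t).
Proof.
rewrite /sp_val summxE -(pair_bigA _ (fun (k : 'I_(sp_size S)) (j : 'I_d) =>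
  (j == l)%:R *
  (sp_coef S k w r j * itvind (sp_time S k) (sp_time S k.+1) t)))/=.
apply: eq_bigr => k _; rewrite mxE (bigD1 l)//= big1 ?addr0.
  by rewrite eqxx mul1r mulrC.
by move=> i /negbTE->; rewrite mul0r.
Qed.

Section two_processes.
Variables (p : nat) (S S' : @simple_process d0 Omega R p d).
Hypotheses (adS : sp_adapted T G S) (adS' : sp_adapted T G S').
Variable r : 'I_p.

(** A difference of two simple processes as one family: the index type is the disjoint union, and
    the minus sign goes into the coefficients of the second process. *)
Let I := ('I_(sp_size S) * 'I_d + 'I_(sp_size S') * 'I_d)%type.
Let s (e : I) := match e with inl e => sp_time S e.1 | inr e => sp_time S' e.1 end.
Let t (e : I) := match e with inl e => sp_time S e.1.+1 | inr e =>
  sp_time S' e.1.+1 end.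
Let j (e : I) := match e with inl e => e.2 | inr e => e.2 end.
Let xi (e : I) w := match e with inl e => sp_coef S e.1 w r e.2
  | inr e => - sp_coef S' e.1 w r e.2 end.

Let adm_xi e : [/\ 0 <= s e, s e < t e, t e <= T & adm P B A0 (s e) (xi e)].
Proof.
case: e => e; first exact: (sp_term_adm adS).
have [h1 h2 h3 [mc [M cM]]] := sp_term_adm adS' r e.
split => //; split; last by exists M => w; rewrite normrN.
exact: measurable_funN.
Qed.

Let integralE w : (sp_integral B S w - sp_integral B S' w) r ord0 =
  elem_integral B s t j xi w.
Proof.
rewrite !mxE !sp_integralE /elem_integral big_sumType/= -sumrN.
by congr (_ + _); apply: eq_bigr => e _; rewrite mulNr.
Qed.

Let valE l (x : Omega * measurableTypeR R) :
  (sp_val S x.2 x.1 - sp_val S' x.2 x.1) r l = elem_val s t j xi l x.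
Proof.
rewrite !mxE !sp_valE /elem_val big_sumType/= -sumrN.
by congr (_ + _); apply: eq_bigr => e _; rewrite !mulNr mulrN.
Qed.

Lemma sp_integralB_sqint :
  sqint P (fun w => (sp_integral B S w - sp_integral B S' w) r ord0).
Proof.
rewrite (_ : (fun _ => _) = elem_integral B s t j xi).
  exact: (elem_integral_sqint H _ adm_xi).
by apply/funext => w; exact: integralE.
Qed.

(** Differences are what both applications compare: the Cauchy property in the construction of Z,
    and the uniqueness of Z. *)
Lemma sp_isometry :
  sqnm P (fun w => (sp_integral B S w - sp_integral B S' w) r ord0) =
  \sum_(l < d) sqnm nu (fun x => (sp_val S x.2 x.1 - sp_val S' x.2 x.1) r l).
Proof.
rewrite (eq_sqnm _ integralE) (elem_isometry H _ adm_xi).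
by apply: eq_bigr => l _; apply: eq_sqnm => x; rewrite valE.
Qed.

End two_processes.

Section orthogonality.
Variables (p : nat) (S : @simple_process d0 Omega R p d).
Hypothesis adS : sp_adapted T G S.
Variable r : 'I_p.

Let I1 := ('I_(sp_size S) * 'I_d)%type.

Lemma sp_integral_sqint : sqint P (fun w => sp_integral B S w r ord0).
Proof.
rewrite (_ : (fun _ => _) = elem_integral B (fun e : I1 => sp_time S e.1)
    (fun e => sp_time S e.1.+1) snd (fun e w => sp_coef S e.1 w r e.2)).
  exact: (elem_integral_sqint H _ (sp_term_adm adS r)).
by apply/funext => w; exact: sp_integralE.
Qed.

Lemma sp_val_sqint l : sqint nu (fun x => sp_val S x.2 x.1 r l).
Proof.
rewrite (_ : (fun _ => _) = elem_val (fun e : I1 => sp_time S e.1)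
    (fun e => sp_time S e.1.+1) snd (fun e w => sp_coef S e.1 w r e.2) l).
  exact: (elem_val_sqint H _ (sp_term_adm adS r) l).
by apply/funext => x; exact: sp_valE.
Qed.

Lemma sp_integral_orth (X : Omega -> R) : adm P B A0 0 X ->
  \int[P]_w (X w * sp_integral B S w r ord0) = 0.
Proof.
move=> aX; rewrite -[RHS](elem_integral_orth H snd (sp_term_adm adS r) aX).
by apply: eq_Rintegral => w _; rewrite sp_integralE.
Qed.

Lemma sp_val_adapted t : 0 <= t <= T -> forall l,
  gmeas (GX P B A0 t) (fun w => sp_val S t w r l).
Proof.
move=> /andP[t0 tT] l.
rewrite (_ : (fun _ => _) = fun w => \sum_(e : 'I_(sp_size S) * 'I_d)
    ((e.2 == l)%:R * itvind (sp_time S e.1) (sp_time S e.1.+1) t) *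
    sp_coef S e.1 w r e.2); last first.
  by apply/funext => w; rewrite sp_valE; apply: eq_bigr => e _; ring.
apply: measurable_sum => e.
(* Intervals are open on the left: a term can be nonzero at [t] only if its coefficient was known
   strictly before [t]. *)
rewrite /itvind indicE mem_setE/= in_itv/=; case: ltP => [et|_]; last first.
  rewrite mulr0 (_ : (fun _ => _) = fun=> 0); first exact: measurable_cst.
  by apply/funext => w; rewrite mul0r.
apply: measurable_funM => //.
have [_ _ _ [mc _]] := sp_term_adm adS r e.
by apply: gmeas_sub mc; apply: GX_sub; exact: ltW.
Qed.

End orthogonality.
End simple_processes.

(** * Cosines of Brownian motion on uniform grids *)

Section trigonometric_estimates.
Context {R : realType}.
Implicit Types x y : R.

Lemma mean_value (f df : R -> R) : (forall x, is_derive x (1 : R) f (df x)) ->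
  forall a b, exists2 c, Num.min a b <= c <= Num.max a b &
    f b - f a = df c * (b - a).
Proof.
move=> fE.
have cf : continuous f.
  move=> x; apply: differentiable_continuous; apply/derivable1_diffP.
  by have [] := fE x.
have aux a b : a <= b -> exists2 c, Num.min a b <= c <= Num.max a b &
    f b - f a = df c * (b - a).
  move=> ab; have [c cab e] := MVT_segment ab (fun x _ =>
    fE x) (continuous_subspaceT cf).
  by exists c => //; rewrite min_l// max_r.
move=> a b; have [ab|ba] := orP (le_total a b); first exact: aux.
have [c cab e] := aux _ _ ba.
exists c; first by rewrite minC maxC.
by apply: oppr_inj; rewrite opprB e -mulrN opprB.
Qed.

Lemma norm_between0 x c : Num.min 0 x <= c <= Num.max 0 x -> `|c| <= `|x|.
Proof.
have [x0|x0] := leP 0 x.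
  by move=> /andP[c0 cx]; rewrite !ger0_norm.
by move=> /andP[xc c0]; rewrite (ltr0_norm x0) ler0_norm// lerN2.
Qed.

Lemma norm_sin_le x : `|sin x| <= `|x|.
Proof.
have [c _] := mean_value (@is_derive_sin R) 0 x.
by rewrite sin0 !subr0 => ->; rewrite normrM ler_piMl// cos_max.
Qed.

Lemma norm_cosB_le x y : `|cos x - cos y| <= `|x - y|.
Proof.
have [c _ ->] := mean_value (@is_derive_cos R) y x.
by rewrite normrM normrN ler_piMl// sin_max.
Qed.

(** From 1 - cos x = 2 sin^2 (x / 2) and |sin| <= |x|. *)
Lemma norm_cos1_le x : `|cos x - 1| <= x ^+ 2 / 2.
Proof.
rewrite [in cos x](splitr x) -mulr2n cos_mulr2n cos2sin2.
have : sin (x / 2) ^+ 2 <= (x / 2) ^+ 2.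
  rewrite -(real_normK (num_real (sin _))) -(real_normK (num_real (x / 2))).
  by rewrite lerXn2r ?nnegrE// norm_sin_le.
rewrite expr_div_n; have := sqr_ge0 (sin (x / 2)); rewrite ler_norml; lra.
Qed.

(** The mean value theorem for z - sin z, whose derivative 1 - cos c is at most c^2 / 2. *)
Lemma norm_subr_sin_le x : `|x - sin x| <= `|x| ^+ 3.
Proof.
have dx (y : R) : is_derive y (1 : R) (fun z => z - sin z) (1 - cos y).
  by apply: is_derive_eq.
have [c /norm_between0 cx] := mean_value dx 0 x.
rewrite sin0 !subr0 => ->; rewrite normrM distrC exprSr.
apply: ler_wpM2r => //; apply: (le_trans (norm_cos1_le c)).
apply: (@le_trans _ _ (`|c| ^+ 2)); last by rewrite lerXn2r ?nnegrE.
by rewrite -normrX ger0_norm ?sqr_ge0// ler_pdivrMr// ler_peMr ?sqr_ge0// ler1n.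
Qed.

(** Discrete variation of constants for u (i + 1) = a i * u i + remainder. It is applied with u i =
    cos x_i and a i the mean of the cosine of the i-th step. *)
Lemma telescope_weighted (a u : nat -> R) n :
  u n = (\prod_(0 <= i < n) a i) * u 0%N +
    \sum_(0 <= i < n) (\prod_(i.+1 <= k < n) a k) * (u i.+1 - a i * u i).
Proof.
elim: n => [|n IH]; first by rewrite !big_geq// mul1r addr0.
have -> : \sum_(0 <= i < n.+1) (\prod_(i.+1 <= k < n.+1) a k) * (u i.+1 - a i * u i) =
    a n * (\sum_(0 <= i < n) (\prod_(i.+1 <= k < n) a k) * (u i.+1 - a i * u i)) +
    (u n.+1 - a n * u n).
  rewrite big_nat_recr//= (@big_geq _ _ _ n.+1 n.+1)// mul1r mulr_sumr.
  congr (_ + _); apply: eq_big_nat => i /andP[_ ilt].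
  by rewrite big_nat_recr//= mulrA [a n * _]mulrC.
rewrite big_nat_recr//=.
have -> : u n.+1 = a n * u n + (u n.+1 - a n * u n) by ring.
by rewrite {1}IH; ring.
Qed.

(** Compare every summand with the largest one. For k = 0 and d = 0 the left side would be 1 and the
    right side 0. *)
Lemma norm_sum_pow_le (d : nat) (y : 'I_d -> R) k : (0 < k)%N ->
  `|\sum_(l < d) y l| ^+ k <= d%:R ^+ k * \sum_(l < d) `|y l| ^+ k.
Proof.
move=> k0; case: d y => [|d] y.
  by rewrite !big_ord0 normr0 mulr0 expr0n (gtn_eqF k0).
have [l0 _ max_l0] := @arg_maxP _ _ 'I_d.+1 ord0 xpredT (fun l => `|y l|) isT.
apply: (@le_trans _ _ ((d.+1%:R * `|y l0|) ^+ k)).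
  apply: lerXn2r; rewrite ?nnegrE// ?mulr_ge0//.
  apply: (le_trans (ler_norm_sum _ _ _)).
  rewrite mulr_natl -[X in _ *+ X](card_ord d.+1) -sumr_const.
  by apply: ler_sum => l _; exact: max_l0.
rewrite exprMn ler_wpM2l ?exprn_ge0// (bigD1 l0)//= lerDl.
by apply: sumr_ge0 => l _; rewrite exprn_ge0.
Qed.

End trigonometric_estimates.

(** * Variables approximable by integrals on uniform grids *)

Section approximable.
Context (d0 : measure_display) (Omega : measurableType d0) (R : realType)
  (P : probability Omega R) (T : R) (d : nat) (B : R -> Omega -> 'cV[R]_d)
  (A0 : set (set Omega)).
Hypothesis H : noise P T B A0.
Local Notation GX := (GX P B A0).
Local Notation dB := (dB B).

Definition gridt (n i : nat) : R := i%:R * (T / n%:R).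

Definition gincr n i l := dB (gridt n i) (gridt n i.+1) l.

Definition grid_sum n (c : nat -> 'I_d -> Omega -> R) (w : Omega) : R :=
  \sum_(i < n) \sum_(l < d) c i l w * gincr n i l w.

Definition grid_approx n (Y : Omega -> R) (e : R) :=
  exists (N0 : Omega -> R) (c : nat -> 'I_d -> Omega -> R),
    [/\ gmeas A0 N0, bnd N0,
        forall i l, (i < n)%N -> adm P B A0 (gridt n i) (c i l) &
        sqnm P (fun w => Y w - (N0 w + grid_sum n c w)) <= e].

(* The approximation is asked for on every fine enough uniform grid, so that
   finitely many approximable variables can be treated on one common grid. *)
Definition approx (Y : Omega -> R) :=
  sqint P Y /\ forall e, 0 < e ->
    exists n0, forall n, (0 < n)%N -> (n0 <= n)%N -> grid_approx n Y e.

Let T0 : 0 < T := noise_gt0 H.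

Lemma gridt0 n : gridt n 0 = 0.
Proof. by rewrite /gridt mul0r. Qed.

Lemma gridtn n : (0 < n)%N -> gridt n n = T.
Proof. by move=> n0; rewrite /gridt mulrCA divff ?mulr1// pnatr_eq0 -lt0n. Qed.

Lemma gridt_ge0 n i : 0 <= gridt n i.
Proof. by rewrite mulr_ge0// divr_ge0// ltW. Qed.

Lemma gridt_le n i k : (i <= k)%N -> gridt n i <= gridt n k.
Proof. by move=> ik; rewrite ler_wpM2r ?ler_nat// divr_ge0// ltW. Qed.

Lemma gridt_lt n i : (0 < n)%N -> gridt n i < gridt n i.+1.
Proof. by move=> n0; rewrite ltr_pM2r ?ltr_nat// divr_gt0// ltr0n. Qed.

Lemma gridt_leT n i : (0 < n)%N -> (i <= n)%N -> gridt n i <= T.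
Proof. by move=> n0 ilen; rewrite -[leRHS](gridtn n0) gridt_le. Qed.

Lemma gridtS n i : gridt n i.+1 - gridt n i = T / n%:R.
Proof. by rewrite /gridt -mulrBl -natr1 [_ + 1]addrC addrK mul1r. Qed.

Lemma A0_adm t (X : Omega -> R) : gmeas A0 X -> bnd X -> adm P B A0 t X.
Proof.
by move=> mX bX; split => //; apply: gmeas_sub mX; exact: A0_sub_GX.
Qed.

Lemma A0_sqint (X : Omega -> R) : gmeas A0 X -> bnd X -> sqint P X.
Proof.
move=> mX bX; apply: (adm_sqint H (ltW T0)); exact: A0_adm.
Qed.

Lemma gincr_sqint n i l : (i < n)%N -> sqint P (gincr n i l).
Proof.
move=> ilen; have n0 : (0 < n)%N by exact: leq_ltn_trans ilen.
by apply: (dB_sqint H); [exact: gridt_ge0|exact: gridt_lt|exact: gridt_leT].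
Qed.

Lemma grid_sum_sqint n c :
  (forall i l, (i < n)%N -> adm P B A0 (gridt n i) (c i l)) ->
  sqint P (grid_sum n c).
Proof.
move=> ac; apply: sqint_sum => i; apply: sqint_sum => l.
have n0 : (0 < n)%N by exact: leq_ltn_trans (ltn_ord i).
apply: (sqint_admM H (gridt_leT n0 (ltnW (ltn_ord i))) (ac i l (ltn_ord i))).
exact: gincr_sqint.
Qed.

Lemma approxD Y Z : approx Y -> approx Z -> approx (fun w => Y w + Z w).
Proof.
move=> [sY aY] [sZ aZ]; split; first exact: sqintD.
move=> e e0; have e40 : 0 < e / 4 by rewrite divr_gt0.
have [n1 h1] := aY _ e40; have [n2 h2] := aZ _ e40.
exists (maxn n1 n2) => n n0; rewrite geq_max => /andP[n1n n2n].
have [N1 [c1 [mN1 bN1 ac1 le1]]] := h1 n n0 n1n.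
have [N2 [c2 [mN2 bN2 ac2 le2]]] := h2 n n0 n2n.
exists (fun w => N1 w + N2 w), (fun i l w => c1 i l w + c2 i l w).
split; [exact: measurable_funD|exact: bndD|by move=> i l il; apply: admD;
  [exact: ac1|exact: ac2]|].
rewrite (@eq_sqnm _ _ _ _ _ (fun w => (Y w - (N1 w + grid_sum n c1 w)) +
    (Z w - (N2 w + grid_sum n c2 w)))); last first.
  move=> w; have -> : grid_sum n (fun i l w => c1 i l w + c2 i l w) w =
      grid_sum n c1 w + grid_sum n c2 w.
    rewrite /grid_sum -big_split/=; apply: eq_bigr => i _.
    by rewrite -big_split/=; apply: eq_bigr => l _; rewrite mulrDl.
  by ring.
apply: (le_trans (sqnmD_le _ _)).
- by apply: sqintB => //; apply: sqintD; [exact: A0_sqint|exact: grid_sum_sqint].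
- by apply: sqintB => //; apply: sqintD; [exact: A0_sqint|exact: grid_sum_sqint].
- by lra.
Qed.

Lemma approxZ a Y : approx Y -> approx (fun w => a * Y w).
Proof.
move=> [sY aY]; split; first exact: sqintZ.
(* The added 1 keeps the divisor positive when a = 0. *)
move=> e e0; have a0 : 0 < a ^+ 2 + 1 by rewrite ltr_wpDl// sqr_ge0.
have ea0 : 0 < e / (a ^+ 2 + 1) by rewrite divr_gt0.
have [n1 h1] := aY _ ea0.
exists n1 => n n0 n1n; have [N1 [c1 [mN1 bN1 ac1 le1]]] := h1 n n0 n1n.
exists (fun w => a * N1 w), (fun i l w => a * c1 i l w).
split; [exact: measurable_funM|by apply: bndM => //; exact: bnd_cst|
  by move=> i l il; apply: admM; [exact: adm_cst|exact: ac1]|].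
rewrite (@eq_sqnm _ _ _ _ _ (fun w => a * (Y w - (N1 w + grid_sum n c1 w))));
  last first.
  move=> w; have -> : grid_sum n (fun i l w => a * c1 i l w) w = a * grid_sum n c1 w.
    rewrite /grid_sum mulr_sumr; apply: eq_bigr => i _.
    by rewrite mulr_sumr; apply: eq_bigr => l _; rewrite mulrA.
  by ring.
rewrite sqnmZ; last first.
  by apply: sqintB => //; apply: sqintD; [exact: A0_sqint|exact: grid_sum_sqint].
move: le1; rewrite ler_pdivlMr// mulrDr mulr1 mulrC; apply: le_trans.
by rewrite lerDl sqnm_ge0.
Qed.

(** By [sqnm_triangle3], a grid approximation of Z within e / 4 serves for Y as soon as Z is within
    e / 4 of Y. *)
Lemma approx_closed Y : sqint P Y ->
  (forall e, 0 < e -> exists2 Z, approx Z & sqnm P (fun w => Y w - Z w) <= e) ->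
  approx Y.
Proof.
move=> sY h; split => // e e0; have e40 : 0 < e / 4 by rewrite divr_gt0.
have [Z [sZ aZ] YZ] := h _ e40; have [n0 hn0] := aZ _ e40.
exists n0 => n n_gt0 n0n; have [N1 [c1 [mN1 bN1 ac1 le1]]] := hn0 n n_gt0 n0n.
exists N1, c1; split => //.
have sS : sqint P (fun w => N1 w + grid_sum n c1 w).
  by apply: sqintD; [exact: A0_sqint|exact: grid_sum_sqint].
by apply: (le_trans (sqnm_triangle3 sY sZ sS)); lra.
Qed.

Lemma approx_null (Y : Omega -> R) : measurable_fun setT Y ->
  {ae P, forall w, Y w = 0} -> approx Y.
Proof.
move=> mY Y0; have [sY nY] := ae_sqnm0 Y0 mY; split => // e e0.
exists 0%N => n n0 _; exists (fun=> 0), (fun _ _ _ => 0).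
split; [exact: measurable_cst|exact: bnd_cst|by move=> *; exact: adm_cst|].
rewrite (@eq_sqnm _ _ _ _ _ Y) ?nY ?ltW// => w.
rewrite /grid_sum big1 ?addr0 ?subr0// => i _.
by rewrite big1// => l _; rewrite mul0r.
Qed.

Lemma approx_dominated (Y_ : nat -> Omega -> R) Y g :
  (forall n, approx (Y_ n)) -> sqint P g -> (forall n w, `|Y_ n w| <= g w) ->
  (forall w, Y_ n w @[n --> \oo] --> Y w) -> approx Y.
Proof.
move=> aY sg Yg Ycvg.
have mY n : measurable_fun setT (Y_ n) by have [[]] := aY n.
have [sY h] := sqint_dominated mY sg Yg Ycvg.
by apply: approx_closed => // e /h[n hn]; exists (Y_ n).
Qed.

End approximable.

(** * The cosine of a linear form of grid increments *)

Section grid_cosine.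
Context (d0 : measure_display) (Omega : measurableType d0) (R : realType)
  (P : probability Omega R) (T : R) (d : nat) (B : R -> Omega -> 'cV[R]_d)
  (A0 : set (set Omega)).
Hypothesis H : noise P T B A0.
Local Notation GX := (GX P B A0).
Local Notation dB := (dB B).
Local Notation adm := (adm P B A0).

Let T0 : 0 < T := noise_gt0 H.

Variables (A : set Omega) (theta : R) (lam : nat -> 'I_d -> R) (L : R) (n : nat).
Hypotheses (AA : <<s A0 >> A) (lamL : forall i l, `|lam i l| <= L) (n0 : (0 < n)%N).

Local Notation t := (gridt T n).
Local Notation db := (gincr T B n).

Definition grid_step i (w : Omega) : R := \sum_(l < d) lam i l * db i l w.

Definition grid_phase i (w : Omega) : R :=
  theta + \sum_(0 <= k < i) grid_step k w.

Let a i : R := \int[P]_w cos (grid_step i w).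

Let pr i : R := \prod_(i.+1 <= k < n) a k.

Let indA : Omega -> R := \1_A.

Let L0 : (0 < d)%N -> 0 <= L.
Proof. by case: d lam lamL => // d' la laL _; apply: le_trans (laL 0%N ord0). Qed.

Let t_ge0 i : 0 <= t i. Proof. exact: (gridt_ge0 H). Qed.
Let t_lt i : t i < t i.+1. Proof. exact: (gridt_lt H). Qed.
Let t_leT i : (i <= n)%N -> t i <= T. Proof. exact: (gridt_leT H). Qed.
Let t_le i k : (i <= k)%N -> t i <= t k. Proof. exact: (gridt_le H). Qed.

Let step_incgen i : (i < n)%N ->
  gmeas (mxgen (fun w => B (t i.+1) w - B (t i) w)) (grid_step i).
Proof.
move=> ilen; apply: measurable_sum => l; apply: measurable_funM => //.
exact: incgen_dB.
Qed.

Let step_gmeas i k : (i < k)%N -> gmeas (GX (t k)) (grid_step i).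
Proof.
move=> ik; apply: measurable_sum => l; apply: measurable_funM => //.
by apply: GX_dB => //; [exact: ltW|exact: t_le].
Qed.

Let phase_gmeas i : gmeas (GX (t i)) (grid_phase i).
Proof.
apply: measurable_funD => //.
rewrite (_ : (fun _ => _) = fun w => \sum_(k < i) grid_step k w); last first.
  by apply/funext => w; rewrite big_mkord.
by apply: measurable_sum => k; exact: step_gmeas.
Qed.

Let cos_gmeas (X : set (set Omega)) (f : Omega -> R) :
  gmeas X f -> gmeas X (fun w => cos (f w)).
Proof.
by move=> mf; apply: measurableT_comp => //; apply: continuous_measurable_fun;
  exact: continuous_cos.
Qed.

Let sin_gmeas (X : set (set Omega)) (f : Omega -> R) :
  gmeas X f -> gmeas X (fun w => sin (f w)).
Proof.
by move=> mf; apply: measurableT_comp => //; apply: continuous_measurable_fun;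
  exact: continuous_sin.
Qed.

Let indA_A0 : gmeas A0 indA. Proof. exact: gmeas_indic. Qed.

Let indA_le1 w : `|indA w| <= 1.
Proof. by rewrite /indA indicE; case: (_ \in _); rewrite /= ?normr0 ?normr1. Qed.

Let indA_adm i : adm i indA.
Proof. by apply: A0_adm => //; exists 1. Qed.

Let cos_adm i : adm (t i) (fun w => cos (grid_phase i w)).
Proof. by split; [exact: cos_gmeas|exists 1 => w; exact: cos_max]. Qed.

Let sin_adm i : adm (t i) (fun w => sin (grid_phase i w)).
Proof. by split; [exact: sin_gmeas|exists 1 => w; exact: sin_max]. Qed.

Let cstep_adm i k : (i < k)%N -> adm (t k) (fun w => cos (grid_step i w)).
Proof.
by move=> ik; split; [apply: cos_gmeas; exact: step_gmeas|exists 1 => w;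
  exact: cos_max].
Qed.

Let cstep_sqint i : (i < n)%N -> sqint P (fun w => cos (grid_step i w)).
Proof.
by move=> ilen; apply: (adm_sqint H (t_leT ilen)); exact: cstep_adm.
Qed.

Let step_sqint i : (i < n)%N -> sqint P (grid_step i).
Proof.
move=> ilen; apply: sqint_sum => l; apply: sqintZ; exact: (gincr_sqint H).
Qed.

Let a_le1 i : (i < n)%N -> `|a i| <= 1.
Proof.
move=> ilen; rewrite -(@ler_pXn2r _ 2) ?nnegrE// expr1n.
rewrite -normrX ger0_norm ?sqr_ge0//.
apply: (le_trans (sqr_Rintegral_le (cstep_sqint ilen))).
rewrite -[leRHS](expr1n _ 2); apply: sqnm_bnd.
  by case: (cstep_sqint ilen).
by move=> w; exact: cos_max.
Qed.

Let pr_le1 i : `|pr i| <= 1.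
Proof.
rewrite /pr normr_prod big_seq; apply: prodr_ile1 => k.
by rewrite mem_index_iota => /andP[_ kn]; rewrite normr_ge0 a_le1.
Qed.

(** [bound2] and [bound3] dominate 1 - cos s and s - sin s by squares and cubes of the increments.
    Their squared norms are governed by the moments of order 4 and 6, hence are of order h^2 and
    h^3. *)
Let bound2 i w := (d%:R * L) ^+ 2 * \sum_(l < d) db i l w ^+ 2.

Let bound3 i w := (d%:R * L) ^+ 3 * \sum_(l < d) `|db i l w| ^+ 3.

Let step_pow_le i w k : (0 < k)%N ->
  `|grid_step i w| ^+ k <= (d%:R * L) ^+ k * \sum_(l < d) `|db i l w| ^+ k.
Proof.
move=> k0; apply: (le_trans (norm_sum_pow_le _ k0)).
rewrite exprMn -mulrA ler_wpM2l ?exprn_ge0// mulr_sumr.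
apply: ler_sum => l _; rewrite normrM exprMn ler_wpM2r ?exprn_ge0//.
have d_gt0 : (0 < d)%N by exact: leq_ltn_trans (ltn_ord l).
by rewrite lerXn2r ?nnegrE// L0.
Qed.

(** [L] is known to be nonnegative only if there is a component; for d = 0 the product vanishes. *)
Let dL0 : 0 <= d%:R * L.
Proof.
have [->|] := posnP d; first by rewrite mul0r.
by move=> /L0 L_ge0; rewrite mulr_ge0.
Qed.

Let cos_err i w : `|cos (grid_step i w) - 1| <= bound2 i w.
Proof.
apply: (le_trans (norm_cos1_le _)).
apply: (@le_trans _ _ (`|grid_step i w| ^+ 2)).
  by rewrite -normrX ger0_norm ?sqr_ge0// ler_pdivrMr// ler_peMr ?sqr_ge0// ler1n.
apply: (le_trans (step_pow_le _ _ _)) => //.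
rewrite /bound2; apply: ler_wpM2l; first by rewrite exprn_ge0.
by apply: ler_sum => l _; rewrite -normrX ger0_norm// sqr_ge0.
Qed.

Let sin_err i w : `|grid_step i w - sin (grid_step i w)| <= bound3 i w.
Proof. exact: le_trans (norm_subr_sin_le _) (step_pow_le _ _ _). Qed.

Let h := T / n%:R.

Let db_meas i l : (i < n)%N -> measurable_fun setT (db i l).
Proof. by move=> ilen; case: (gincr_sqint H l ilen). Qed.

Let bound2_sqint i : (i < n)%N -> sqint P (bound2 i) /\
  sqnm P (bound2 i) <= 64 * (d%:R * L) ^+ 4 * d%:R ^+ 2 * h ^+ 2.
Proof.
move=> ilen.
have m4 l := dB_moment4 H (t_ge0 i) (t_lt i) (t_leT ilen) l.
have e4 l : (fun w => (db i l w ^+ 2) ^+ 2) = (fun w => db i l w ^+ 4).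
  by apply/funext => w; rewrite -exprM.
have s2 l : sqint P (fun w => db i l w ^+ 2).
  split; first by apply: measurable_funX; exact: db_meas.
  by rewrite e4; case: (m4 l).
have ss := sqint_sum (index_enum 'I_d) s2.
split; first exact: sqintZ.
rewrite sqnmZ// -exprM.
apply: (@le_trans _ _ ((d%:R * L) ^+ 4 * (d%:R * \sum_(l < d) 64 * h ^+ 2))).
  rewrite ler_wpM2l ?exprn_ge0//; apply: (le_trans (sqnm_sum_le s2)).
  rewrite ler_wpM2l//; apply: ler_sum => l _.
  by have [_] := m4 l; rewrite gridtS -e4.
rewrite sumr_const card_ord -mulr_natl le_eqVlt; apply/orP; left; apply/eqP; ring.
Qed.

Let bound3_sqint i : (i < n)%N -> sqint P (bound3 i) /\
  sqnm P (bound3 i) <= 768 * (d%:R * L) ^+ 6 * d%:R ^+ 2 * h ^+ 3.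
Proof.
move=> ilen.
have m6 l := dB_moment6 H (t_ge0 i) (t_lt i) (t_leT ilen) l.
have e6 l : (fun w => (`|db i l w| ^+ 3) ^+ 2) = (fun w => db i l w ^+ 6).
  apply/funext => w; rewrite -exprM -normrX ger0_norm//.
  by rewrite exprn_even_ge0.
have s3 l : sqint P (fun w => `|db i l w| ^+ 3).
  split.
    apply: measurable_funX; apply: measurableT_comp => //; exact: db_meas.
  by rewrite e6; case: (m6 l).
have ss := sqint_sum (index_enum 'I_d) s3.
split; first exact: sqintZ.
rewrite sqnmZ// -exprM.
apply: (@le_trans _ _ ((d%:R * L) ^+ 6 * (d%:R * \sum_(l < d) 768 * h ^+ 3))).
  rewrite ler_wpM2l ?exprn_ge0//; apply: (le_trans (sqnm_sum_le s3)).
  rewrite ler_wpM2l//; apply: ler_sum => l _.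
  by have [_] := m6 l; rewrite gridtS -e6.
rewrite sumr_const card_ord -mulr_natl le_eqVlt; apply/orP; left; apply/eqP; ring.
Qed.

Let coef i w := indA w * pr i * cos (grid_phase i w).

Let coef' i w := indA w * pr i * sin (grid_phase i w).

Let coef_le1 i w : `|coef i w| <= 1.
Proof.
rewrite !normrM -[leRHS]mulr1; apply: ler_pM => //; last exact: cos_max.
by rewrite -[leRHS]mulr1; apply: ler_pM.
Qed.

Let coef'_le1 i w : `|coef' i w| <= 1.
Proof.
rewrite !normrM -[leRHS]mulr1; apply: ler_pM => //; last exact: sin_max.
by rewrite -[leRHS]mulr1; apply: ler_pM.
Qed.

Let coef_adm i : adm (t i) (coef i).
Proof. by apply: admM => //; apply: admM => //; exact: adm_cst. Qed.

Let coef'_adm i : adm (t i) (coef' i).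
Proof. by apply: admM => //; apply: admM => //; exact: adm_cst. Qed.

(* M i is a martingale difference, and E i comes from replacing sin s by s in
   the expansion of cos (x + s). *)
Let M i w := coef i w * (cos (grid_step i w) - a i).

Let E i w := coef' i w * (grid_step i w - sin (grid_step i w)).

Let M_sqint i : (i < n)%N -> sqint P (M i).
Proof.
move=> ilen; apply: (sqint_admM H (t_leT (ltnW ilen)) (coef_adm i)).
apply: sqintB; first exact: cstep_sqint.
by apply: (adm_sqint H (t_leT (ltnW ilen))); exact: adm_cst.
Qed.

(** cos s - a is the centred version of cos s - 1, and centring does not increase the norm. The
    prefactor is at most 1. *)
Let M_sqnm i : (i < n)%N -> sqnm P (M i) <= 64 * (d%:R * L) ^+ 4 * d%:R ^+ 2 * h ^+ 2.
Proof.
move=> ilen; have [sb] := bound2_sqint ilen; apply: le_trans.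
have s1 : sqint P (fun w => cos (grid_step i w) - 1).
  apply: sqintB; first exact: cstep_sqint.
  by apply: (adm_sqint H (t_leT (ltnW ilen))); exact: adm_cst.
have sa : sqint P (fun w => cos (grid_step i w) - a i).
  apply: sqintB; first exact: cstep_sqint.
  by apply: (adm_sqint H (t_leT (ltnW ilen))); exact: adm_cst.
apply: (@le_trans _ _ (sqnm P (fun w => cos (grid_step i w) - a i))).
  apply: sqnm_le => //; first exact: M_sqint.
  by move=> w; rewrite /M normrM ler_piMl.
have ea : a i = \int[P]_w (cos (grid_step i w) - 1) + 1.
  rewrite RintegralB ?Rintegral_prob_cst ?subrK//.
    exact: sqint_intg (cstep_sqint ilen).
  exact: finite_measure_integrable_cst.
apply: (@le_trans _ _ (sqnm P (fun w => cos (grid_step i w) - 1))).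
  rewrite (eq_sqnm _ (g := fun w => (cos (grid_step i w) - 1) -
    \int[P]_w (cos (grid_step i w) - 1))); first exact: sqnm_center_le.
  by move=> w; rewrite ea; ring.
apply: sqnm_le => // w; apply: (le_trans (cos_err i w)); exact: ler_norm.
Qed.

(** All factors but the k-th centred cosine are known at time [t k], and that cosine is a function
    of the increment after [t k]. *)
Let M_orth i k : (i < k)%N -> (k < n)%N -> \int[P]_w (M i w * M k w) = 0.
Proof.
move=> ik kn; have iln := ltn_trans ik kn.
pose X w := M i w * coef k w.
have aX : adm (t k) X.
  apply: admM => //; apply: admM.
    by apply: (adm_sub _ (coef_adm i)); exact: t_le (ltnW ik).
  by apply: (@admD _ _ _ _ _ _ _ _ _ (fun=> - a i)); [exact: cstep_adm|exact: adm_cst].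
have sc : sqint P (fun w => cos (grid_step k w) - a k).
  apply: sqintB; first exact: cstep_sqint.
  by apply: (adm_sqint H (t_leT (ltnW kn))); exact: adm_cst.
have mc : gmeas (mxgen (fun w => B (t k.+1) w - B (t k) w))
    (fun w => cos (grid_step k w) - a k).
  by apply: measurable_funB => //; apply: cos_gmeas; exact: step_incgen.
have [_ e] := GX_indep_Rintegral H (t_ge0 k) (t_lt k) (t_leT kn) aX.1 mc
  (sqint_intg (adm_sqint H (t_leT (ltnW kn)) aX)) (sqint_intg sc).
transitivity (\int[P]_w (X w * (cos (grid_step k w) - a k))).
  by apply: eq_Rintegral => w _; rewrite /X /M; ring.
rewrite e RintegralB ?Rintegral_prob_cst ?subrr ?mulr0//.
  exact: sqint_intg (cstep_sqint kn).
exact: finite_measure_integrable_cst.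
Qed.

Let E_sqint i : (i < n)%N -> sqint P (E i).
Proof.
move=> ilen; apply: (sqint_admM H (t_leT (ltnW ilen)) (coef'_adm i)).
apply: sqintB; first exact: step_sqint.
apply: (adm_sqint H (t_leT ilen)); split; last by exists 1 => w; exact: sin_max.
by apply: sin_gmeas; exact: step_gmeas.
Qed.

Let E_sqnm i : (i < n)%N -> sqnm P (E i) <= 768 * (d%:R * L) ^+ 6 * d%:R ^+ 2 * h ^+ 3.
Proof.
move=> ilen; have [sb] := bound3_sqint ilen; apply: le_trans.
apply: sqnm_le => //; first exact: E_sqint.
move=> w; rewrite /E normrM.
apply: (@le_trans _ _ (bound3 i w)); last exact: ler_norm.
by rewrite -[leRHS]mul1r; apply: ler_pM.
Qed.

(** The factors 2 come from [sqnmD_le]. With mesh h = T / n, the orthogonal terms sum to a multiple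
    of n * h^2 = T^2 / n, and the others to a multiple of n * n * h^3 = T^3 / n. The frequencies
    enter only through their bound [L]. *)
Definition grid_cosine_cst : R :=
  2 * (64 * (d%:R * L) ^+ 4 * d%:R ^+ 2 * T ^+ 2) +
  2 * (768 * (d%:R * L) ^+ 6 * d%:R ^+ 2 * T ^+ 3).

Lemma grid_cosine_approx :
  grid_approx P T B A0 n (fun w => \1_A w * cos (grid_phase n w))
    (grid_cosine_cst / n%:R).
Proof.
exists (fun w => indA w * ((\prod_(0 <= i < n) a i) * cos theta)),
  (fun i l w => - (coef' i w * lam i l)).
split.
- exact: measurable_funM.
- by apply: bndM; [exists 1|exact: bnd_cst].
- move=> i l ilen; rewrite (_ : (fun _ => _) = fun w => coef' i w * (- lam i l)).
    by apply: admM => //; exact: adm_cst.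
  by apply/funext => w; rewrite mulrN.
(* Each telescoped remainder is cos x (cos s - a) - sin x sin s. Subtracting the grid integral,
   whose term is - sin x * s, leaves exactly [M] and [E]. *)
rewrite (@eq_sqnm _ _ _ _ _ (fun w =>
  \sum_(i < n) M i w + \sum_(i < n) E i w)); last first.
  move=> w; rewrite (telescope_weighted a (fun i => cos (grid_phase i w))).
  rewrite [X in cos X](_ : grid_phase 0 w = theta); last first.
    by rewrite /grid_phase big_geq// addr0.
  rewrite !big_mkord mulrDr opprD addrA -/indA [_ - indA w * _]addrC addrA.
  rewrite addNr add0r /grid_sum -sumrN mulr_sumr -!big_split/=.
  apply: eq_bigr => i _; rewrite -/(pr i).
  have -> : \sum_(l < d) - (coef' i w * lam i l) * db i l w =
    - coef' i w * grid_step i w.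
    by rewrite /grid_step mulr_sumr; apply: eq_bigr => l _; ring.
  have -> : grid_phase i.+1 w = grid_phase i w + grid_step i w.
    by rewrite /grid_phase big_nat_recr//= addrA.
  by rewrite cosD /M /E /coef /coef'; ring.
have sM (i : 'I_n) : sqint P (M i) by exact: M_sqint.
have sE (i : 'I_n) : sqint P (E i) by exact: E_sqint.
apply: (le_trans (sqnmD_le (sqint_sum _ sM) (sqint_sum _ sE))).
have nR : (0 : R) < n%:R by rewrite ltr0n.
rewrite /grid_cosine_cst [leRHS]mulrDl; apply: lerD; rewrite -[leRHS]mulrA ler_wpM2l//.
- rewrite sqnm_orth_sum//; last by move=> i k ik; exact: M_orth.
  apply: (@le_trans _ _ (\sum_(i < n) 64 * (d%:R * L) ^+ 4 * d%:R ^+ 2 * h ^+ 2)).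
    by apply: ler_sum => i _; exact: M_sqnm.
  rewrite sumr_const card_ord -mulr_natl /h le_eqVlt; apply/orP; left; apply/eqP.
  by field; rewrite gt_eqF.
- apply: (le_trans (sqnm_sum_le sE)).
  apply: (@le_trans _ _ (n%:R * \sum_(i < n) 768 * (d%:R * L) ^+ 6 * d%:R ^+ 2
    * h ^+ 3)).
    by rewrite ler_wpM2l//; apply: ler_sum => i _; exact: E_sqnm.
  rewrite sumr_const card_ord -mulr_natl /h le_eqVlt; apply/orP; left; apply/eqP.
  by field; rewrite gt_eqF.
Qed.

End grid_cosine.

(** * From grid times to arbitrary times *)

Section cosine_approximable.
Context (d0 : measure_display) (Omega : measurableType d0) (R : realType)
  (P : probability Omega R) (T : R) (d : nat) (B : R -> Omega -> 'cV[R]_d)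
  (A0 : set (set Omega)).
Hypothesis H : noise P T B A0.
Local Notation dB := (dB B).

Let T0 : 0 < T := noise_gt0 H.

(* a frequency, a time and a component *)
Definition freq := (R * R * 'I_d)%type.

Definition freq_ok (q : freq) := 0 <= q.1.2 <= T.

(** Increments from time 0 are used instead of values of [B]: the grid sums telescope to them
    exactly, whereas B_0 = 0 is only almost sure. *)
Definition phase (theta : R) (js : seq freq) (w : Omega) : R :=
  theta + \sum_(q <- js) q.1.1 * dB 0 q.1.2 q.2 w.

Definition grid_floor n (r : R) : nat := Num.trunc (r / (T / n%:R)).

Lemma grid_floorP n r : (0 < n)%N -> 0 <= r <= T ->
  [/\ (grid_floor n r <= n)%N, gridt T n (grid_floor n r) <= r &
      r - gridt T n (grid_floor n r) <= T / n%:R].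
Proof.
move=> n0 /andP[r0 rT]; have nR : (0 : R) < n%:R by rewrite ltr0n.
have h0 : 0 < T / n%:R by rewrite divr_gt0.
have q0 : 0 <= r / (T / n%:R) by rewrite divr_ge0// ltW.
have /andP[le1 lt2] := truncn_itv q0; rewrite -/(grid_floor n r) in le1 lt2.
have kr : gridt T n (grid_floor n r) <= r by rewrite /gridt -ler_pdivlMr.
split=> //.
  rewrite -(ler_nat R) (le_trans le1)// ler_pdivrMr// mulrCA divff ?gt_eqF//.
  by rewrite mulr1.
rewrite -[leRHS](gridtS T n (grid_floor n r)) lerD2r ltW// /gridt.
by rewrite -ltr_pdivrMr.
Qed.

Section frequencies.
Variables (A : set Omega) (theta : R) (js : seq freq).
Hypotheses (AA : <<s A0 >> A) (okjs : all freq_ok js).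

(** The i-th grid increment is part of the increment up to the rounded time of [q] exactly when [i]
    is below its grid index, so its coefficient collects the frequencies of the later times. *)
Let lam n i (l : 'I_d) : R :=
  \sum_(q <- js) q.1.1 * ((q.2 == l) && (i < grid_floor n q.1.2)%N)%:R.

(** A bound that does not depend on the mesh, so that the constant of [grid_cosine_approx] is the
    same for all grids. *)
Let L : R := \sum_(q <- js) `|q.1.1|.

Let lamL n i l : `|lam n i l| <= L.
Proof.
apply: (le_trans (ler_norm_sum _ _ _)); apply: ler_sum => q _.
by rewrite normrM ler_piMr//; case: (_ && _); rewrite ?normr0 ?normr1.
Qed.

Let lam_phase n w : (0 < n)%N ->
  grid_phase T B theta (lam n) n n w =
  theta + \sum_(q <- js) q.1.1 * dB 0 (gridt T n (grid_floor n q.1.2)) q.2 w.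
Proof.
move=> n0; congr (_ + _); rewrite /grid_step.
transitivity (\sum_(0 <= k < n) \sum_(q <- js)
    q.1.1 * ((k < grid_floor n q.1.2)%N%:R * gincr T B n k q.2 w)).
  apply: eq_big_nat => k _; rewrite /lam.
  under eq_bigr do rewrite mulr_suml.
  rewrite exchange_big/=; apply: eq_bigr => q _.
  rewrite (bigD1 q.2)//= eqxx/= big1 ?addr0 ?mulrA// => l lq.
  by rewrite eq_sym (negbTE lq) mulr0 mul0r.
rewrite exchange_big/=; apply: eq_big_seq => q qjs.
have [kn _ _] := grid_floorP n0 (allP okjs _ qjs).
rewrite -mulr_sumr; congr (_ * _).
rewrite (big_cat_nat (n := grid_floor n q.1.2))//= [X in _ + X]big1_seq ?addr0;
  last first.
  by move=> k /andP[_]; rewrite mem_index_iota => /andP[kk _]; rewrite ltnNge kk mul0r.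
rewrite (eq_big_nat _ _ (F2 := fun k =>
  B (gridt T n k.+1) w q.2 ord0 - B (gridt T n k) w q.2 ord0)).
  by rewrite telescope_sumr// /dB gridt0.
by move=> k /andP[_ kk]; rewrite kk mul1r.
Qed.

Let phase_err n (s : seq freq) w :=
  \sum_(q <- s) q.1.1 * dB (gridt T n (grid_floor n q.1.2)) q.1.2 q.2 w.

(** Rounding a time down skips an increment of variance at most T / n. The constant grows along the
    list through [sqnmD_le], but not with [n]. *)
Let phase_err_sqnm s : all freq_ok s -> exists2 C, 0 <= C &
  forall n, (0 < n)%N -> sqint P (phase_err n s) /\ sqnm P (phase_err n s) <= C / n%:R.
Proof.
elim: s => [_|q s IH /=/andP[qok /IH[C C0 hC]]].
  exists 0 => // n n0; have e : phase_err n [::] = fun=> 0.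
    by apply/funext => w; rewrite /phase_err big_nil.
  by rewrite e sqnm_cst expr0n mul0r; split => //; exact: sqint0.
exists (2 * (q.1.1 ^+ 2 * T) + 2 * C).
  by rewrite addr_ge0// mulr_ge0// mulr_ge0 ?sqr_ge0// ltW.
move=> n n0; have [se le_e] := hC n n0.
have e : phase_err n (q :: s) = fun w =>
    q.1.1 * dB (gridt T n (grid_floor n q.1.2)) q.1.2 q.2 w + phase_err n s w.
  by apply/funext => w; rewrite /phase_err big_cons.
have [kn kr rk] := grid_floorP n0 qok.
have /andP[r0 rT] := qok.
have t0 := gridt_ge0 H n (grid_floor n q.1.2).
have sq := sqint_dB H q.2 t0 kr rT.
have nq : sqnm P (dB (gridt T n (grid_floor n q.1.2)) q.1.2 q.2) <= T / n%:R.
  apply: le_trans rk; move: kr; rewrite le_eqVlt => /orP[/eqP->|kr].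
    by rewrite subrr dBxx sqnm_cst expr0n.
  rewrite -(dB_variance H t0 kr rT q.2) le_eqVlt; apply/orP; left; apply/eqP.
  by apply: eq_Rintegral => w _; rewrite expr2.
rewrite e; split; first by apply: sqintD => //; exact: sqintZ.
apply: (le_trans (sqnmD_le (sqintZ _ sq) se)).
rewrite sqnmZ// [leRHS]mulrDl -!mulrA; apply: lerD; rewrite ler_wpM2l//.
by rewrite ![q.1.1 * (q.1.1 * _)]mulrA -expr2 ler_wpM2l ?sqr_ge0.
Qed.

Let Y w := (\1_A w : R) * cos (phase theta js w).

Let indA_le1 w : `|\1_A w : R| <= 1.
Proof. by rewrite indicE; case: (_ \in _); rewrite /= ?normr0 ?normr1. Qed.

Let mA : measurable_fun setT (\1_A : Omega -> R).
Proof. by apply: measurable_indic; exact: (noise_meas H). Qed.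

Let mcos (f : Omega -> R) : measurable_fun setT f ->
  measurable_fun setT (fun w => cos (f w)).
Proof.
by move=> mf; apply: measurableT_comp => //; apply: continuous_measurable_fun;
  exact: continuous_cos.
Qed.

Let phase_meas (r : freq -> R) (s : seq freq) : (forall q, q \in s -> 0 <= r q <= T) ->
  measurable_fun setT (fun w => \sum_(q <- s) q.1.1 * dB 0 (r q) q.2 w).
Proof.
elim: s => [_|q s IH rs].
  rewrite (_ : (fun _ => _) = fun=> 0); first exact: measurable_cst.
  by apply/funext => w; rewrite big_nil.
rewrite (_ : (fun _ => _) = fun w => q.1.1 * dB 0 (r q) q.2 w +
    \sum_(q <- s) q.1.1 * dB 0 (r q) q.2 w); last first.
  by apply/funext => w; rewrite big_cons.
apply: measurable_funD; last first.
  by apply: IH => q' q's; apply: rs; rewrite inE q's orbT.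
apply: measurable_funM => //.
have /andP[r0 rT] := rs q (mem_head _ _).
by case: (sqint_dB H q.2 (lexx 0) r0 rT).
Qed.

Lemma cosine_approximable : approx P T B A0 Y.
Proof.
have bndY (f : Omega -> R) w : `|\1_A w * cos (f w)| <= 1.
  by rewrite normrM -[leRHS]mulr1; apply: ler_pM => //; exact: cos_max.
have sqY f : measurable_fun setT f -> sqint P (fun w => \1_A w * cos (f w)).
  move=> mf; apply: (@bnd_sqint _ _ _ _ _ 1) => //.
  by apply: measurable_funM => //; exact: mcos.
have mphase : measurable_fun setT (phase theta js).
  by apply: measurable_funD => //; apply: phase_meas => q /(allP okjs).
split; first exact: sqY.
have [C C0 hC] := phase_err_sqnm okjs.
pose K := grid_cosine_cst T d L.
(* Ensures (2 C + 2 K) / n <= e for n >= n0, where [C] pays for rounding the times and [K] for the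
   grid approximation. *)
move=> e e0; pose n0 := (Num.trunc (`|2 * C + 2 * K| / e)).+1.
exists n0 => n n_gt0 n0n.
have nR : (0 : R) < n%:R by rewrite ltr0n.
have [N0 [c [mN0 bN0 ac le_c]]] := grid_cosine_approx H theta AA (lamL n) n_gt0.
exists N0, c; split => //.
have mgp : measurable_fun setT (grid_phase T B theta (lam n) n n).
  rewrite (_ : grid_phase T B theta (lam n) n n = fun w => theta +
      \sum_(q <- js) q.1.1 * dB 0 (gridt T n (grid_floor n q.1.2)) q.2 w); last first.
    by apply/funext => w; exact: lam_phase.
  apply: measurable_funD => //.
  apply: (@phase_meas (fun q => gridt T n (grid_floor n q.1.2))) => q /(allP okjs) qok.
  have [kn _ _] := grid_floorP n_gt0 qok.
  by rewrite (gridt_ge0 H) (gridt_leT H).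
have sX := sqY _ mgp.
have sN : sqint P (fun w => N0 w + grid_sum T B n c w).
  by apply: sqintD; [exact: (A0_sqint H)|exact: (grid_sum_sqint H)].
apply: (le_trans (sqnm_triangle3 (sqY _ mphase) sX sN)).
have [se le_err] := hC n n_gt0.
have le1 : sqnm P (fun w => \1_A w * cos (phase theta js w) -
    \1_A w * cos (grid_phase T B theta (lam n) n n w)) <= C / n%:R.
  apply: le_trans le_err; apply: sqnm_le => //; first by apply: sqintB => //;
    exact: sqY.
  move=> w; rewrite -mulrBr normrM; apply: (@le_trans _ _ (1 * `|phase_err n js w|)).
    apply: ler_pM => //; apply: (le_trans (norm_cosB_le _ _)).
    rewrite lam_phase// /phase /phase_err opprD addrACA subrr add0r -sumrB.
    rewrite le_eqVlt; apply/orP; left; apply/eqP; congr `|_|.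
    by apply: eq_bigr => q _; rewrite -mulrBr /dB; congr (_ * _); ring.
  by rewrite mul1r.
apply: (@le_trans _ _ ((2 * C + 2 * K) / n%:R)).
  by rewrite [leRHS]mulrDl -!mulrA; apply: lerD; rewrite ler_wpM2l.
rewrite ler_pdivrMr// (le_trans (ler_norm _))// -ler_pdivrMl// mulrC.
apply: ltW; apply: (lt_le_trans (truncnS_gt _)).
by rewrite ler_nat.
Qed.

End frequencies.
End cosine_approximable.

(** * Density in L2 *)

Section sign_iteration.
Context {R : realType}.
Implicit Types x y : R.

(* The Newton-Schulz iteration: its iterates are polynomials in x and converge
   to the sign of x on [-1, 1]. *)
Definition sgn_step x : R := (3 / 2) * x - 2^-1 * (x * x * x).

Definition sgn_iter k x : R := iter k sgn_step x.

(** With f the step, f x - x = x (1 - x) (1 + x) / 2 and 1 - f x = (1 - x)^2 (2 + x) / 2. *)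
Let sgn_step_itv x : 0 <= x <= 1 -> x <= sgn_step x <= 1.
Proof.
move=> /andP[x0 x1]; rewrite /sgn_step.
have h1 : 0 <= x * ((1 - x) * (1 + x)) by rewrite !mulr_ge0//; lra.
have h2 : 0 <= (1 - x) ^+ 2 * (2 + x) by rewrite mulr_ge0 ?sqr_ge0//; lra.
by apply/andP; split; nra.
Qed.

(** 1 minus the step is (1 - x) (1 - (x + x^2) / 2), and x + x^2 >= c; hence geometric convergence
    to 1 from any positive starting point. *)
Let sgn_step_contract c x : 0 < c -> c <= x <= 1 ->
  1 - sgn_step x <= (1 - c / 2) * (1 - x).
Proof.
move=> c0 /andP[cx x1]; rewrite /sgn_step.
have h : 0 <= (1 - x) * ((x - c) + x ^+ 2) by apply: mulr_ge0;
  [lra|apply: addr_ge0; [lra|exact: sqr_ge0]].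
by rewrite -subr_ge0; apply: le_trans (_ : 0 <= 2^-1 * ((1 - x) * ((x - c) + x
  ^+ 2))) _;
  [rewrite mulr_ge0|rewrite le_eqVlt; apply/orP; left; apply/eqP; field].
Qed.

Let sgn_iter_itv c k : 0 < c <= 1 -> c <= sgn_iter k c <= 1 /\
  1 - sgn_iter k c <= (1 - c / 2) ^+ k.
Proof.
move=> /andP[c0 c1]; elim: k => [|k [/andP[h1 h2] h3]].
  by rewrite /sgn_iter/= expr0 lexx c1; split => //; lra.
have /sgn_step_itv/andP[s1 s2] : 0 <= sgn_iter k c <= 1 by rewrite h2 andbT; lra.
rewrite /sgn_iter iterS -/(sgn_iter k c); split.
  by rewrite s2 andbT (le_trans h1).
rewrite exprS; apply: (le_trans (sgn_step_contract c0 _)); first by rewrite h1.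
by rewrite ler_wpM2l//; lra.
Qed.

Lemma sgn_iterN k x : sgn_iter k (- x) = - sgn_iter k x.
Proof.
elim: k => // k IH; rewrite /sgn_iter !iterS -!/(sgn_iter _ _) IH /sgn_step.
by ring.
Qed.

Lemma sgn_iter0 k : sgn_iter k 0 = 0.
Proof.
elim: k => // k IH; rewrite /sgn_iter !iterS -!/(sgn_iter _ _) IH /sgn_step.
by ring.
Qed.

Let sgn_iter_cvg1 x : 0 < x <= 1 -> sgn_iter k x @[k --> \oo] --> (1 : R).
Proof.
move=> x01; have /andP[x0 x1] := x01.
apply: (@squeeze_cvgr _ _ _ _ (fun k => 1 - (1 - x / 2) ^+ k) (fun=> 1)).
- apply: nearW => k; have [/andP[_ ->] h] := sgn_iter_itv k x01.
  by rewrite andbT; lra.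
- rewrite -[X in _ --> X]subr0; apply: cvgB; first exact: cvg_cst.
  by apply: cvg_expr; rewrite ger0_norm; lra.
- exact: cvg_cst.
Qed.

Lemma sgn_iter_cvg x : `|x| <= 1 -> sgn_iter k x @[k --> \oo] --> Num.sg x.
Proof.
move=> x1; have [x0|x0|->] := ltgtP x 0.
- rewrite ltr0_sg// -[x]opprK.
  rewrite (_ : (fun _ => _) = fun k => - sgn_iter k (- x)); last first.
    by apply/funext => k; exact: sgn_iterN.
  apply: cvgN; apply: sgn_iter_cvg1; rewrite oppr_gt0 x0/=.
  by rewrite -(ltr0_norm x0).
- by rewrite gtr0_sg//; apply: sgn_iter_cvg1; rewrite x0 -(gtr0_norm x0).
- rewrite sgr0 (_ : (fun _ => _) = fun=> 0); first exact: cvg_cst.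
  by apply/funext => k; exact: sgn_iter0.
Qed.

Lemma sgn_iter_le1 k x : `|x| <= 1 -> `|sgn_iter k x| <= 1.
Proof.
move=> x1; have pos y : 0 < y <= 1 -> `|sgn_iter k y| <= 1.
  move=> y01; have /andP[y0 _] := y01; have [/andP[h1 h2] _] := sgn_iter_itv k y01.
  by rewrite ger0_norm// (le_trans (ltW y0)).
have [x0|x0|->] := ltgtP x 0.
- rewrite -[x]opprK sgn_iterN normrN pos// oppr_gt0 x0/=.
  by rewrite -(ltr0_norm x0).
- by apply: pos; rewrite x0 -(gtr0_norm x0).
- by rewrite sgn_iter0 normr0.
Qed.

End sign_iteration.

(** * The algebra generated by cosines and bounded limits *)

Section density.
Context (d0 : measure_display) (Omega : measurableType d0) (R : realType)
  (P : probability Omega R) (T : R) (d : nat) (B : R -> Omega -> 'cV[R]_d)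
  (A0 : set (set Omega)).
Hypothesis H : noise P T B A0.
Local Notation dB := (dB B).
Local Notation freq := (freq R d).

Let T0 : 0 < T := noise_gt0 H.

(* Being inductive, the class is closed under products as well, although the
   set of approximable variables is not obviously so. *)
Inductive trig_closure : (Omega -> R) -> Prop :=
| TrigBase (A : set Omega) (theta : R) (js : seq freq) :
    <<s A0 >> A -> all (@freq_ok R T d) js ->
    trig_closure (fun w => \1_A w * cos (phase B theta js w))
| TrigNull (f : Omega -> R) : measurable_fun setT f -> bnd f ->
    {ae P, forall w, f w = 0} -> trig_closure f
| TrigAdd f g : trig_closure f -> trig_closure g ->
    trig_closure (fun w => f w + g w)
| TrigScale c f : trig_closure f -> trig_closure (fun w => c * f w)
| TrigLim (f_ : nat -> Omega -> R) f M : (forall n, trig_closure (f_ n)) ->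
    (forall n w, `|f_ n w| <= M) -> (forall w, f_ n w @[n --> \oo] --> f w) ->
    trig_closure f.

Lemma trig_closure_approx f : trig_closure f -> approx P T B A0 f.
Proof.
elim=> {f} [A theta js AA okjs|f mf _ f0|f g _ af _ ag|c f _ af|f_ f M _ af fM ff].
- exact: (cosine_approximable H).
- exact: approx_null.
- exact: (approxD H).
- exact: (approxZ H).
- apply: (approx_dominated H af (g := cst M)) => //.
  by apply: (@bnd_sqint _ _ _ _ _ `|M|).
Qed.

Lemma trig_closure_measurable f : trig_closure f -> measurable_fun setT f.
Proof. by move=> /trig_closure_approx[[]]. Qed.

Lemma trig_closure_bnd f : trig_closure f -> bnd f.
Proof.
elim=> {f} [A theta js AA okjs|f mf bf _|f g _ bf _ bg|c f _ bf|f_ f M _ _ fM ff].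
- exists 1 => w; rewrite normrM -[leRHS]mulr1; apply: ler_pM => //; last exact: cos_max.
  by rewrite indicE; case: (_ \in _); rewrite /= ?normr0 ?normr1.
- by [].
- exact: bndD.
- by apply: bndM => //; exact: bnd_cst.
- exists M => w; have -> : `|f w| = limn (fun n => `|f_ n w|).
    by apply/esym/cvg_lim => //; exact: cvg_norm (ff w).
  apply: limr_le; first by apply/cvg_ex; exists `|f w|; exact: cvg_norm (ff w).
  exact: nearW.
Qed.

Lemma trig_closure_eq (f g : Omega -> R) : f =1 g -> trig_closure f -> trig_closure g.
Proof. by move=> e; rewrite (funext e). Qed.

(** Induction on both factors. Sums and multiples distribute, limits pass because members of the
    class are bounded, and null functions absorb the other factor; what remains is a product of two
    base elements. *)
Lemma trig_closureM f g : trig_closure f -> trig_closure g ->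
  trig_closure (fun w => f w * g w).
Proof.
have limM (h : Omega -> R) (f_ : nat -> Omega -> R) f' M : trig_closure h ->
    (forall n w, `|f_ n w| <= M) -> (forall w, f_ n w @[n --> \oo] --> f' w) ->
    (forall n, trig_closure (fun w => h w * f_ n w)) ->
    trig_closure (fun w => h w * f' w).
  move=> /trig_closure_bnd[K hK] fM ff th.
  apply: (TrigLim (M := K * M) th) => [n w|w].
    by rewrite normrM; apply: ler_pM.
  by apply: cvgM; [exact: cvg_cst|exact: ff].
have nullM (h u : Omega -> R) : measurable_fun setT h -> bnd h ->
  {ae P, forall w, h w = 0} ->
    trig_closure u -> trig_closure (fun w => h w * u w).
  move=> mh bh h0 tu; apply: TrigNull.
  - by apply: measurable_funM => //; exact: trig_closure_measurable.
  - by apply: bndM => //; exact: trig_closure_bnd.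
  - by apply: filterS h0 => w ->; rewrite mul0r.
have baseM A theta js u : <<s A0 >> A -> all (@freq_ok R T d) js -> trig_closure u ->
    trig_closure (fun w => (\1_A w * cos (phase B theta js w)) * u w).
  move=> AA okjs; elim=> {u} [A' theta' js' AA' okjs'|u mu bu u0|u v _ tu _
    tv|c u _ tu|f_ u M tf tfM fM ff].
  (* The product of two cosines is half the sum of the cosines of the sum and of the difference of
     the phases; the difference needs the frequencies of the second phase negated. *)
  - pose neg (q : freq) : freq := (- q.1.1, q.1.2, q.2).
    have okneg : all (@freq_ok R T d) (map neg js').
      by rewrite all_map; apply/allP => q /(allP okjs').
    have AAA : <<s A0 >> (A `&` A') by exact: gsaI.
    have okD : all (@freq_ok R T d) (js ++ js') by rewrite all_cat okjs.
    have okB : all (@freq_ok R T d) (js ++ map neg js') by rewrite all_cat okjs.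
    apply: trig_closure_eq (TrigAdd (TrigScale 2^-1 (TrigBase (theta + theta') AAA okD))
      (TrigScale 2^-1 (TrigBase (theta - theta') AAA okB))) => w.
    have -> : phase B (theta + theta') (js ++ js') w =
        phase B theta js w + phase B theta' js' w.
      by rewrite /phase big_cat/=; ring.
    have -> : phase B (theta - theta') (js ++ map neg js') w =
        phase B theta js w - phase B theta' js' w.
      rewrite /phase big_cat/= big_map/=.
      have -> : \sum_(j <- js') - j.1.1 * dB 0 j.1.2 j.2 w =
          - \sum_(j <- js') j.1.1 * dB 0 j.1.2 j.2 w.
        by rewrite -sumrN; apply: eq_bigr => q _; rewrite mulNr.
      by ring.
    by rewrite cosD cosB indicI /=; field.
  - apply: trig_closure_eq (nullM u _ mu bu u0 (TrigBase theta AA okjs)) => w; ring.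
  - by apply: trig_closure_eq (TrigAdd tu tv) => w; ring.
  - by apply: trig_closure_eq (TrigScale c tu) => w; ring.
  - exact: limM (TrigBase theta AA okjs) fM ff tfM.
move=> tf tg; elim: tf =>
  {f} [A theta js AA okjs|f mf bf f0|f h _ tf _ th|c f _ tf|f_ f M _ tfM fM ff].
- exact: baseM.
- exact: nullM.
- by apply: trig_closure_eq (TrigAdd tf th) => w; ring.
- by apply: trig_closure_eq (TrigScale c tf) => w; ring.
- have tgf n : trig_closure (fun w => g w * f_ n w).
    by apply: trig_closure_eq (tfM n) => w; rewrite mulrC.
  by apply: trig_closure_eq (limM g f_ f M tg fM ff tgf) => w; rewrite mulrC.
Qed.

Lemma trig_closure_cst c : trig_closure (fun=> c).
Proof.
have := TrigScale c (TrigBase 0 (@gsaT _ _ A0) (isT : all (@freq_ok R T d) [::])).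
apply: trig_closure_eq => w.
by rewrite indicT /phase big_nil addr0 cos0 !mulr1.
Qed.

Lemma trig_closure_sum (I : Type) (r : seq I) (F : I -> Omega -> R) :
  (forall i, trig_closure (F i)) -> trig_closure (fun w => \sum_(i <- r) F i w).
Proof.
move=> tF; elim: r => [|i r IH].
  by apply: trig_closure_eq (trig_closure_cst 0) => w; rewrite big_nil.
by apply: trig_closure_eq (TrigAdd (tF i) IH) => w; rewrite big_cons.
Qed.

Lemma trig_closure_sgn f : trig_closure f -> (forall w, `|f w| <= 1) ->
  trig_closure (fun w => Num.sg (f w)).
Proof.
move=> tf f1; apply: (@TrigLim (fun k w => sgn_iter k (f w)) _ 1).
- elim=> [|k IH]; first exact: tf.
  apply: trig_closure_eq (TrigAdd (TrigScale (3 / 2) IH) (TrigScale (- 2^-1)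
    (trig_closureM (trig_closureM IH IH) IH))) => w.
  by rewrite /sgn_iter iterS -/(sgn_iter k (f w)) /sgn_step; ring.
- by move=> k w; exact: sgn_iter_le1.
- by move=> w; exact: sgn_iter_cvg.
Qed.

(* the indicator of {x > a}, as a limit of a polynomial in the sign of
   sin ((x - a) / (n + 1)) *)
Lemma trig_closure_dB_gt r l a : 0 <= r <= T ->
  trig_closure (\1_[set w | a < dB 0 r l w]).
Proof.
move=> rT; pose S n w := Num.sg (sin (n.+1%:R^-1 * (dB 0 r l w - a))) : R.
have tS n : trig_closure (S n).
  apply: trig_closure_sgn; last by move=> w; exact: sin_max.
  have ok : all (@freq_ok R T d) [:: (n.+1%:R^-1, r, l)] by rewrite /= andbT.
  (* sin x = cos (x - pi / 2), so the shift goes into the free phase. *)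
  apply: trig_closure_eq (TrigBase (- n.+1%:R^-1 * a - pi / 2) (@gsaT _ _ A0) ok) => w.
  rewrite indicT mul1r /phase big_seq1/= -[RHS]cosBpihalf; congr cos; ring.
(* (y + y^2) / 2 sends the signs 1, 0, -1 to 1, 0, 0, which yields the strict inequality. *)
apply: (@TrigLim (fun n w => 2^-1 * (S n w + S n w * S n w)) _ 1).
- by move=> n; apply: TrigScale; apply: TrigAdd => //; exact: trig_closureM.
- move=> n w; rewrite /S; case: sgrP => _; rewrite ?mulr0 ?addr0 ?mulr0 ?normr0//.
    by rewrite mulr1 ger0_norm//; lra.
  by rewrite mulrNN mulr1 addNr mulr0 normr0.
move=> w; apply: cvg_near_cst; set x := dB 0 r l w - a.
near=> n.
have n0 : (0 : R) < n.+1%:R by [].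
(* For large [n] the argument of the sine lies in ]-pi, pi[, where the sine has the sign of its
   argument; the approximants are then already equal to the limit. *)
have xn : `|x| < pi * n.+1%:R.
  rewrite mulrC -ltr_pdivrMr ?pi_gt0//; apply: (@lt_trans _ _ n%:R);
    last by rewrite ltr_nat.
  near: n; exact: nbhs_infty_gtr.
have xpi : `|n.+1%:R^-1 * x| < pi.
  by rewrite normrM ger0_norm ?invr_ge0// mulrC ltr_pdivrMr.
rewrite /S -/x indicE; have [ax|xa] := ltP a (dB 0 r l w).
  rewrite mem_set//= gtr0_sg ?mulr1; first by field.
  apply: sin_gt0_pi; rewrite mulr_gt0 ?invr_gt0 ?subr_gt0//=.
  by rewrite (le_lt_trans (ler_norm _)).
rewrite memNset/=; last by apply/negP; rewrite -leNgt.
have [x0|x0] := eqVneq x 0; first by rewrite x0 mulr0 sin0 sgr0 mulr0 addr0 mulr0.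
have xlt : x < 0 by rewrite lt_neqAle x0 subr_le0.
rewrite ltr0_sg; first by rewrite mulrNN mulr1 addNr mulr0.
rewrite -[_ * x]opprK sinN oppr_lt0; apply: sin_gt0_pi.
rewrite -mulrN mulr_gt0 ?invr_gt0 ?oppr_gt0//=.
by rewrite mulrN (le_lt_trans _ xpi)// -normrN ler_norm.
Unshelve. all: by end_near. Qed.

Definition trig_sets : set (set Omega) := [set D | trig_closure (\1_D)].

Lemma trig_setsC D : trig_sets D -> trig_sets (~` D).
Proof.
move=> tD; rewrite /trig_sets/=.
apply: trig_closure_eq (TrigAdd (trig_closure_cst 1) (TrigScale (-1) tD)) => w.
by rewrite !indicE in_setC; case: (w \in D) => /=; rewrite ?mulr1 ?mulr0 ?subrr ?addr0.
Qed.

Lemma sigma_algebra_trig_sets : sigma_algebra setT trig_sets.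
Proof.
split.
- by apply: trig_closure_eq (trig_closure_cst 0) => w; rewrite indic0.
- by move=> D tD; rewrite setTD; exact: trig_setsC.
move=> F tF; rewrite -[\bigcup_n F n]setCK; apply: trig_setsC.
rewrite /trig_sets/=.
(* The complement of the union is an intersection, whose indicator is the bounded limit of finite
   products; stability under products is used here. *)
pose Q n w : R := \prod_(i < n) \1_(~` F i) w.
apply: (@TrigLim Q _ 1).
- elim=> [|n IH].
    by apply: trig_closure_eq (trig_closure_cst 1) => w; rewrite /Q big_ord0.
  apply: trig_closure_eq (trig_closureM IH (trig_setsC (tF n))) => w.
  by rewrite /Q big_ord_recr.
- move=> n w; rewrite /Q normr_prod; apply: prodr_ile1 => i _.
  by rewrite normr_ge0 indicE; case: (_ \in _); rewrite /= ?normr0 ?normr1.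
move=> w; apply: cvg_near_cst; rewrite indicE.
have [[k _ Fkw]|nF] := pselect ((\bigcup_n F n) w).
  exists k.+1 => // n /= kn; rewrite memNset/=; last by apply: contrapT;
    apply/not_notP => h; apply: h; exists k.
  by rewrite /Q (bigD1 (Ordinal kn))//= indicE memNset ?mul0r//= => /(_ Fkw).
apply: nearW => n; rewrite mem_set// /Q big1// => i _.
by rewrite indicE mem_set// => Fiw; apply: nF; exists i.
Qed.

(** The two indicators differ by a bounded null function, a member of the class by [TrigNull]. *)
Lemma trig_sets_ae D D' : measurable D -> measurable D' ->
  {ae P, forall w, D w <-> D' w} -> trig_sets D -> trig_sets D'.
Proof.
move=> mD mD' DD' tD; rewrite /trig_sets/=.
have tN : trig_closure (fun w => \1_D' w - \1_D w).
  apply: TrigNull.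
  - by apply: measurable_funB; exact: measurable_indic.
  - exists 2 => w; rewrite !indicE; do 2 case: (_ \in _) => /=;
      rewrite ?subrr ?subr0 ?sub0r ?normrN ?normr0 ?normr1//; lra.
  - apply: filterS DD' => w [h1 h2]; apply/eqP; rewrite subr_eq0; apply/eqP.
    by rewrite !indicE; congr (_%:R); congr nat_of_bool; apply/idP/idP; rewrite !inE.
by apply: trig_closure_eq (TrigAdd tN tD) => w; rewrite subrK.
Qed.

Lemma trig_sets_null D : measurable D -> P D = 0%E -> trig_sets D.
Proof.
move=> mD D0; apply: (@trig_sets_ae set0) => //; last by case: sigma_algebra_trig_sets.
exists D; split => // w /= h; apply: contrapT => nDw; apply: h; split => //.
Qed.

Lemma trig_sets_A0 : <<s A0 >> `<=` trig_sets.
Proof.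
move=> A AA; rewrite /trig_sets/=.
apply: trig_closure_eq (TrigBase 0 AA (isT : all (@freq_ok R T d) [::])) => w.
by rewrite /phase big_nil addr0 cos0 mulr1.
Qed.

Lemma trig_sets_B r l (U : set R) : 0 <= r <= T -> measurable U ->
  trig_sets ((fun w => B r w l ord0) @^-1` U).
Proof.
move=> rT; have /andP[r0 rleT] := rT.
have mB s : 0 <= s <= T -> measurable_fun setT (fun w => B s w l ord0).
  move=> sT; have /mx_measurable_measurableP := bm_measurable (noise_bm H) sT; exact.
have mT : (0 : R) <= 0 <= T by rewrite lexx ltW.
move=> mU.
(* Open upper rays generate the Borel sets, so only their preimages remain to be checked. *)
have {mU} : (@RGenOInfty.G R).-sigma.-measurable U.
  by rewrite -RGenOInfty.measurableE.
move: U.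
apply: smallest_sub => [|_ [a ->]].
  split.
  - by rewrite /= preimage_set0; case: sigma_algebra_trig_sets.
  - by move=> U tU; rewrite /= setTD preimage_setC; exact: trig_setsC.
  - move=> F tF; rewrite /= preimage_bigcup.
    by case: sigma_algebra_trig_sets => _ _; apply.
(* Here the almost sure equality B_0 = 0 is used to pass from B_r - B_0 to B_r. *)
apply: (@trig_sets_ae [set w | a < dB 0 r l w]).
- rewrite (_ : [set w | _] = dB 0 r l @^-1` `]a, +oo[%classic); last first.
    by apply/seteqP; split => w /=; rewrite in_itv/= andbT.
  rewrite -[X in measurable X]setTI; apply: measurable_funB;
    [exact: mB|exact: mB| |] => //.
- by rewrite -[X in measurable X]setTI; apply: mB.
- apply: filterS (bm_start (noise_bm H)) => w B0.
  by rewrite /= in_itv/= andbT /dB B0 mxE subr0.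
- exact: trig_closure_dB_gt.
Qed.

Lemma trig_sets_GX : <<s GX P B A0 T >> `<=` trig_sets.
Proof.
apply: smallest_sub; first exact: sigma_algebra_trig_sets.
move=> D [[FD|AD]|[mD D0]]; [|exact: trig_sets_A0|exact: trig_sets_null].
move: D FD; apply: smallest_sub; first exact: sigma_algebra_trig_sets.
move=> D [r /= rT]; move: D; apply: smallest_sub; first exact: sigma_algebra_trig_sets.
move=> _ [[i j] _ [U mU <-]]; rewrite setTI ord1.
by apply: trig_sets_B => //; rewrite in_itv/= in rT.
Qed.

(** After an affine rescaling to [0, 1], f is a uniform limit of averages of indicators of its upper
    level sets, which belong to [trig_sets]. *)
Lemma bounded_approx (f : Omega -> R) M : gmeas (GX P B A0 T) f ->
  (forall w, `|f w| <= M) ->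
  trig_closure f.
Proof.
(* The added 1 makes [K] positive; f / K then lies in [-1, 1] and [g] in [0, 1]. *)
move=> mf fM; pose K := `|M| + 1.
have K0 : 0 < K by rewrite ltr_wpDl.
pose g w := (f w / K + 1) / 2.
have g01 w : 0 <= g w <= 1.
  have : `|f w / K| <= 1.
    rewrite normrM normfV (gtr0_norm K0) ler_pdivrMr// mul1r.
    by rewrite (le_trans (fM w))// (le_trans (ler_norm M))// lerDl.
  by rewrite ler_norml /g => /andP[h1 h2]; apply/andP; split; lra.
suff tg : trig_closure g.
  apply: trig_closure_eq (TrigScale (2 * K) (TrigAdd tg (trig_closure_cst (-
    2^-1)))) => w.
  by rewrite /g; field; rewrite gt_eqF.
have mg : gmeas (GX P B A0 T) g.
  by apply: measurable_funM => //; apply: measurable_funD => //; exact: measurable_funM.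
pose D n k := g @^-1` `[(k.+1%:R / n.+1%:R), +oo[%classic.
have tD n k : trig_closure (\1_(D n k)).
  apply: trig_sets_GX; apply: gmeas_preimage => //; exact: measurable_itv.
pose g_ n w : R := n.+1%:R^-1 * \sum_(k < n.+1) \1_(D n k) w.
(* The number of levels (k + 1) / (n + 1) not exceeding g w is the integer part of (n + 1) g w, so
   [g_ n] is g rounded down to a multiple of 1 / (n + 1). *)
have gE n w : g_ n w = n.+1%:R^-1 * (Num.trunc (g w * n.+1%:R))%:R.
  have /andP[g0 g1] := g01 w; congr (_ * _).
  set m := Num.trunc _.
  have mn : (m <= n.+1)%N.
    by rewrite -(ler_nat R) (le_trans (_ : _ <= g w * n.+1%:R))//;
      [rewrite truncn_le mulr_ge0|rewrite ler_piMl].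
  transitivity (\sum_(k < n.+1) ((k < m)%N%:R : R)).
    apply: eq_bigr => k _; rewrite indicE; congr (_%:R); congr nat_of_bool.
    rewrite truncn_gt_nat; apply/idP/idP; rewrite inE /D/= in_itv/= andbT;
      by rewrite ler_pdivrMr.
  rewrite -natr_sum; congr (_%:R).
  rewrite -(big_mkord xpredT (fun k => (k < m)%N : nat)) (big_cat_nat (n := m))//=.
  rewrite [X in (_ + X)%N]big1_seq ?addn0; last first.
    by move=> k /andP[_]; rewrite mem_index_iota => /andP[mk _]; rewrite ltnNge mk.
  rewrite (eq_big_nat _ _ (F2 := fun=> 1%N)) ?sum_nat_const_nat ?subn0 ?muln1//.
  by move=> k /andP[_ ->].
apply: (@TrigLim g_ _ 1).
- move=> n; apply: TrigScale; exact: trig_closure_sum.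
- move=> n w; rewrite gE; have /andP[g0 g1] := g01 w.
  rewrite ger0_norm ?mulr_ge0 ?invr_ge0// mulrC ler_pdivrMr// mul1r.
  by rewrite (le_trans (_ : _ <= g w * n.+1%:R))//;
    [rewrite truncn_le mulr_ge0|rewrite ler_piMl].
move=> w; have /andP[g0 g1] := g01 w.
apply: (@squeeze_cvgr _ _ _ _ (fun n => g w - n.+1%:R^-1) (fun=> g w)).
- apply: nearW => n; rewrite gE.
  have y0 : 0 <= g w * n.+1%:R by rewrite mulr_ge0.
  have n0 : (0 : R) < n.+1%:R by [].
  have /andP[h1 h2] := truncn_itv y0.
  rewrite mulrC ler_pdivrMr// h1 andbT ler_pdivlMr// mulrBl mulVf ?gt_eqF//.
  by rewrite lerBlDr natr1 ltW.
- rewrite -[X in _ --> X]subr0; apply: cvgB; first exact: cvg_cst.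
  exact: cvg_harmonic.
- exact: cvg_cst.
Qed.

(** The truncations of f to the event |f| <= n are bounded, dominated by |f|, and pointwise
    eventually equal to f. *)
Lemma L2_approx (f : Omega -> R) : gmeas (GX P B A0 T) f -> sqint P f ->
  approx P T B A0 f.
Proof.
move=> mf sf; have [msf _] := sf.
pose D n := f @^-1` `[- n%:R, n%:R]%classic.
have mD n : <<s GX P B A0 T >> (D n).
  by apply: gmeas_preimage => //; exact: measurable_itv.
apply: (approx_dominated H (Y_ := fun n w => f w * \1_(D n) w) (g := fun w => `|f w|)).
- move=> n; apply: trig_closure_approx; apply: (@bounded_approx _ n%:R).
    by apply: measurable_funM => //; exact: gmeas_indic.
  move=> w; rewrite indicE; case: (boolP (w \in D n)) => [|_];
    last by rewrite mulr0 normr0.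
  by rewrite inE /D /= in_itv/= mulr1 ler_norml.
- apply: sqint_le sf; last by move=> w; rewrite normr_id.
  exact: measurableT_comp.
- move=> n w; rewrite normrM ler_piMr// indicE; case: (_ \in _);
  rewrite /= ?normr0 ?normr1//.
move=> w; apply: cvg_near_cst; near=> n.
rewrite indicE mem_set ?mulr1// /D/= in_itv/= -ler_norml ltW//.
near: n; exact: nbhs_infty_gtr.
Unshelve. all: by end_near. Qed.

End density.

(** * Limits of simple integrals *)

Section riesz_fischer.
Context d (T : measurableType d) (R : realType).
Variable mu : {measure set T -> \bar R}.
Variable f_ : nat -> T -> R.
Hypothesis sf : forall k, sqint mu (f_ k).
Hypothesis fast : forall k m, (k <= m)%N ->
  sqnm mu (fun x => f_ k x - f_ m x) <= 4^-1 ^+ k.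

(* An upper limit rather than an abstract L^2 limit, so that measurability is
   inherited for every sigma-algebra, hence adaptedness. *)
Definition seq_lim (S : Type) (u : nat -> S -> R) (x : S) : R :=
  fine (limn_esup (fun k => (u k x)%:E)).

Lemma seq_lim_cvg (S : Type) (u : nat -> S -> R) x l :
  u k x @[k --> \oo] --> l -> seq_lim u x = l.
Proof.
move=> ul; have c : (u k x)%:E @[k --> \oo] --> l%:E.
  by apply/cvg_EFin => //; exact: nearW.
rewrite /seq_lim is_cvg_limn_esupE; last by apply/cvg_ex; exists l%:E.
by rewrite (cvg_lim _ c).
Qed.

Lemma measurable_seq_lim d' (S : measurableType d') (u : nat -> S -> R) :
  (forall k, measurable_fun setT (u k)) -> measurable_fun setT (seq_lim u).
Proof.
move=> mu'; apply: (measurableT_comp (f := fine)) => //.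
by apply: measurable_fun_limn_esup => k; exact/measurable_EFinP.
Qed.

Let half_sum n : \sum_(0 <= k < n) 2^-1 ^+ k <= 2 :> R.
Proof.
have -> : \sum_(0 <= k < n) 2^-1 ^+ k = 2 - 2 * 2^-1 ^+ n :> R.
  elim: n => [|n IH]; first by rewrite big_geq// expr0 mulr1 subrr.
  by rewrite big_nat_recr//= IH exprS; field.
by rewrite gerBl mulr_ge0// exprn_ge0.
Qed.

Let a k x := f_ k.+1 x - f_ k x.

(** The measure may be infinite, so L^2 bounds on the increments [a k] do not give L^1 bounds. The
    weights 2^k help: the integral of g k is at most 2^k 4^-k = 2^-k, while |a k| <= 2^-k + g k
    pointwise, so finiteness of the sum of the g k makes the increments summable. *)
Let g k x : \bar R := (2 ^+ k * a k x ^+ 2)%:E.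

Let g0 k x : (0 <= g k x)%E.
Proof. by rewrite lee_fin; apply: mulr_ge0; [exact: exprn_ge0|exact: sqr_ge0]. Qed.

Let sa k : sqint mu (a k). Proof. exact: sqintB. Qed.

Let mg k : measurable_fun setT (g k).
Proof.
apply/measurable_EFinP/measurable_funM => //; apply: measurable_funX.
by case: (sa k).
Qed.

Let integral_g : (\int[mu]_x (\sum_(k <oo) g k x) < +oo)%E.
Proof.
rewrite integral_nneseries//.
apply: (@le_lt_trans _ _ (\sum_(k <oo) (2 / (2 ^ (k + 1))%:R)%:E)%E); last first.
  by have /cvg_lim -> // := @cvg_geometric_eseries_half R 2 0; exact: ltry.
apply: lee_nneseries => [k _ _|k _]; first exact: integral_ge0.
have -> : (\int[mu]_x g k x = (2 ^+ k * sqnm mu (a k))%:E)%E.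
  have [_ ia] := sa k.
  by rewrite -RintegralZl// -EFin_Rintegral//; exact: intgZ.
rewrite lee_fin.
have h : sqnm mu (a k) <= 4^-1 ^+ k.
  by rewrite /a sqnmBC; exact: fast.
apply: (@le_trans _ _ (2 ^+ k * 4^-1 ^+ k)).
  by rewrite ler_wpM2l// exprn_ge0.
rewrite -exprMn natrX exprD expr1 invfM mulrA mulrAC divff// mul1r -exprVn.
by rewrite le_eqVlt; apply/orP; left; apply/eqP; congr (_ ^+ _); field.
Qed.

Let cvg_ae : {ae mu, forall x, f_ k x @[k --> \oo] --> seq_lim f_ x}.
Proof.
have mG : measurable_fun setT (fun x => \sum_(k <oo) g k x)%E.
  by apply: ge0_emeasurable_sum => //.
have iG : mu.-integrable setT (fun x => \sum_(k <oo) g k x)%E.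
  apply/integrableP; split => //.
  rewrite (eq_integral (fun x => \sum_(k <oo) g k x)%E) => [|x _]//.
  by rewrite gee0_abs// nneseries_ge0.
have := integrable_ae measurableT iG; apply: filterS => x /(_ I) Gfin.
suff : cvgn (f_ ^~ x).
  by move=> /cvg_ex[l fl]; rewrite (seq_lim_cvg fl).
have -> : f_ ^~ x = (fun n => f_ 0%N x + series (telescope (f_ ^~ x)) n).
  by apply/funext => n; exact: eq_sum_telescope.
apply: is_cvgD; first exact: is_cvg_cst.
apply: normed_cvg; apply: nondecreasing_is_cvgn.
  by apply: nondecreasing_series => k _ _; exact: normr_ge0.
exists (2 + fine (\sum_(k <oo) g k x)%E) => _ [n _ <-].
rewrite [X in X <= _](_ : _ = \sum_(0 <= k < n) `|telescope (f_ ^~ x) k|) //.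
(* With y = 2^k |a k x| this is y <= 1 + y^2, multiplied by 2^-k. *)
apply: (@le_trans _ _ (\sum_(0 <= k < n) (2^-1 ^+ k + 2 ^+ k * a k x ^+ 2))).
  apply: ler_sum => k _; rewrite /telescope -/(a k x).
  have p0 : 0 < 2 ^+ k :> R by rewrite exprn_gt0.
  rewrite exprVn; have -> : (2 ^+ k)^-1 + 2 ^+ k * a k x ^+ 2 =
     (2 ^+ k)^-1 * (1 + (2 ^+ k * `|a k x|) ^+ 2).
    rewrite mulrDr mulr1 exprMn -normrX (ger0_norm (sqr_ge0 _)).
    by rewrite mulrA expr2 !mulrA mulVf ?mul1r// gt_eqF.
  rewrite ler_pdivlMl//; set y := _ * `|_|.
  by have := sqr_ge0 (y - 1); have := sqr_ge0 y; nra.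
rewrite big_split/=; apply: lerD; first exact: half_sum.
rewrite -lee_fin fineK// -sumEFin.
by apply: nneseries_lim_ge => k _ _; exact: g0.
Qed.

(** Fatou's lemma in m for (f_k - f_(m + k))^2, whose integrals are all at most 4^-k. The limit is
    square-integrable as f_0 minus a square-integrable difference. *)
Lemma riesz_fischer : sqint mu (seq_lim f_) /\
  forall k, sqnm mu (fun x => f_ k x - seq_lim f_ x) <= 4^-1 ^+ k.
Proof.
have mf k : measurable_fun setT (f_ k) by case: (sf k).
have ml : measurable_fun setT (seq_lim f_) by exact: measurable_seq_lim.
have le_k k : (\int[mu]_x ((f_ k x - seq_lim f_ x) ^+ 2)%:E <= (4^-1 ^+ k)%:E)%E.
  pose u m x := ((f_ k x - f_ (m + k)%N x) ^+ 2)%:E.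
  have mu_ m : measurable_fun setT (u m).
    by apply/measurable_EFinP/measurable_funX/measurable_funB.
  have u0 m x : (0 <= u m x)%E by rewrite lee_fin sqr_ge0.
  have ucvg : {ae mu, forall x, limn_einf (u ^~ x) = ((f_ k x - seq_lim f_ x) ^+ 2)%:E}.
    apply: filterS cvg_ae => x fx.
    have uc : u m x @[m --> \oo] --> ((f_ k x - seq_lim f_ x) ^+ 2)%:E.
      apply/cvg_EFin; first exact: nearW.
      have c : f_ k x - f_ (m + k)%N x @[m --> \oo] --> f_ k x - seq_lim f_ x.
        apply: cvgB; first exact: cvg_cst.
        by rewrite (cvg_shiftn k (f_ ^~ x)).
      exact: (cvgM c c).
    by rewrite is_cvg_limn_einfE; [exact: cvg_lim uc|apply/cvg_ex; eexists; exact: uc].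
  have -> : (\int[mu]_x ((f_ k x - seq_lim f_ x) ^+ 2)%:E =
      \int[mu]_x limn_einf (u ^~ x))%E.
    apply: ae_eq_integral => //.
    - by apply/measurable_EFinP/measurable_funX/measurable_funB.
    - apply: (measurableT_comp (f := -%E)) => //.
      by apply: measurable_fun_limn_esup => m; exact: measurableT_comp.
    - by apply: filterS ucvg => x -> _.
  apply: (le_trans (fatou _ _ _ _)) => //.
  have um m : (\int[mu]_x u m x <= (4^-1 ^+ k)%:E)%E.
    rewrite sqint_sqnmE; last exact: sqintB.
    by rewrite lee_fin fast// leq_addl.
  rewrite limn_einf_lim; apply: lime_le; first exact: is_cvg_einfs.
  apply: nearW => n; apply: le_trans (um n).
  by apply: ereal_inf_lbound; exists n => /=.
have s0 : sqint mu (fun x => f_ 0%N x - seq_lim f_ x).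
  apply: sqint_ereal; first exact: measurable_funB.
  exact: le_lt_trans (le_k 0%N) (ltry _).
have sl : sqint mu (seq_lim f_).
  have := sqintB (sf 0%N) s0; congr (sqint mu _).
  by apply/funext => x; ring.
split => // k; rewrite -lee_fin -sqint_sqnmE//; exact: sqintB.
Qed.

End riesz_fischer.

Section square_norm.
Context d (T : measurableType d) (R : realType).
Variable mu : {measure set T -> \bar R}.
Variables (p q : nat) (X : T -> 'M[R]_(p, q)).

Lemma integral_sqnorm : (forall i j, sqint mu (fun w => X w i j)) ->
  (\int[mu]_w (sqnorm (X w))%:E)%E =
  (\sum_(i < p) \sum_(j < q) sqnm mu (fun w => X w i j))%:E.
Proof.
move=> sX.
have iX i j : intg mu (fun w => X w i j ^+ 2) by case: (sX i j).
have is_ i : intg mu (fun w => \sum_(j < q) X w i j ^+ 2) by exact: intg_sum.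
rewrite /sqnorm EFin_Rintegral; last exact: intg_sum.
rewrite Rintegral_bigsum//; congr EFin; apply: eq_bigr => i _.
by rewrite Rintegral_bigsum.
Qed.

Lemma sqnorm_entry_le i j : forall w, X w i j ^+ 2 <= sqnorm (X w).
Proof.
move=> w; rewrite /sqnorm (bigD1 i)//= (bigD1 j)//= -addrA lerDl.
apply: addr_ge0; first by apply: sumr_ge0 => l _; exact: sqr_ge0.
by apply: sumr_ge0 => r _; apply: sumr_ge0 => l _; exact: sqr_ge0.
Qed.

Lemma measurable_sqnorm : (forall i j, measurable_fun setT (fun w => X w i j)) ->
  measurable_fun setT (fun w => sqnorm (X w)).
Proof.
move=> mX; apply: measurable_sum => i; apply: measurable_sum => j.
exact: measurable_funX.
Qed.

Lemma sqnorm_lty_sqint : (forall i j, measurable_fun setT (fun w => X w i j)) ->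
  (\int[mu]_w (sqnorm (X w))%:E < +oo)%E -> forall i j, sqint mu (fun w => X w i j).
Proof.
move=> mX Xoo i j; apply: sqint_ereal => //; apply: le_lt_trans Xoo.
apply: ge0_le_integral => //.
- by move=> w _; rewrite lee_fin sqr_ge0.
- exact/measurable_EFinP/measurable_funX.
- exact/measurable_EFinP/measurable_sqnorm.
- by move=> w _; rewrite lee_fin sqnorm_entry_le.
Qed.

End square_norm.

(** * Processes on [0, T] as functions on the product space *)

Section time_cut.
Context (d0 : measure_display) (Omega : measurableType d0) (R : realType)
  (P : probability Omega R) (T : R).
Local Notation leb := (@lebesgue_measure R).
Local Notation nu := (P \x leb)%E.
Variables (p q : nat).
Implicit Types Z : R -> Omega -> 'M[R]_(p, q).

(** Extension by 0 outside [0, T]: processes become functions on the whole product space, and the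
    values at other times, which carry no meaning, disappear. *)
Definition cut Z (x : Omega * measurableTypeR R) : 'M[R]_(p, q) :=
  (\1_(`[0, T]%classic) x.2 : R) *: Z x.2 x.1.

Lemma cutE Z x i j : cut Z x i j = \1_(`[0, T]%classic) x.2 * Z x.2 x.1 i j.
Proof. by rewrite mxE. Qed.

Lemma measurable_cut Z :
  (forall i j, measurable_fun ([set: Omega] `*` `[0, T]%classic)
    (fun x : Omega * measurableTypeR R => Z x.2 x.1 i j)) ->
  forall i j, measurable_fun setT (fun x => cut Z x i j).
Proof.
move=> mZ i j.
have mD : measurable ([set: Omega] `*` (`[0, T]%classic : set (measurableTypeR R))).
  by apply: measurableX => //; exact: measurable_itv.
have /(measurable_restrictT _ mD) := mZ i j.
congr (measurable_fun _ _); apply/funext => -[w t].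
rewrite cutE patchE /= indicE in_setX in_setT /=.
by case: (t \in _); rewrite ?mul1r ?mul0r.
Qed.

Lemma M2_sqnormE Z : (forall i j, measurable_fun setT (fun x => cut Z x i j)) ->
  M2_sqnorm P T Z = (\int[nu]_x (sqnorm (cut Z x))%:E)%E.
Proof.
move=> mZ; rewrite /M2_sqnorm fubini_tonelli1//; last 2 first.
- exact/measurable_EFinP/measurable_sqnorm.
- move=> x; rewrite lee_fin; apply: sumr_ge0 => i _; apply: sumr_ge0 => j _.
  exact: sqr_ge0.
apply: eq_integral => w _; rewrite /fubini_F [LHS]integral_mkcond.
apply: eq_integral => t _; rewrite patchE /cut/= indicE.
case: (t \in _) => /=; first by rewrite scale1r.
have -> // : sqnorm (0 *: Z t w) = 0.
rewrite scale0r /sqnorm big1// => i _; rewrite big1// => j _.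
by rewrite mxE expr0n.
Qed.

End time_cut.

(** * Ito integrals: approximation, orthogonality, injectivity *)

Section ito_integral.
Context (d0 : measure_display) (Omega : measurableType d0) (R : realType)
  (P : probability Omega R) (T : R) (d : nat) (B : R -> Omega -> 'cV[R]_d)
  (A0 : set (set Omega)).
Hypothesis H : noise P T B A0.
Local Notation G := (fun t => <<s GX P B A0 t >>).
Local Notation leb := (@lebesgue_measure R).
Local Notation nu := (P \x leb)%E.
Variable p : nat.
Implicit Types (Z : R -> Omega -> 'M[R]_(p, d)) (I : Omega -> 'cV[R]_p).
Implicit Types (S : @simple_process d0 Omega R p d).

Lemma in_M2_sqint Z : in_M2 P T G Z ->
  forall i j, sqint nu (fun x => cut T Z x i j).
Proof.
move=> [mZ _ Zoo]; have mc := measurable_cut mZ.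
by apply: sqnorm_lty_sqint => //; rewrite -M2_sqnormE.
Qed.

(** All intervals of an adapted simple process lie in ]0, T], so in a difference [cut] changes only
    the other process. *)
Lemma sp_val_out S : sp_adapted T G S -> forall (x : Omega * measurableTypeR R) i j,
  \1_(`[0, T]%classic) x.2 * sp_val S x.2 x.1 i j = sp_val S x.2 x.1 i j.
Proof.
move=> adS x i j; rewrite indicE; have [_|xT] := boolP (x.2 \in _).
  by rewrite mul1r.
rewrite mul0r sp_valE big1// => e _.
have [s0 st tT _] := sp_term_adm adS i e.
rewrite /itvind indicE memNset ?mulr0//= in_itv/= => /andP[sx xt].
move: xT; rewrite notin_setE/= in_itv/=; apply.
by rewrite (le_trans s0 (ltW sx)) (le_trans xt).
Qed.

Lemma cut_spB S Z : sp_adapted T G S -> forall x i j,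
  cut T (fun t w => sp_val S t w - Z t w) x i j =
  sp_val S x.2 x.1 i j - cut T Z x i j.
Proof.
move=> adS x i j; rewrite !cutE [in LHS]mxE [X in _ * (_ + X)]mxE mulrBr.
by rewrite (sp_val_out adS).
Qed.

Let cut_spB_sqint S Z : sp_adapted T G S ->
  (forall i j, sqint nu (fun x => cut T Z x i j)) ->
  forall i j, sqint nu (fun x => cut T (fun t w => sp_val S t w - Z t w) x i j).
Proof.
move=> adS sZ i j; rewrite (_ : (fun _ => _) =
    fun x => sp_val S x.2 x.1 i j - cut T Z x i j); last first.
  by apply/funext => x; exact: cut_spB.
by apply: sqintB => //; exact: (sp_val_sqint H).
Qed.

Let M2_spB S Z : sp_adapted T G S ->
  (forall i j, sqint nu (fun x => cut T Z x i j)) ->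
  M2_sqnorm P T (fun t w => sp_val S t w - Z t w) =
  (\sum_(i < p) \sum_(j < d)
    sqnm nu (fun x => sp_val S x.2 x.1 i j - cut T Z x i j))%:E.
Proof.
move=> adS sZ; have sc := cut_spB_sqint adS sZ.
rewrite M2_sqnormE; last by move=> i j; case: (sc i j).
rewrite integral_sqnorm//; congr EFin; apply: eq_bigr => i _.
by apply: eq_bigr => j _; apply: eq_sqnm => x; exact: cut_spB.
Qed.

Let integral_spB S I : sp_adapted T G S ->
  (forall i, sqint P (fun w => I w i ord0)) ->
  (\int[P]_w (sqnorm (sp_integral B S w - I w)%R)%:E =
  (\sum_(i < p) sqnm P (fun w => sp_integral B S w i ord0 - I w i ord0))%:E)%E.
Proof.
move=> adS sI.
have e i : (fun w => (sp_integral B S w - I w) i ord0) =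
    (fun w => sp_integral B S w i ord0 - I w i ord0).
  by apply/funext => w; rewrite !mxE.
rewrite integral_sqnorm; last first.
  move=> i j; rewrite ord1 e; apply: sqintB => //.
  exact: (sp_integral_sqint H).
by congr EFin; apply: eq_bigr => i _; rewrite big_ord1 e.
Qed.

Lemma in_L2_sqint I : in_L2 P measurable I -> forall i, sqint P (fun w => I w i ord0).
Proof.
move=> [/mx_measurable_measurableP mI Ioo] i.
exact: (sqnorm_lty_sqint mI Ioo i ord0).
Qed.

Let cvg0_le (u : nat -> \bar R) : u n @[n --> \oo] --> 0%E -> forall e, 0 < e ->
  \forall n \near \oo, (u n <= e%:E)%E.
Proof.
move=> /fine_cvgP[fu /cvgrPdist_le cu] e /cu; move: fu; apply: filterS2 => n fu /=.
rewrite sub0r normrN => h; rewrite -(fineK fu) lee_fin; apply: le_trans h.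
exact: ler_norm.
Qed.

Lemma ito_integral_approx Z I : is_ito_integral P T G B Z I -> in_M2 P T G Z ->
  forall e, 0 < e -> exists S, [/\ sp_adapted T G S,
    forall i j, sqnm nu (fun x => sp_val S x.2 x.1 i j - cut T Z x i j) <= e &
    forall i, sqnm P (fun w => sp_integral B S w i ord0 - I w i ord0) <= e].
Proof.
move=> [I2 [S [adS /cvg0_le SZ /cvg0_le SI]]] MZ e e0.
have [n _ /(_ n (leqnn n)) [h1 h2]] : \forall n \near \oo,
    (M2_sqnorm P T (fun t w => sp_val (S n) t w - Z t w)%R <= e%:E)%E /\
    (\int[P]_w (sqnorm (sp_integral B (S n) w - I w)%R)%:E <= e%:E)%E.
  by move: (SZ e e0) (SI e e0); apply: filterS2.
exists (S n); split => // [i j|i].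
- move: h1; rewrite (M2_spB (adS n) (in_M2_sqint MZ)) lee_fin; apply: le_trans.
  rewrite (bigD1 i)//= (bigD1 j)//= -addrA lerDl; apply: addr_ge0.
    by apply: sumr_ge0 => l _; exact: sqnm_ge0.
  by apply: sumr_ge0 => k _; apply: sumr_ge0 => l _; exact: sqnm_ge0.
- move: h2; rewrite (integral_spB (adS n) (in_L2_sqint I2)) lee_fin; apply: le_trans.
  rewrite (bigD1 i)//= lerDl.
  by apply: sumr_ge0 => l _; exact: sqnm_ge0.
Qed.

(** A single rate [u] bounds all entries, so both convergences follow by squeezing finite sums. *)
Lemma ito_integral_intro (S : nat ->
  @simple_process d0 Omega R p d) Z I (u : nat -> R) :
  in_L2 P measurable I -> (forall n, sp_adapted T G (S n)) ->
  (forall i j, sqint nu (fun x => cut T Z x i j)) ->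
  (forall n i j, sqnm nu (fun x => sp_val (S n) x.2 x.1 i j - cut T Z x i j) <= u n) ->
  (forall n i, sqnm P (fun w => sp_integral B (S n) w i ord0 - I w i ord0) <= u n) ->
  u n @[n --> \oo] --> (0 : R) -> is_ito_integral P T G B Z I.
Proof.
move=> I2 adS sZ SZ SI u0; split => //; exists S.
have cv (v : nat -> R) (c : R) : (forall n, 0 <= v n <= c * u n) ->
    (v n)%:E @[n --> \oo] --> 0%E.
  move=> vu; apply/cvg_EFin; first exact: nearW.
  apply: (@squeeze_cvgr _ _ _ _ (fun=> 0) (fun n => c * u n)).
  - by apply: nearW.
  - exact: cvg_cst.
  - rewrite -[X in _ --> X](mulr0 c); apply: cvgM => //; exact: cvg_cst.
split => //.
- rewrite (_ : (fun _ => _) = fun n => (\sum_(i < p) \sum_(j < d)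
      sqnm nu (fun x => sp_val (S n) x.2 x.1 i j - cut T Z x i j))%:E); last first.
    by apply/funext => n; exact: M2_spB.
  apply: (cv _ (p%:R * d%:R)) => n; apply/andP; split.
    by apply: sumr_ge0 => i _; apply: sumr_ge0 => j _; exact: sqnm_ge0.
  apply: (@le_trans _ _ (\sum_(i < p) \sum_(j < d) u n)).
    by apply: ler_sum => i _; apply: ler_sum => j _; exact: SZ.
  by rewrite !sumr_const !card_ord -[u n *+ d]mulr_natl -[_ *+ p]mulr_natl mulrA.
- rewrite (_ : (fun _ => _) = fun n =>
      (\sum_(i < p) sqnm P (fun w =>
        sp_integral B (S n) w i ord0 - I w i ord0))%:E); last first.
    by apply/funext => n; apply: integral_spB => //; exact: in_L2_sqint.
  apply: (cv _ p%:R) => n; apply/andP; split.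
    by apply: sumr_ge0 => i _; exact: sqnm_ge0.
  apply: (@le_trans _ _ (\sum_(i < p) u n)); first by apply: ler_sum => i _; exact: SI.
  by rewrite sumr_const card_ord -[u n *+ p]mulr_natl.
Qed.

(** Orthogonality holds for simple integrals. Replacing I by one of them costs, by Jensen's
    inequality, at most (|M| + 1)^2 e' in the squared mean, where M bounds X. *)
Lemma ito_integral_orth Z I X : is_ito_integral P T G B Z I -> in_M2 P T G Z ->
  adm P B A0 0 X -> forall i, \int[P]_w (X w * I w i ord0) = 0.
Proof.
move=> ZI MZ aX i; have [I2 _] := ZI; have sI := in_L2_sqint I2 i.
have T0 : 0 <= T := ltW (noise_gt0 H).
have [_ [M XM]] := aX.
have M0 : 0 <= `|M| + 1 by rewrite addr_ge0.
apply/eqP; rewrite -sqrf_eq0 eq_le sqr_ge0 andbT; apply/ler_addgt0Pl => e e0.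
rewrite addr0; pose e' := e / (`|M| + 1) ^+ 2.
have e'0 : 0 < e' by rewrite divr_gt0// exprn_gt0// ltr_wpDl.
have [S [adS _ /(_ i) SI]] := ito_integral_approx ZI MZ e'0.
have sS := sp_integral_sqint H adS i.
have sD := sqintB sS sI.
have XS := sqint_admM H T0 aX sS; have XI := sqint_admM H T0 aX sI.
have XD := sqint_admM H T0 aX sD.
have -> : \int[P]_w (X w * I w i ord0) =
    - \int[P]_w (X w * (sp_integral B S w i ord0 - I w i ord0)).
  have e_ : \int[P]_w (X w * (sp_integral B S w i ord0 - I w i ord0)) =
      \int[P]_w (X w * sp_integral B S w i ord0) - \int[P]_w (X w * I w i ord0).
    rewrite -RintegralB//; [|exact: sqint_intg|exact: sqint_intg].
    by apply: eq_Rintegral => w _; rewrite mulrBr.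
  by rewrite e_ (sp_integral_orth H adS i aX) sub0r opprK.
rewrite sqrrN; apply: (le_trans (sqr_Rintegral_le XD)).
apply: (@le_trans _ _ (sqnm P (fun w =>
  (`|M| + 1) * (sp_integral B S w i ord0 - I w i ord0)))).
  apply: sqnm_le => //; first exact: sqintZ.
  move=> w; rewrite !normrM ler_wpM2r// (ger0_norm M0).
  by rewrite (le_trans (XM w))// (le_trans (ler_norm M))// lerDl.
by rewrite sqnmZ// mulrC -ler_pdivlMr// exprn_gt0// ltr_wpDl.
Qed.

(** The isometry leads back from integrals to integrands: simple approximations of the two integrals
    are close to each other, hence so are the simple processes. *)
Lemma ito_integral_inj Z Z' I I' : in_M2 P T G Z -> in_M2 P T G Z' ->
  is_ito_integral P T G B Z I -> is_ito_integral P T G B Z' I' ->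
  {ae P, forall w, I w = I' w} ->
  {ae nu, forall x, cut T Z x = cut T Z' x}.
Proof.
move=> MZ MZ' ZI ZI' II'.
have [I2 _] := ZI; have [I2' _] := ZI'.
have sI := in_L2_sqint I2; have sI' := in_L2_sqint I2'.
have sZ := in_M2_sqint MZ; have sZ' := in_M2_sqint MZ'.
have zero i j : sqnm nu (fun x => cut T Z x i j - cut T Z' x i j) = 0.
  apply/eqP; rewrite eq_le sqnm_ge0 andbT; apply/ler_addgt0Pl => e e0; rewrite addr0.
  (* The integrals of S and S' are within 2 e' + 2 (2 e') = 6 e', then S is within 2 (6 e') + 2 e' =
     14 e' of Z', and Z within 2 e' + 2 (14 e') = 30 e' of Z'. *)
  pose e' := e / 30; have e'0 : 0 < e' by rewrite divr_gt0.
  have [S [adS SZ SI]] := ito_integral_approx ZI MZ e'0.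
  have [S' [adS' SZ' SI']] := ito_integral_approx ZI' MZ' e'0.
  have sS := sp_integral_sqint H adS i; have sS' := sp_integral_sqint H adS' i.
  have sv := sp_val_sqint H adS i j; have sv' := sp_val_sqint H adS' i j.
  have I0 : sqnm P (fun w => I w i ord0 - I' w i ord0) = 0.
    have [] // := @ae_sqnm0 _ _ _ P (fun w => I w i ord0 - I' w i ord0).
      by apply: filterS II' => w ->; rewrite subrr.
    by apply: measurable_funB; [case: (sI i)|case: (sI' i)].
  have SS' : sqnm nu (fun x => sp_val S x.2 x.1 i j - sp_val S' x.2 x.1 i j) <= 6 * e'.
    apply: (@le_trans _ _ (sqnm P (fun w =>
      sp_integral B S w i ord0 - sp_integral B S' w i ord0))).
      rewrite (@eq_sqnm _ _ _ P _ (fun w =>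
        (sp_integral B S w - sp_integral B S' w) i ord0)); last first.
        by move=> w; rewrite !mxE.
      rewrite (sp_isometry H adS adS') (bigD1 j)//=.
      rewrite [X in X + _](@eq_sqnm _ _ _ nu _ (fun x =>
        sp_val S x.2 x.1 i j - sp_val S' x.2 x.1 i j)).
        by rewrite lerDl; apply: sumr_ge0 => l _; exact: sqnm_ge0.
      by move=> x; rewrite !mxE.
    apply: (le_trans (sqnm_triangle3 sS (sI i) sS')).
    have h1 := SI i.
    have h2 : sqnm P (fun w => I w i ord0 - sp_integral B S' w i ord0) <= 2 * e'.
      apply: (le_trans (sqnm_triangle3 (sI i) (sI' i) sS')).
      by rewrite I0 mulr0 add0r ler_wpM2l// sqnmBC.
    by lra.
  apply: (le_trans (sqnm_triangle3 (sZ i j) sv (sZ' i j))).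
  have h1 : sqnm nu (fun x => cut T Z x i j - sp_val S x.2 x.1 i j) <= e'.
    by rewrite sqnmBC; exact: SZ.
  have h2 : sqnm nu (fun x => sp_val S x.2 x.1 i j - cut T Z' x i j) <= 14 * e'.
    apply: (le_trans (sqnm_triangle3 sv sv' (sZ' i j))).
    have := SZ' i j; lra.
  rewrite /e' in h1 h2 *; lra.
have : {ae nu, forall x, forall ij : 'I_p * 'I_d,
    cut T Z x ij.1 ij.2 - cut T Z' x ij.1 ij.2 = 0}.
  apply: filter_forall => -[i j]; apply: sqnm0_ae (zero i j).
  exact: sqintB.
apply: filterS => x h; apply/matrixP => i j.
by apply/eqP; rewrite -subr_eq0; apply/eqP; exact: (h (i, j)).
Qed.

End ito_integral.

(** * The representation *)

Section representation.
Context (d0 : measure_display) (Omega : measurableType d0) (R : realType)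
  (P : probability Omega R) (T : R) (d : nat) (B : R -> Omega -> 'cV[R]_d)
  (A0 : set (set Omega)).
Hypothesis H : noise P T B A0.
Local Notation G := (fun t => <<s GX P B A0 t >>).
Local Notation leb := (@lebesgue_measure R).
Local Notation nu := (P \x leb)%E.
Variable k : nat.

Let T0 : 0 < T := noise_gt0 H.

Definition grid_process n (c : 'I_k -> nat -> 'I_d -> Omega -> R) :=
  @SimpleProcess d0 Omega R k d n (gridt T n) (fun i w => \matrix_(r, l) c r i l w).

Lemma grid_process_adapted n c : (0 < n)%N ->
  (forall r i l, (i < n)%N -> adm P B A0 (gridt T n i) (c r i l)) ->
  sp_adapted T G (grid_process n c).
Proof.
move=> n0 ac; split => //=.
- by rewrite gridt0 gridtn.
- by move=> l _; exact: (gridt_lt H).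
- move=> i ilen; apply/mx_measurableP => r l.
  rewrite (_ : (fun _ => _) = c r i l); first by case: (ac r i l ilen).
  by apply/funext => w; rewrite mxE.
have /choice[M hM] (q : 'I_k * 'I_n * 'I_d) : exists M, forall w, `|c q.1.1
  q.1.2 q.2 w| <= M.
  by have [_] := ac q.1.1 q.1.2 q.2 (ltn_ord _).
exists (\sum_q `|M q|) => i w r l ilen; rewrite mxE.
have := hM (r, Ordinal ilen, l) w => /= h; apply: (le_trans h).
rewrite (bigD1 (r, Ordinal ilen, l))//=; apply: (le_trans (ler_norm _)).
by rewrite lerDl sumr_ge0.
Qed.

Lemma grid_process_integral n c r w :
  sp_integral B (grid_process n c) w r ord0 = grid_sum T B n (c r) w.
Proof.
rewrite sp_integralE /= -(pair_bigA _ (fun (i : 'I_n) (l : 'I_d) =>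
  (\matrix_(r, l) c r i l w) r l * dB B (gridt T n i) (gridt T n i.+1) l w))/=.
by apply: eq_bigr => i _; apply: eq_bigr => l _; rewrite mxE.
Qed.

(** The rows are approximated separately, but a simple process has one time partition for all rows.
    Approximability on every fine grid provides it. *)
Lemma common_grid (Y : 'I_k -> Omega -> R) e : 0 < e ->
  (forall r, approx P T B A0 (Y r)) ->
  exists (N0 : 'I_k -> Omega -> R) (S : @simple_process d0 Omega R k d),
    [/\ forall r, gmeas A0 (N0 r), forall r, bnd (N0 r), sp_adapted T G S &
      forall r, sqnm P (fun w => Y r w - (N0 r w + sp_integral B S w r ord0)) <= e].
Proof.
move=> e0 aY.
have /choice[n0 hn0] r : exists n0, forall n, (0 < n)%N -> (n0 <= n)%N ->
  grid_approx P T B A0 n (Y r) e by have [_ /(_ e e0)] := aY r.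
(* The successor makes [n] positive even when the maximum is 0. *)
pose n := (\max_(r < k) n0 r).+1.
have /choice[Nc hN] r : exists Nc : (Omega -> R) * (nat -> 'I_d -> Omega -> R),
    [/\ gmeas A0 Nc.1, bnd Nc.1,
      forall i l, (i < n)%N -> adm P B A0 (gridt T n i) (Nc.2 i l) &
      sqnm P (fun w => Y r w - (Nc.1 w + grid_sum T B n Nc.2 w)) <= e].
  have [//||N0 [c h]] := hn0 r n _ _; last by exists (N0, c).
  by apply: leqW; exact: leq_bigmax.
exists (fun r => (Nc r).1), (grid_process n (fun r => (Nc r).2)); split.
- by move=> r; case: (hN r).
- by move=> r; case: (hN r).
- by apply: grid_process_adapted => // r i l ilen; case: (hN r) => _ _ ac _; exact: ac.
move=> r; case: (hN r) => _ _ _; apply: le_trans; rewrite le_eqVlt; apply/orP; left.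
by apply/eqP; apply: eq_sqnm => w; rewrite grid_process_integral.
Qed.

(** Testing the difference U on the event U >= 0 and on its complement, both in <<s A0>>, gives E
    |U| = 0. *)
Lemma A0_ae_eq (X Y : Omega -> R) : gmeas A0 X -> gmeas A0 Y ->
  sqint P X -> sqint P Y ->
  (forall D, <<s A0 >> D -> \int[P]_w (\1_D w * X w) = \int[P]_w (\1_D w * Y w)) ->
  {ae P, forall w, X w = Y w}.
Proof.
move=> mX mY sX sY XY; pose U w := X w - Y w.
have mU : gmeas A0 U by exact: measurable_funB.
have sU : sqint P U by exact: sqintB.
have mind D : <<s A0 >> D -> measurable_fun setT (\1_D : Omega -> R).
  by move=> AD; apply: measurable_indic; exact: (noise_meas H).
have ind1 (D : set Omega) w : `|\1_D w : R| <= 1.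
  by rewrite indicE; case: (_ \in _); rewrite /= ?normr0 ?normr1.
have sI D Z : <<s A0 >> D -> sqint P Z -> sqint P (fun w => \1_D w * Z w).
  by move=> AD sZ; apply: (sqint_bndM (M := 1)) => //; exact: mind.
have U0 D : <<s A0 >> D -> \int[P]_w (\1_D w * U w) = 0.
  move=> AD; rewrite (@eq_Rintegral _ _ _ _ _ (fun w => \1_D w * X w - \1_D w * Y w)).
    rewrite RintegralB//; [|exact: sqint_intg (sI _ _ AD sX)|exact: sqint_intg
      (sI _ _ AD sY)].
    by rewrite XY// subrr.
  by move=> w _; rewrite /U mulrBr.
pose D := U @^-1` `[0, +oo[%classic.
have AD : <<s A0 >> D by apply: gmeas_preimage => //; exact: measurable_itv.
have ADc : <<s A0 >> (~` D) by rewrite -setTD; exact: sigma_algebraCD.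
have absU w : `|U w| = \1_D w * U w - \1_(~` D) w * U w.
  rewrite !indicE in_setC; have [wD|wD] := boolP (w \in D) => /=.
    rewrite mul1r mul0r subr0 ger0_norm//.
    by move: wD; rewrite inE /D/= in_itv/= andbT.
  rewrite mul1r mul0r sub0r ltr0_norm// ltNge.
  by apply: contra wD => U_ge0; rewrite inE /D/= in_itv/= U_ge0.
have : \int[P]_w `|U w| = 0.
  rewrite (eq_Rintegral _ (fun w _ => absU w)).
  rewrite RintegralB//; [|exact: sqint_intg (sI _ _ AD sU)|exact: sqint_intg
    (sI _ _ ADc sU)].
  by rewrite !U0// subrr.
have iU : intg P (fun w => `|U w|) := intg_norm (sqint_intg sU).
move=> U00; have : (\int[P]_(w in setT) `|(U w)%:E| = 0)%E.
  by rewrite (EFin_Rintegral iU) U00.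
have mU' : measurable_fun setT (fun w => (U w)%:E).
  by apply/measurable_EFinP; case: sU.
move/(ae_eq_integral_abs P measurableT mU').
by apply: filterS => w /= /(_ I) [] /eqP; rewrite /U subr_eq0 => /eqP.
Qed.

Theorem brownian_representation (N : Omega -> 'cV[R]_k) : in_L2 P (G T) N ->
  exists (N0 : Omega -> 'cV[R]_k) (Z : R -> Omega -> 'M[R]_(k, d)),
    [/\ [/\ in_L2 P <<s A0 >> N0, in_M2 P T G Z &
            ito_representation P T G B N N0 Z],
        forall (N0' : Omega -> 'cV[R]_k) (Z' : R -> Omega -> 'M[R]_(k, d)),
          in_L2 P <<s A0 >> N0' -> in_M2 P T G Z' ->
          ito_representation P T G B N N0' Z' ->
          {ae P, forall w, N0' w = N0 w} /\
          {ae (P \x @lebesgue_measure R)%E, forall x : Omega * R,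
             0 <= x.2 <= T -> Z' x.2 x.1 = Z x.2 x.1} &
        is_cond_exp P <<s A0 >> N N0].
Proof.
move=> [/mx_measurableP mN Noo].
have GTm := GX_measurable H (lexx T).
have mN' i j : measurable_fun setT (fun w =>
  N w i j) by exact: gmeas_measurable (mN i j).
have sN i : sqint P (fun w => N w i ord0) by exact: (sqnorm_lty_sqint mN').
have aN i : approx P T B A0 (fun w => N w i ord0) by exact: (L2_approx H).
(* The divisor 4 is chosen so that two such errors combine through [sqnm_triangle3] to the rate 4^-q
   that [riesz_fischer] asks for. *)
have e4 q : 0 < 4^-1 ^+ q / 4 :> R by rewrite divr_gt0// exprn_gt0.
have /choice[NS hNS] q : exists NS : ('I_k -> Omega ->
  R) * (@simple_process d0 Omega R k d),
    [/\ forall r, gmeas A0 (NS.1 r), forall r, bnd (NS.1 r), sp_adapted T G NS.2 &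
      forall r, sqnm P (fun w => N w r ord0 - (NS.1 r w + sp_integral B NS.2 w r ord0))
        <= 4^-1 ^+ q / 4].
  by have [N0 [S h]] := common_grid (e4 q) aN; exists (N0, S).
pose N_ q := (NS q).1; pose S_ q := (NS q).2.
have mN_ q r : gmeas A0 (N_ q r) by have [h _ _ _] := hNS q; exact: h.
have bN_ q r : bnd (N_ q r) by have [_ h _ _] := hNS q; exact: h.
have adS q : sp_adapted T G (S_ q) by have [_ _ h _] := hNS q.
have close q r : sqnm P (fun w =>
  N w r ord0 - (N_ q r w + sp_integral B (S_ q) w r ord0))
    <= 4^-1 ^+ q / 4 by have [_ _ _ h] := hNS q; exact: h.
have sN_ q r : sqint P (N_ q r) by exact: (A0_sqint H).
have sI_ q r : sqint P (fun w =>
  sp_integral B (S_ q) w r ord0) by exact: (sp_integral_sqint H).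
have sv_ q r l : sqint nu (fun x =>
  sp_val (S_ q) x.2 x.1 r l) by exact: (sp_val_sqint H).
have le4 q m : (q <= m)%N -> 4^-1 ^+ m <= 4^-1 ^+ q :> R.
  by move=> qm; rewrite ler_wiXn2l//; lra.
(* Pythagoras: the differences of the <<s A0>>-measurable parts are orthogonal to those of the
   integrals, so the bound on the sum controls each part, and the isometry turns the second into a
   bound on the integrands. *)
have pyth q m r : (q <= m)%N ->
    sqnm P (fun w => N_ q r w - N_ m r w) +
    \sum_(l < d) sqnm nu (fun x =>
      sp_val (S_ q) x.2 x.1 r l - sp_val (S_ m) x.2 x.1 r l)
    <= 4^-1 ^+ q.
  move=> qm; pose DI w := (sp_integral B (S_ q) w - sp_integral B (S_ m) w) r ord0.
  have sDI : sqint P DI by exact: (sp_integralB_sqint H).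
  have sDN : sqint P (fun w => N_ q r w - N_ m r w) by exact: sqintB.
  have aDN : adm P B A0 0 (fun w => N_ q r w - N_ m r w).
    apply: A0_adm; first exact: measurable_funB.
    by rewrite (_ : (fun _ => _) = fun w => N_ q r w + (-1) * N_ m r w);
      [apply: bndD => //; apply: bndM => //; exact: bnd_cst|apply/funext => w; ring].
  have orth : \int[P]_w ((N_ q r w - N_ m r w) * DI w) = 0.
    have s1 := sqint_admM H (ltW T0) aDN (sI_ q r).
    have s2 := sqint_admM H (ltW T0) aDN (sI_ m r).
    transitivity (\int[P]_w ((N_ q r w - N_ m r w) * sp_integral B (S_ q) w r ord0 -
        (N_ q r w - N_ m r w) * sp_integral B (S_ m) w r ord0)).
      by apply: eq_Rintegral => w _; rewrite /DI !mxE mulrBr.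
    rewrite RintegralB//; [|exact: sqint_intg s1|exact: sqint_intg s2].
    by rewrite !(sp_integral_orth H)// subrr.
  have -> : \sum_(l < d) sqnm nu (fun x =>
    sp_val (S_ q) x.2 x.1 r l - sp_val (S_ m) x.2 x.1 r l)
      = sqnm P DI.
    rewrite /DI (sp_isometry H (adS q) (adS m)); apply: eq_bigr => l _.
    by apply: eq_sqnm => x; rewrite !mxE.
  have -> : sqnm P (fun w => N_ q r w - N_ m r w) + sqnm P DI =
      sqnm P (fun w => (N_ q r w - N_ m r w) + DI w).
    by rewrite (sqnmD sDN sDI) [X in 2 * X](_ : _ = 0) ?mulr0 ?addr0//; exact: orth.
  rewrite (@eq_sqnm _ _ _ P _ (fun w => (N_ q r w + sp_integral B (S_ q) w r ord0) -
      (N_ m r w + sp_integral B (S_ m) w r ord0))); last first.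
    by move=> w; rewrite /DI !mxE; ring.
  apply: (le_trans (sqnm_triangle3 (sqintD (sN_ q r) (sI_ q r)) (sN r) (sqintD
    (sN_ m r) (sI_ m r)))).
  by have := le4 _ _ qm; have := close m r; have := close q r; rewrite sqnmBC; lra.
have fastN r q m : (q <= m)%N -> sqnm P (fun w => N_ q r w - N_ m r w) <= 4^-1 ^+ q.
  move=> qm; apply: le_trans (pyth q m r qm); rewrite lerDl.
  by apply: sumr_ge0 => l _; exact: sqnm_ge0.
have fastS r l q m : (q <= m)%N ->
    sqnm nu (fun x => sp_val (S_ q) x.2 x.1 r l - sp_val (S_ m) x.2 x.1 r l) <=
      4^-1 ^+ q.
  move=> qm; apply: le_trans (pyth q m r qm); rewrite (bigD1 l)//= addrCA lerDl.
  by rewrite addr_ge0 ?sqnm_ge0//; apply: sumr_ge0 => l' _; exact: sqnm_ge0.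
pose N0 w : 'cV[R]_k := \col_r seq_lim (fun q => N_ q r) w.
(* The limit is taken at each time [t] separately, so Z is adapted at every [t], while the same
   formula in (w, t) gives joint measurability. *)
pose Z t w : 'M[R]_(k, d) := \matrix_(r, l) seq_lim (fun q w =>
  sp_val (S_ q) t w r l) w.
have N0E r : (fun w => N0 w r ord0) = seq_lim (fun q => N_ q r).
  by apply/funext => w; rewrite mxE.
have ZE r l : (fun x : Omega * measurableTypeR R => Z x.2 x.1 r l) =
    seq_lim (fun q x => sp_val (S_ q) x.2 x.1 r l).
  by apply/funext => x; rewrite mxE.
have RN r := riesz_fischer (fun q => sN_ q r) (fastN r).
have RS r l := riesz_fischer (fun q => sv_ q r l) (fastS r l).
have sN0 r : sqint P (fun w => N0 w r ord0) by rewrite N0E; case: (RN r).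
have sZ r l : sqint nu (fun x : Omega * measurableTypeR R => Z x.2 x.1 r l).
  by rewrite ZE; case: (RS r l).
have mN0 r : gmeas A0 (fun w => N0 w r ord0).
  by rewrite N0E; apply: measurable_seq_lim => q; exact: mN_.
have L2N0 : in_L2 P <<s A0 >> N0.
  split; first by apply/mx_measurableP => i j; rewrite ord1.
  by rewrite integral_sqnorm ?ltry// => i j; rewrite ord1.
have mcZ r l : measurable_fun setT (fun x => cut T Z x r l).
  rewrite (_ : (fun _ => _) = fun x : Omega * measurableTypeR R =>
    \1_(`[0, T]%classic) x.2 * Z x.2 x.1 r l); last by apply/funext => x; rewrite cutE.
  apply: measurable_funM; last by case: (sZ r l).
  by apply: measurableT_comp => //; apply: measurable_indic; exact: measurable_itv.
have ind1 (x : measurableTypeR R) : `|\1_(`[0, T]%classic) x : R| <= 1.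
  by rewrite indicE; case: (_ \in _); rewrite /= ?normr0 ?normr1.
have scZ r l : sqint nu (fun x => cut T Z x r l).
  apply: (sqint_le (mcZ r l) _ (sZ r l)) => x.
  by rewrite cutE normrM ler_piMl.
have M2Z : in_M2 P T G Z.
  split.
  - by move=> r l; apply: measurable_funTS; case: (sZ r l).
  - move=> t tT; apply/mx_measurableP => r l.
    rewrite (_ : (fun _ => _) = seq_lim (fun q w => sp_val (S_ q) t w r l)); last first.
      by apply/funext => w; rewrite mxE.
    by apply: measurable_seq_lim => q; exact: (sp_val_adapted (adS q) r tT).
  - by rewrite M2_sqnormE// integral_sqnorm// ltry.
(* The integral is defined as what the representation requires, and then shown to be the limit of
   the simple integrals. *)
pose I0 w : 'cV[R]_k := N w - N0 w.
have I0E r : (fun w => I0 w r ord0) = fun w => N w r ord0 - N0 w r ord0.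
  by apply/funext => w; rewrite !mxE.
have sI0 r : sqint P (fun w => I0 w r ord0) by rewrite I0E; exact: sqintB.
have ItoZ : is_ito_integral P T G B Z I0.
  (* The error of the integrals is at most 2 (4^-q / 4) + 2 * 4^-q, which the factor 3 covers. *)
  apply: (ito_integral_intro H (S := S_) (u := fun q => 3 * 4^-1 ^+ q)) => //.
  - split; first by apply/mx_measurable_measurableP => r j; rewrite ord1; case: (sI0 r).
    by rewrite integral_sqnorm ?ltry// => i j; rewrite ord1.
  - move=> q r l; apply: (@le_trans _ _ (4^-1 ^+ q)); last first.
      by have := exprn_ge0 q (ltac:(lra) : 0 <= 4^-1 :> R); lra.
    have [_ /(_ q)] := RS r l; rewrite -ZE; apply: le_trans.
    apply: sqnm_le; [exact: sqintB|exact: sqintB|].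
    by move=> x; rewrite cutE -{1}(sp_val_out (adS q)) -mulrBr normrM ler_piMl.
  - move=> q r.
    rewrite (@eq_sqnm _ _ _ P _ (fun w =>
        - (N w r ord0 - (N_ q r w + sp_integral B (S_ q) w r ord0)) +
        - (N_ q r w - N0 w r ord0))); last by move=> w; rewrite !mxE; ring.
    apply: (le_trans (sqnmD_le _ _)).
    + by apply: sqintN; apply: sqintB => //; exact: sqintD.
    + by apply: sqintN; exact: sqintB.
    rewrite !sqnmN; have := close q r.
    by have [_ /(_ q)] := RN r; rewrite -N0E; have := e4 q; lra.
  - rewrite -[X in _ --> X](mulr0 3); apply: cvgM; first exact: cvg_cst.
    by apply: cvg_expr; rewrite ger0_norm//; lra.
have repZ : ito_representation P T G B N N0 Z.
  by exists I0 => //; apply: aeW => w; rewrite /I0 addrC subrK.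
have adm_ind D : <<s A0 >> D -> adm P B A0 0 (\1_D : Omega -> R).
  move=> AD; apply: A0_adm; first exact: gmeas_indic.
  by exists 1 => w; rewrite indicE; case: (_ \in _); rewrite /= ?normr0 ?normr1.
have indS D f : <<s A0 >> D -> sqint P f -> intg P (fun w => \1_D w * f w).
  by move=> AD sf; exact: sqint_intg (sqint_admM H (ltW T0) (adm_ind D AD) sf).
have L2s (N1 : Omega -> 'cV[R]_k) : in_L2 P <<s A0 >> N1 ->
    forall r, gmeas A0 (fun w => N1 w r ord0) /\ sqint P (fun w => N1 w r ord0).
  move=> [/mx_measurableP mN1 N1oo] r; split => //.
  apply: (sqnorm_lty_sqint (X := N1)) => // i j.
  by apply: gmeas_measurable (mN1 i j); exact: (noise_meas H).
(* Tested on an event of <<s A0>>, the integral of any representation vanishes. This identifies its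
   first component as the conditional expectation, and serves for uniqueness of N0 as well. *)
have ceq (N1 : Omega -> 'cV[R]_k) (Z1 : R -> Omega -> 'M[R]_(k, d)) :
    in_L2 P <<s A0 >> N1 -> in_M2 P T G Z1 -> ito_representation P T G B N N1 Z1 ->
    forall D, <<s A0 >> D -> forall r,
    \int[P]_w (\1_D w * N1 w r ord0) = \int[P]_w (\1_D w * N w r ord0).
  move=> L2N1 MZ1 [I1 ItoI1 NI1] D AD r.
  have [_ sN1] := L2s _ L2N1 r.
  have sI1 := in_L2_sqint ItoI1.1 r.
  transitivity (\int[P]_w (\1_D w * N1 w r ord0 + \1_D w * I1 w r ord0)).
    rewrite RintegralD//; [|exact: indS|exact: indS].
    by rewrite (ito_integral_orth H ItoI1 MZ1 (adm_ind D AD)) addr0.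
  congr fine; apply: ae_eq_integral => //.
  - by apply/measurable_EFinP/measurable_funD; apply: intg_meas; exact: indS.
  - by apply/measurable_EFinP; apply: intg_meas; exact: indS.
  - by apply: filterS NI1 => w -> _; rewrite mxE mulrDr.
exists N0, Z; split => //.
- move=> N1 Z1 L2N1 MZ1 repZ1.
  have NN1 : {ae P, forall w, N1 w = N0 w}.
    have : {ae P, forall w, forall r, N1 w r ord0 = N0 w r ord0}.
      apply: filter_forall => r; have [mN1 sN1] := L2s _ L2N1 r.
      apply: A0_ae_eq => // D AD.
      by rewrite (ceq _ _ L2N1 MZ1 repZ1)// (ceq _ _ L2N0 M2Z repZ).
    by apply: filterS => w h; apply/matrixP => r j; rewrite ord1.
  split => //; have [I1 ItoI1 NI1] := repZ1.
  have II : {ae P, forall w, I1 w = I0 w}.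
    move: NN1 NI1; apply: filterS2 => w e1 e2.
    by rewrite /I0 e2 e1 addrAC subrr add0r.
  have := ito_integral_inj H MZ1 M2Z ItoI1 ItoZ II.
  apply: filterS => -[w t] /= e tT; move: e; rewrite /cut/= indicE mem_set/= ?scale1r//.
- have intE (f : Omega -> R) D : <<s A0 >> D -> sqint P f ->
      (\int[P]_(w in D) (f w)%:E = (\int[P]_w (\1_D w * f w))%:E)%E.
    move=> AD sf; rewrite -EFin_Rintegral; last exact: indS.
    rewrite [LHS]integral_mkcond; apply: eq_integral => w _.
    by rewrite patchE indicE; case: (w \in D); rewrite ?mul1r ?mul0r.
  split.
  + by case: L2N0.
  + by move=> i j; rewrite ord1; exact: (sqint_intg (sN0 i)).
  + move=> D AD i j; rewrite ord1 intE// intE//; congr EFin.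
    exact: (ceq _ _ L2N0 M2Z repZ).
Qed.

End representation.

Theorem proposition2p1 (disp : measure_display) (Omega : measurableType disp)
    (R : realType) (P : probability Omega R) (T : R) (d k m : nat)
    (B : R -> Omega -> 'cV[R]_d) (alpha : R -> Omega -> 'I_m)
    (T_gt0 : 0 < T)
    (B_bm : brownian_motion P T B)
    (alpha_mc : markov_chain P T alpha)
    (B_alpha_indep :
      indep_sigma P (mx_filtration B T) (chain_filtration alpha T)) :
  let FalphaT := chain_filtration alpha T in
  let G := enlarged_filtration P T B alpha in
  forall N : Omega -> 'cV[R]_k, in_L2 P (G T) N ->
  exists (N0 : Omega -> 'cV[R]_k) (Z : R -> Omega -> 'M[R]_(k, d)),
    [/\ [/\ in_L2 P FalphaT N0, in_M2 P T G Z &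
            ito_representation P T G B N N0 Z],
        forall (N0' : Omega -> 'cV[R]_k) (Z' : R -> Omega -> 'M[R]_(k, d)),
          in_L2 P FalphaT N0' -> in_M2 P T G Z' ->
          ito_representation P T G B N N0' Z' ->
          {ae P, forall w, N0' w = N0 w} /\
          {ae (P \x @lebesgue_measure R)%E, forall x : Omega * R,
             0 <= x.2 <= T -> Z' x.2 x.1 = Z x.2 x.1} &
        is_cond_exp P FalphaT N N0].
Proof.
move=> FalphaT G N L2N.
have mA : FalphaT `<=` measurable.
  apply: gsa_sub_measurable => A [t]; rewrite /= in_itv/= => tT;
    exact: (mc_measurable alpha_mc tT).
(* With this generator, [<<s A0 >>] and [<<s GX P B A0 t >>] are by definition the sigma-algebras of
   the statement. *)
apply: (@brownian_representation _ _ _ _ _ _ _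
  (\bigcup_(t in `[0, T]) discrete_sigma (alpha t))) => //.
Qed.
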